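(* Let $p\in[1,+\infty]$, let $\Omega$ be a nonempty open subset of $\mathbb{R}^N$, of finite measure if $p\in[1,+\infty)$ and arbitrary if $p=+\infty$, and let $\omega$ be an admissible weight function in $\Omega$. If there exists a constant $k>0$ such that $k\le\omega(x,y)$ for all $(x,y)\in\Omega\times\Omega$, then $W^{1,p}_\omega(\Omega)\hookrightarrow W^{1,p}(\Omega)$. Moreover, the embedding $W^{1,p}(\Omega)\hookrightarrow W^{1,p}_\omega(\Omega)$ holds if and only if there exists a constant $K>0$ such that $f^p_\omega(x)\le K$ for all $x\in\Omega$, where, for all $x\in\Omega$, $$f^p_\omega(x):=\begin{cases}\int_\Omega\omega(x,y)^p\,\mathrm{d}y&\text{if }p\in[1,+\infty),\\ \operatorname{ess\,sup}_{y\in\Omega}\omega(x,y)&\text{if }p=+\infty.\end{cases}$$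
   Context: An admissible weight function in $\Omega$ is a function $\omega:\Omega\times\Omega\to[0,+\infty)$ belonging to $\mathcal{C}^1(\Omega\times\Omega)$ with $\omega(x,y)=\omega(y,x)$ for all $(x,y)$. For $\psi\in\mathcal{C}^1_c(\Omega\times\Omega)$ and $i=1,\dots,N$ put $$\partial^*_{\omega,i}(\psi)(x):=\int_\Omega\frac{\partial}{\partial x_i}\left[\omega(x,y)(\psi(y,x)-\psi(x,y))\right]\mathrm{d}y,\quad x\in\Omega.$$ A function $u\in L^1_{\mathrm{loc}}(\Omega)$ has weak $i$-th nonlocal partial derivative $\partial_{\omega,i}u\in L^1_{\mathrm{loc}}(\Omega\times\Omega)$ if $$\int_\Omega u(x)\,\partial^*_{\omega,i}(\psi)(x)\,\mathrm{d}x=-\int_{\Omega\times\Omega}\partial_{\omega,i}u(x,y)\,\psi(x,y)\,\mathrm{d}x\,\mathrm{d}y\quad\text{for all }\psi\in\mathcal{C}^1_c(\Omega\times\Omega);$$ it is unique a.e. Put $\nabla_\omega u:=(\partial_{\omega,1}u,\dots,\partial_{\omega,N}u)$. Then $W^{1,p}_\omega(\Omega):=\{u\in L^p(\Omega):\nabla_\omega u\in L^p(\Omega\times\Omega;\mathbb{R}^N)\}$ with norm $\|u\|_{L^p(\Omega)}+\|\nabla_\omega u\|_{L^p(\Omega\times\Omega;\mathbb{R}^N)}$, the $L^p$ norm of a vector field being the $L^p$ norm of its pointwise Euclidean norm. $W^{1,p}(\Omega)$ is the classical Sobolev space with norm $\|u\|_{L^p(\Omega)}+\|\nabla u\|_{L^p(\Omega;\mathbb{R}^N)}$.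 $X\hookrightarrow Y$ means $X\subset Y$ and there is $C>0$ with $\|u\|_Y\le C\|u\|_X$ for all $u\in X$. *)

(* Defs.v *)
From HB Require Import structures.
From mathcomp Require Import all_boot all_order all_algebra.
From mathcomp Require Import all_classical all_reals all_analysis.
From mathcomp Require Import ess_sup_inf.
Import Order.TTheory GRing.Theory Num.Theory.
Import numFieldNormedType.Exports.

Set Implicit Arguments.
Unset Strict Implicit.
Unset Printing Implicit Defensive.

Local Open Scope classical_set_scope.
Local Open Scope ring_scope.

(* 'rV[R]_n carries the sigma-algebra generated by the coordinate functions,
   as n.-tuple R does in the library; it is the Borel sigma-algebra. *)
Section measurable_rV.
Context {R : realType} (n : nat).

Definition rV_coord (i : 'I_n) (x : 'rV[R]_n) : R := x ord0 i.

Let rV_measurable0 : g_sigma_preimage rV_coord set0.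
Proof. exact: sigma_algebra0. Qed.

Let rV_measurableC A :
  g_sigma_preimage rV_coord A -> g_sigma_preimage rV_coord (~` A).
Proof. exact: sigma_algebraC. Qed.

Let rV_measurable_bigcup (F : _^nat) :
  (forall i, g_sigma_preimage rV_coord (F i)) ->
  g_sigma_preimage rV_coord (\bigcup_i F i).
Proof. exact: sigma_algebra_bigcup. Qed.

HB.instance Definition _ := @isMeasurable.Build
  (measure_tuple_display default_measure_display) 'rV[R]_n
  (g_sigma_preimage rV_coord)
  rV_measurable0 rV_measurableC rV_measurable_bigcup.

Lemma measurable_rV_coord (i : 'I_n) : measurable_fun setT (rV_coord i).
Proof.
move=> _ Y mY; rewrite setTI; apply: sub_sigma_algebra => /=.
rewrite -bigcup_seq/=; exists i => /=; first by rewrite mem_index_enum.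
by exists Y => //; rewrite setTI.
Qed.

Lemma measurable_fun_rVP d (T : measurableType d) (f : T -> 'rV[R]_n) :
  (forall i, measurable_fun setT (rV_coord i \o f)) -> measurable_fun setT f.
Proof.
move=> mf _ A; rewrite setTI; move: A.
pose G := [set A : set 'rV[R]_n | measurable (f @^-1` A)].
suff : g_sigma_preimage rV_coord `<=` G by [].
apply: smallest_sub.
  split.
  - by rewrite /G/= preimage_set0.
  - by move=> A mA; rewrite /G/= setTD preimage_setC; apply: measurableC.
  - by move=> F mF; rewrite /G/= preimage_bigcup; exact: bigcupT_measurable.
move=> A; rewrite -bigcup_seq => -[i _ [B mB <-]].
by rewrite setTI; have := mf i measurableT B mB; rewrite setTI.
Qed.

End measurable_rV.

(* The library's instance of this fact is shadowed by the one for
   subprobability measures. *)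
Lemma sigma_finite_product_measure (R : realType) d1 d2
    (T1 : measurableType d1) (T2 : measurableType d2)
    (m1 : {sigma_finite_measure set T1 -> \bar R})
    (m2 : {sigma_finite_measure set T2 -> \bar R}) :
  sigma_finite setT (m1 \x m2)%E.
Proof.
have /sigma_finiteP[F [TF ndF Foo]] := sigma_finiteT m1.
have /sigma_finiteP[G [TG ndG Goo]] := sigma_finiteT m2.
exists (fun n => F n `*` G n).
  rewrite -setXTT TF TG predeqE => -[x y]; split.
    move=> [/= [n _ Fnx] [k _ Gky]]; exists (maxn n k) => //; split.
    - by move: x Fnx; exact/subsetPset/ndF/leq_maxl.
    - by move: y Gky; exact/subsetPset/ndG/leq_maxr.
  by move=> [n _ []/= ? ?]; split; exists n.
move=> k; have [? ?] := Foo k; have [? ?] := Goo k.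
split; first exact: measurableX.
by rewrite product_measure1E// lte_mul_pinfty// ge0_fin_numE.
Qed.

Section rV_cons.
Context {R : realType} (n : nat).

Definition rV_cons (x : measurableTypeR R * 'rV[R]_n) : 'rV[R]_n.+1 :=
  \row_i (if unlift ord0 i is Some j then x.2 ord0 j else x.1).

Lemma measurable_rV_cons : measurable_fun setT rV_cons.
Proof.
apply: measurable_fun_rVP => i; rewrite /rV_cons /rV_coord.
case: (unliftP ord0 i) => [j ->|->].
  have -> : (fun x : 'rV[R]_n.+1 => x ord0 (lift ord0 j)) \o rV_cons
            = @rV_coord R n j \o snd.
    by apply/funext => x /=; rewrite mxE liftK.
  exact: measurableT_comp (measurable_rV_coord j) measurable_snd.
have -> : (fun x : 'rV[R]_n.+1 => x ord0 ord0) \o rV_cons = fst.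
  by apply/funext => x /=; rewrite mxE unlift_none.
exact: measurable_fst.
Qed.

Let rV_uncons (x : 'rV[R]_n.+1) : measurableTypeR R * 'rV[R]_n :=
  (x ord0 ord0, \row_j x ord0 (lift ord0 j)).

Let measurable_rV_uncons : measurable_fun setT rV_uncons.
Proof.
apply: measurable_fun_pair; first exact: (measurable_rV_coord ord0).
apply: measurable_fun_rVP => j; rewrite /rV_coord.
have -> : (fun x : 'rV[R]_n => x ord0 j) \o
    (fun x : 'rV[R]_n.+1 => \row_j0 x ord0 (lift ord0 j0))
    = @rV_coord R n.+1 (lift ord0 j).
  by apply/funext => x /=; rewrite mxE.
exact: measurable_rV_coord.
Qed.

Let rV_consK : cancel rV_cons rV_uncons.
Proof.
move=> [a v]; rewrite /rV_uncons mxE unlift_none /=; congr pair.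
by apply/rowP => j; rewrite !mxE liftK.
Qed.

Variable m : {sigma_finite_measure set 'rV[R]_n -> \bar R}.

Definition rV_cons_measure : set 'rV[R]_n.+1 -> \bar R :=
  pushforward (lebesgue_measure \x m)%E rV_cons.

Let rV_cons_measure0 : rV_cons_measure set0 = 0%E.
Proof. by rewrite /rV_cons_measure /pushforward preimage_set0 measure0. Qed.

Let rV_cons_measure_ge0 A : (0 <= rV_cons_measure A)%E.
Proof. by rewrite /rV_cons_measure /pushforward; exact: measure_ge0. Qed.

Let rV_cons_measure_sigma_additive : semi_sigma_additive rV_cons_measure.
Proof.
move=> F mF tF mUF; rewrite /rV_cons_measure /pushforward preimage_bigcup.
apply: measure_semi_sigma_additive.
- by move=> k; rewrite -[X in measurable X]setTI; exact: measurable_rV_cons.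
- apply/trivIsetP => /= i j _ _ ij; rewrite -preimage_setI.
  by move/trivIsetP : tF => /(_ _ _ _ _ ij) ->//; rewrite preimage_set0.
- rewrite -preimage_bigcup -[X in measurable X]setTI.
  exact: measurable_rV_cons.
Qed.

HB.instance Definition _ := isMeasure.Build _ _ _ rV_cons_measure
  rV_cons_measure0 rV_cons_measure_ge0 rV_cons_measure_sigma_additive.

Let rV_cons_measure_sigma_finite : sigma_finite setT rV_cons_measure.
Proof.
have [F FT Foo] := sigma_finite_product_measure (@lebesgue_measure R) m.
exists (fun k => rV_uncons @^-1` F k).
  by rewrite -preimage_bigcup -FT preimage_setT.
move=> k; have [mF Fk] := Foo k; split.
  by rewrite -[X in measurable X]setTI; exact: measurable_rV_uncons.
rewrite /rV_cons_measure /pushforward -comp_preimage.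
by rewrite (_ : rV_uncons \o rV_cons = id)//; apply/funext => x; exact: rV_consK.
Qed.

HB.instance Definition _ := Measure_isSigmaFinite.Build _ _ _ rV_cons_measure
  rV_cons_measure_sigma_finite.

End rV_cons.

(* n-dimensional Lebesgue measure on 'rV[R]_n, as an iterated product. *)
Fixpoint lebesgue_rV (R : realType) (n : nat) :
    {sigma_finite_measure set 'rV[R]_n -> \bar R} :=
  if n is n'.+1 then rV_cons_measure (lebesgue_rV R n') else \d_(0 : 'rV[R]_0).

Lemma lebesgue_rV_box (R : realType) (n : nat) (A : 'I_n -> set R) :
  (forall i, measurable (A i)) ->
  lebesgue_rV R n [set x | forall i, A i (x ord0 i)] =
  (\prod_(i < n) lebesgue_measure (A i))%E.
Proof.
elim: n A => [|n IHn] A mA.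
  by rewrite big_ord0 /= diracE mem_set// => -[].
rewrite big_ord_recl -IHn//= /rV_cons_measure /pushforward.
have mbox : measurable [set x : 'rV[R]_n | forall i, A (lift ord0 i) (x ord0 i)].
  rewrite (_ : mkset _ = \bigcap_(i in [set: 'I_n])
      (@rV_coord R n i @^-1` A (lift ord0 i))).
    apply: fin_bigcap_measurable => // i _.
    rewrite -[X in measurable X]setTI.
    exact: (measurable_rV_coord i measurableT (mA _)).
  by apply/seteqP; split=> x /= Ax i => [_|]; exact: Ax.
rewrite -product_measure1E//; last exact: mA.
congr (_ _); apply/seteqP; split=> -[a v] /=.
  move=> Aav; split=> [|i].
    by have := Aav ord0; rewrite /rV_cons mxE unlift_none.
  by have := Aav (lift ord0 i); rewrite /rV_cons mxE liftK.
move=> [Aa Av] i; rewrite /rV_cons mxE.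
by case: (unliftP ord0 i) => [j ->|->]//=; exact: Av.
Qed.

Section function_classes.
Context {R : realType}.

Definition C1_on (V : normedModType R) (D : set V) (f : V -> R) : Prop :=
  (forall x, D x -> differentiable f x) /\
  (forall v, {within D, continuous 'D_v f}).

Definition C1c (V : normedModType R) (D : set V) (f : V -> R) : Prop :=
  [/\ C1_on D f, compact (closure [set x | f x != 0])
    & closure [set x | f x != 0] `<=` D].

(* For D of positive measure the extension by 0 does not affect the case
   p = +oo. *)
Definition Lp_norm d (T : measurableType d) (mu : {measure set T -> \bar R})
    (p : \bar R) (D : set T) (f : T -> R) : \bar R :=
  ('N[mu]_p[(EFin \o f) \_ D])%E.

Definition in_Lp d (T : measurableType d) (mu : {measure set T -> \bar R})
    (p : \bar R) (D : set T) (f : T -> R) : Prop :=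
  measurable_fun D f /\ (Lp_norm mu p D f < +oo)%E.

(* The norm provided by the library on 'rV[R]_N is the sup norm. *)
Definition enorm (N : nat) (v : 'rV[R]_N) : R :=
  Num.sqrt (\sum_i v ord0 i ^+ 2).

Definition embeds (U : Type) (X : set U) (normX : U -> \bar R)
    (Y : set U) (normY : U -> \bar R) : Prop :=
  X `<=` Y /\
  exists2 C : R, 0 < C & forall u, X u -> (normY u <= C%:E * normX u)%E.

End function_classes.

(* Functions on Omega or on Omega x Omega are represented by total functions,
   whose values outside these sets are irrelevant. *)
Section sobolev.
Context {R : realType} {N : nat}.
Local Notation V := 'rV[R]_N.
Local Notation mu := (lebesgue_rV R N).
Local Notation mu2 := (mu \x mu)%E.
Implicit Types (p : \bar R) (Omega : set V) (i : 'I_N) (u : V -> R).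
Implicit Types (omega psi : V * V -> R).

Definition ebase i : V := delta_mx ord0 i.

Definition L1loc Omega u : Prop := measurable_fun Omega u /\
  forall K : set V, compact K -> K `<=` Omega ->
    (\int[mu]_(x in K) `|u x|%:E < +oo)%E.

Definition L1loc2 Omega (g : V * V -> R) : Prop :=
  measurable_fun (Omega `*` Omega) g /\
  forall K : set (V * V), compact K -> K `<=` Omega `*` Omega ->
    (\int[mu2]_(z in K) `|g z|%:E < +oo)%E.

(* Test functions are of class C^1 with compact support, as in Gilbarg-Trudinger,
   section 7.3, and as in the definition of the nonlocal derivative below. *)
Definition weak_partial Omega i u (g : V -> R) : Prop :=
  [/\ L1loc Omega u, L1loc Omega g &
    forall phi : V -> R, C1c Omega phi ->
      \int[mu]_(x in Omega) (u x * 'D_(ebase i) phi x) =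
      - \int[mu]_(x in Omega) (g x * phi x)].

(* Weak derivatives are unique almost everywhere; xget picks a version. *)
Definition weak_grad Omega u (x : V) : V :=
  \row_i xget (cst 0) [set g | weak_partial Omega i u g] x.

Definition sobolev p Omega u : Prop :=
  [/\ in_Lp mu p Omega u, forall i, exists g, weak_partial Omega i u g
    & in_Lp mu p Omega (@enorm R N \o weak_grad Omega u)].

Definition sobolev_norm p Omega u : \bar R :=
  (Lp_norm mu p Omega u +
   Lp_norm mu p Omega (@enorm R N \o weak_grad Omega u))%E.

Definition admissible_weight Omega omega : Prop :=
  [/\ forall x y, Omega x -> Omega y -> 0 <= omega (x, y),
      forall x y, Omega x -> Omega y -> omega (x, y) = omega (y, x)
    & C1_on (Omega `*` Omega) omega].

(* The operator $\partial^*_{\omega,i}$. *)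
Definition nl_adjoint Omega omega i psi (x : V) : R :=
  \int[mu]_(y in Omega)
    'D_(ebase i) (fun x' : V => omega (x', y) * (psi (y, x') - psi (x', y))) x.

Definition nl_weak_partial Omega omega i u (g : V * V -> R) : Prop :=
  [/\ L1loc Omega u, L1loc2 Omega g &
    forall psi : V * V -> R, C1c (Omega `*` Omega) psi ->
      \int[mu]_(x in Omega) (u x * nl_adjoint Omega omega i psi x) =
      - \int[mu2]_(z in Omega `*` Omega) (g z * psi z)].

Definition nl_grad Omega omega u (z : V * V) : V :=
  \row_i xget (cst 0) [set g | nl_weak_partial Omega omega i u g] z.

Definition nl_sobolev p Omega omega u : Prop :=
  [/\ in_Lp mu p Omega u, forall i, exists g, nl_weak_partial Omega omega i u g
    & in_Lp mu2 p (Omega `*` Omega) (@enorm R N \o nl_grad Omega omega u)].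

Definition nl_sobolev_norm p Omega omega u : \bar R :=
  (Lp_norm mu p Omega u +
   Lp_norm mu2 p (Omega `*` Omega) (@enorm R N \o nl_grad Omega omega u))%E.

(* As omega >= 0 on Omega x Omega and a nonempty open Omega is not negligible,
   the essential supremum over Omega is that of the extension by 0. *)
Definition weight_fun p Omega omega (x : V) : \bar R :=
  match p with
  | q%:E => \int[mu]_(y in Omega) (omega (x, y) `^ q)%:E
  | +oo => ess_sup mu ((fun y => (omega (x, y))%:E) \_ Omega)
  | -oo => 0
  end%E.

End sobolev.

(* Main.v *)
Require Import Defs.
From mathcomp Require Import all_boot all_order all_algebra.
From mathcomp Require Import all_classical all_reals all_analysis.
From mathcomp Require Import measurable_realfun ess_sup_inf.
From mathcomp Require Import ring lra.

(** Why the theorem holds.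

    Lower bound on the weight.  Fix a test function [eta] on Omega of integral 1
    and, for a test function [phi], use
    [psi (x, y) = phi x * eta y / omega (x, y)] in the definition of the
    nonlocal derivative.  As the weight is symmetric, it cancels in
    [omega (x, y) * (psi (y, x) - psi (x, y)) = eta x * phi y - phi x * eta y],
    so the nonlocal adjoint of [psi] is [D_i eta x * int phi - D_i phi x] and
    the nonlocal identity becomes the classical one: if [g] is the nonlocal
    derivative of [u], the weak derivative of [u] is
    [- (int u D_i eta + int g (x, y) eta y / omega (x, y) dy)]
    ([nl_weak_partial_local]).  The first term is a constant, which has a finite
    L^p norm because Omega has finite measure when [p] is finite; the second
    is bounded by the Hoelder inequality, because the kernel
    [eta y / omega (x, y)] is bounded and supported in a fixed compact set of
    [y] ([nl_sobolev_embeds_sobolev]).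

    Upper bound on the weight function.  By Fubini and the symmetry of the
    weight, a function with weak derivative [g] has the nonlocal derivative
    [omega (x, y) * (g y - g x)] ([weak_partial_nl]).  Integrating the weight
    first bounds its L^p norm by that of [g] ([Lp_nl_diff_le]).

    Necessity of that bound.  Test the embedding on a bump of radius [r] at
    [a].  Its Sobolev norm is at most of order [1 / r] times the p-th root of
    the volume of a ball [B] of radius [2 r] ([bump_nl_diff_le]).  On a cube
    near [a] of volume comparable to that of [B] the derivative of the bump is
    at least of order [1 / r], while it vanishes outside [B]; hence the nonlocal
    derivative at [(x, y)], for [x] in the cube and [y] outside [B], is at least
    of order [omega (x, y) / r].  All powers of [r] cancel, so some point [x] of
    the cube satisfies an estimate of the integral of [omega (x, y) ^ p] over
    [y] outside [B] that depends neither on [a] nor on [r]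
    ([exists_shell_integral_le]).  When [r] tends to 0 this point tends to [a],
    and Fatou's lemma gives the bound at [a] ([integral_weight_le]).  For
    [p = +oo] the continuity of the weight gives a pointwise bound directly
    ([weight_le]).  In dimension 0 there is no derivative to test with, but
    there Omega is one point and the weight function is a finite number.

    The gradients in the definition of the two spaces are chosen
    representatives, so the computations above apply to them only because weak
    and nonlocal derivatives are unique almost everywhere; this is the
    fundamental lemma of the calculus of variations
    ([fundamental_lemma_rV], [fundamental_lemma_rV2]). *)
Import Order.TTheory GRing.Theory Num.Theory.
Import numFieldNormedType.Exports.
Set Implicit Arguments.
Unset Strict Implicit.
Unset Printing Implicit Defensive.
Local Open Scope classical_set_scope.
Local Open Scope ring_scope.

(** * Borel sets and Lebesgue measure on row vectors *)

Section measurability.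
Context {R : realType}.

(** The doubled balls inside [U] leave room for the closed support of a bump
    that is positive on the ball itself. *)
Lemma open_bigcup_balls (X : pseudoMetricType R) (I : Type) (c : I -> X)
    (U : set X) :
  (forall x e, 0 < e -> exists i, ball x e (c i)) -> open U ->
  U = \bigcup_(ik in [set ik : I * nat |
          ball (c ik.1) (2 / ik.2.+1%:R) `<=` U])
        ball (c ik.1) ik.2.+1%:R^-1.
Proof.
move=> dense_c oU; apply/seteqP; split=> [x Ux|x [[i k]] /= sub bx].
  have /nbhs_ballP[e /= e0 xeU] : nbhs x U by exact: open_nbhs_nbhs.
  have [k _ ke] := @near_infty_natSinv_lt R (PosNum (divr_gt0 e0 (ltr0n _ 3))).
  have {}ke : k.+1%:R^-1 < e / 3 by exact: (ke k (leqnn k)).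
  have k0 : 0 < k.+1%:R^-1 :> R by rewrite invr_gt0 ltr0n.
  have [i xi] := dense_c x _ k0.
  exists (i, k) => /=; last exact: ball_sym.
  move=> y iy; apply: xeU.
  apply: (@le_ball _ _ _ (k.+1%:R^-1 + 2 / k.+1%:R)); last exact: ball_triangle xi iy.
  by move: ke k0; set a := _^-1 => ke k0; lra.
apply: sub; apply: le_ball bx.
have : 0 < k.+1%:R^-1 :> R by rewrite invr_gt0 ltr0n.
by set a := _^-1 => a0; lra.
Qed.

Lemma rV_ballP n (x y : 'rV[R]_n) e : 0 < e ->
  ball x e y <-> forall i, `|x ord0 i - y ord0 i| < e.
Proof.
move=> e0; split=> [[_ xy] i|xy]; first exact: (xy ord0 i).
by split=> // i j; rewrite (ord1 i); exact: (xy j).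
Qed.

Lemma rat_rV_dense n (x : 'rV[R]_n) e : 0 < e ->
  exists q : 'rV[rat]_n, ball x e (map_mx ratr q).
Proof.
move=> e0.
have /choice[q qP] : forall i, exists q : rat, `|x ord0 i - ratr q| < e.
  move=> i; have : x ord0 i - e < x ord0 i + e by lra.
  move=> /rat_in_itvoo[q]; rewrite in_itv /= => /andP[q1 q2].
  by exists q; rewrite ltr_norml; lra.
exists (\row_i q i); apply/rV_ballP => // i; rewrite !mxE; exact: qP.
Qed.

Lemma measurable_rV_box n (A : 'I_n -> set R) :
  (forall i, measurable (A i)) ->
  measurable [set x : 'rV[R]_n | forall i, A i (x ord0 i)].
Proof.
move=> mA.
rewrite (_ : mkset _ = \bigcap_(i in [set: 'I_n]) (@rV_coord R n i @^-1` A i)).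
  apply: fin_bigcap_measurable => // i _.
  rewrite -[X in measurable X]setTI.
  exact: (measurable_rV_coord i measurableT (mA _)).
by apply/seteqP; split=> x /= Ax i => [_|]; exact: Ax.
Qed.

Lemma rV_ballE n (x : 'rV[R]_n) e : 0 < e ->
  ball x e = [set y : 'rV[R]_n | forall i,
    (`]x ord0 i - e, x ord0 i + e[%classic : set R) (y ord0 i)].
Proof.
move=> e0; apply/seteqP; split=> y /=.
  by move/(rV_ballP _ _ e0) => xy i; have := xy i; rewrite in_itv /= ltr_norml; lra.
move=> xy; apply/(rV_ballP _ _ e0) => i; have := xy i.
by rewrite in_itv /= ltr_norml; lra.
Qed.

Lemma measurable_rV_ball n (x : 'rV[R]_n) e : 0 < e -> measurable (ball x e).
Proof.
move=> e0; rewrite rV_ballE//.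
by apply: (measurable_rV_box (A := fun i => `]x ord0 i - e, x ord0 i + e[%classic)).
Qed.

Lemma measurable_rV2_ball n (z : 'rV[R]_n * 'rV[R]_n) e : 0 < e ->
  measurable (ball z e).
Proof.
move=> e0; rewrite (_ : ball z e = ball z.1 e `*` ball z.2 e)//.
by apply: measurableX; exact: measurable_rV_ball.
Qed.

Lemma open_measurable_rV n (U : set 'rV[R]_n) : open U -> measurable U.
Proof.
move=> /(open_bigcup_balls (@rat_rV_dense n)) ->.
rewrite bigcup_mkcond; apply: countable_bigcupT_measurable.
  exact: countableP.
by move=> [q k]; case: ifP => // _; apply: measurable_rV_ball; rewrite invr_gt0.
Qed.

Definition ratr2 n (q : 'rV[rat]_n * 'rV[rat]_n) : 'rV[R]_n * 'rV[R]_n :=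
  (map_mx ratr q.1, map_mx ratr q.2).

Lemma rat_rV2_dense n (z : 'rV[R]_n * 'rV[R]_n) e : 0 < e ->
  exists q : 'rV[rat]_n * 'rV[rat]_n, ball z e (ratr2 q).
Proof.
move=> e0; have [q1 h1] := rat_rV_dense z.1 e0.
by have [q2 h2] := rat_rV_dense z.2 e0; exists (q1, q2).
Qed.

Lemma open_measurable_rV2 n (U : set ('rV[R]_n * 'rV[R]_n)) :
  open U -> measurable U.
Proof.
move=> /(open_bigcup_balls (@rat_rV2_dense n)) ->.
rewrite bigcup_mkcond; apply: countable_bigcupT_measurable.
  exact: countableP.
by move=> [q k]; case: ifP => // _; apply: measurable_rV2_ball; rewrite invr_gt0.
Qed.

Lemma measurable_fun_of_open_preimage d (T : measurableType d) (D : set T)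
    (f : T -> R) :
  measurable D -> (forall U, open U -> measurable (D `&` f @^-1` U)) ->
  measurable_fun D f.
Proof.
move=> mD oT; apply: (measurability _ (RGenOpens.measurableE R)) => //.
move=> A [_ [a [b ->]] <-]; apply: oT; exact: interval_open.
Qed.

Lemma open_continuous_measurable_rV n (D : set 'rV[R]_n) (f : 'rV[R]_n -> R) :
  open D -> {within D, continuous f} -> measurable_fun D f.
Proof.
move=> oD; rewrite continuous_open_subspace// => cf.
apply: measurable_fun_of_open_preimage; first exact: open_measurable_rV.
move=> U oU; apply: open_measurable_rV.
rewrite openE => x [Dx Ux]; apply: filterI; first exact: open_nbhs_nbhs.
by apply: cf; [rewrite inE|exact: open_nbhs_nbhs].
Qed.

Lemma open_continuous_measurable_rV2 n (D : set ('rV[R]_n * 'rV[R]_n))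
    (f : 'rV[R]_n * 'rV[R]_n -> R) :
  open D -> {within D, continuous f} -> measurable_fun D f.
Proof.
move=> oD; rewrite continuous_open_subspace// => cf.
apply: measurable_fun_of_open_preimage; first exact: open_measurable_rV2.
move=> U oU; apply: open_measurable_rV2.
rewrite openE => x [Dx Ux]; apply: filterI; first exact: open_nbhs_nbhs.
by apply: cf; [rewrite inE|exact: open_nbhs_nbhs].
Qed.

Lemma compact_measurable_rV n (K : set 'rV[R]_n) : compact K -> measurable K.
Proof.
move=> /compact_closed -/(_ (@norm_hausdorff _ _)) cK.
by rewrite -[K]setCK; apply: measurableC; apply: open_measurable_rV; exact: closed_openC.
Qed.

Lemma compact_measurable_rV2 n (K : set ('rV[R]_n * 'rV[R]_n)) :
  compact K -> measurable K.
Proof.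
move=> /compact_closed -/(_ (@norm_hausdorff _ _)) cK.
by rewrite -[K]setCK; apply: measurableC; apply: open_measurable_rV2; exact: closed_openC.
Qed.

Lemma lebesgue_rV_ball n (x : 'rV[R]_n) e : 0 < e ->
  lebesgue_rV R n (ball x e) = ((e *+ 2) ^+ n)%:E.
Proof.
move=> e0; rewrite rV_ballE// (lebesgue_rV_box (A := fun i => `]x ord0 i - e, x ord0 i + e[%classic))//.
rewrite (eq_bigr (fun=> (e *+ 2)%:E)) => [|i _].
  by rewrite prodEFin prodr_const card_ord.
rewrite lebesgue_measure_itv /= lte_fin ifT; last by lra.
by rewrite -EFinB; congr EFin; lra.
Qed.

Lemma compact_sub_ball n (K : set 'rV[R]_n) : compact K ->
  exists2 e, 0 < e & K `<=` ball 0 e.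
Proof.
move=> /compact_bounded/ex_strict_bound_gt0[M M0 KM].
exists M => // x /KM; rewrite /= => xM.
by rewrite -ball_normE /= sub0r normrN.
Qed.

Lemma compact_lebesgue_rV_lty n (K : set 'rV[R]_n) : compact K ->
  (lebesgue_rV R n K < +oo)%E.
Proof.
move=> cK; have [e e0 Ke] := compact_sub_ball cK.
apply: (@le_lt_trans _ _ (lebesgue_rV R n (ball (0 : 'rV[R]_n) e))).
  apply: le_measure => //; rewrite inE.
    exact: compact_measurable_rV.
  exact: measurable_rV_ball.
by rewrite lebesgue_rV_ball// ltry.
Qed.

Lemma open_lebesgue_rV_gt0 n (U : set 'rV[R]_n) : open U -> U !=set0 ->
  (0 < lebesgue_rV R n U)%E.
Proof.
move=> oU [x Ux].
have /nbhs_ballP[e /= e0 xeU] : nbhs x U by exact: open_nbhs_nbhs.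
apply: (@lt_le_trans _ _ (lebesgue_rV R n (ball x e))).
  by rewrite lebesgue_rV_ball// lte_fin exprn_gt0// pmulrn_lgt0.
apply: le_measure => //; rewrite inE; first exact: measurable_rV_ball.
exact: open_measurable_rV.
Qed.

End measurability.

(** * Functions of class C^1 and test functions *)

Section C1_calculus.
Context {R : realType}.
Implicit Types U V W : normedModType R.

Lemma openX (T1 T2 : topologicalType) (A : set T1) (B : set T2) :
  open A -> open B -> open (A `*` B).
Proof.
move=> oA oB; rewrite openE => -[x y] [/= Ax By].
by exists (A, B) => //=; split; exact: open_nbhs_nbhs.
Qed.

Lemma C1_onP V (D : set V) (f : V -> R) : open D ->
  C1_on D f <-> (forall x, D x -> differentiable f x) /\
                (forall v x, D x -> {for x, continuous ('D_v f)}).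
Proof.
move=> oD; split=> -[df cf]; split=> // v; last first.
  by rewrite continuous_open_subspace// => x; rewrite inE; exact: cf.
by move=> x Dx; have := cf v; rewrite continuous_open_subspace//; apply; rewrite inE.
Qed.

Lemma C1_on_subset V (D E : set V) (f : V -> R) : E `<=` D ->
  C1_on D f -> C1_on E f.
Proof.
move=> ED [df cf]; split=> [x /ED/df//|v].
exact: continuous_subspaceW (cf v).
Qed.

Lemma C1_on_continuous V (D : set V) (f : V -> R) : open D ->
  C1_on D f -> {within D, continuous f}.
Proof.
move=> oD [df _]; rewrite continuous_open_subspace// => x; rewrite inE => Dx.
exact/differentiable_continuous/df.
Qed.

Lemma C1_onT V (D : set V) (f : V -> R) : C1_on setT f -> C1_on D f.
Proof. exact: C1_on_subset. Qed.

Let near_open V (D : set V) (P : V -> Prop) x : open D -> D x ->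
  (forall y, D y -> P y) -> \forall y \near x, P y.
Proof.
move=> oD Dx DP; have : nbhs x D by exact: open_nbhs_nbhs.
by apply: filterS.
Qed.

Lemma continuous_for_near_eq V W (f g : V -> W) x :
  (\forall y \near x, f y = g y) -> {for x, continuous g} ->
  {for x, continuous f}.
Proof.
rewrite /prop_for /continuous_at => fg cg; rewrite (nbhs_singleton fg).
by apply: cvg_trans cg; apply: near_eq_cvg; apply: filterS fg => y ->.
Qed.

(** As [D] is open, continuity of the derivatives on [D] can be read off any
    formula that holds on [D]. *)
Lemma C1_on_derive_eq V (D : set V) (f : V -> R) (df : V -> V -> R) :
  open D -> (forall x, D x -> differentiable f x) ->
  (forall v x, D x -> 'D_v f x = df v x) ->
  (forall v x, D x -> {for x, continuous (df v)}) -> C1_on D f.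
Proof.
move=> oD dif dfE cdf; apply/C1_onP => //; split=> // v x Dx.
by apply: continuous_for_near_eq (cdf v x Dx); apply: near_open oD Dx _ => y /dfE.
Qed.

Lemma C1_on_cst V (D : set V) (c : R) : open D -> C1_on D (cst c : V -> R).
Proof.
move=> oD; apply: (@C1_on_derive_eq _ _ _ (fun _ => cst 0)) => //.
- by move=> v x _; rewrite derive_cst.
- by move=> v x _; exact: cst_continuous.
Qed.

Lemma C1_onD V (D : set V) (f g : V -> R) : open D ->
  C1_on D f -> C1_on D g -> C1_on D (f \+ g).
Proof.
move=> oD /(C1_onP _ oD)[df cf] /(C1_onP _ oD)[dg cg].
apply: (@C1_on_derive_eq _ _ _ (fun v => 'D_v f \+ 'D_v g)) => //.
- by move=> x Dx; apply: differentiableD; [exact: df|exact: dg].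
- by move=> v x Dx; rewrite deriveD//; apply: diff_derivable; [exact: df|exact: dg].
- by move=> v x Dx; apply: continuousD; [exact: cf|exact: cg].
Qed.

Lemma C1_onM V (D : set V) (f g : V -> R) : open D ->
  C1_on D f -> C1_on D g -> C1_on D (f \* g).
Proof.
move=> oD /(C1_onP _ oD)[df cf] /(C1_onP _ oD)[dg cg].
apply: (@C1_on_derive_eq _ _ _ (fun v => (f \* 'D_v g) \+ (g \* 'D_v f))) => //.
- by move=> x Dx; apply: differentiableM; [exact: df|exact: dg].
- by move=> v x Dx; rewrite deriveM//; apply: diff_derivable; [exact: df|exact: dg].
- move=> v x Dx.
  have cf0 := differentiable_continuous (df _ Dx).
  have cg0 := differentiable_continuous (dg _ Dx).
  by apply: continuousD; apply: continuousM => //; [exact: cg|exact: cf].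
Qed.

Lemma C1_onN V (D : set V) (f : V -> R) : open D -> C1_on D f -> C1_on D (\- f).
Proof.
move=> oD Cf.
rewrite (_ : (\- f) = cst (-1) \* f); last by apply/funext => x /=; rewrite mulN1r.
by apply: C1_onM => //; exact: C1_on_cst.
Qed.

Lemma C1_onB V (D : set V) (f g : V -> R) : open D ->
  C1_on D f -> C1_on D g -> C1_on D (f \- g).
Proof. by move=> oD Cf Cg; exact: C1_onD oD Cf (C1_onN oD Cg). Qed.

Lemma C1_onX V (D : set V) (f : V -> R) k : open D ->
  C1_on D f -> C1_on D (fun x => f x ^+ k).
Proof.
move=> oD Cf; elim: k => [|k IH].
  by under eq_fun do rewrite expr0; exact: C1_on_cst.
by under eq_fun do rewrite exprS; exact: C1_onM.
Qed.

Lemma C1_on_prod V (D : set V) I (r : seq I) (f : I -> V -> R) : open D ->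
  (forall i, C1_on D (f i)) -> C1_on D (fun x => \prod_(i <- r) f i x).
Proof.
move=> oD Cf; elim: r => [|i r IH].
  by under eq_fun do rewrite big_nil; exact: C1_on_cst.
by under eq_fun do rewrite big_cons; exact: C1_onM.
Qed.

Lemma C1_onV V (D : set V) (f : V -> R) : open D ->
  (forall x, D x -> f x != 0) -> C1_on D f -> C1_on D (fun x => (f x)^-1).
Proof.
move=> oD f0 /(C1_onP _ oD)[df cf].
apply: (@C1_on_derive_eq _ _ _ (fun v x => (- (f x)^-1 ^+ 2) * 'D_v f x)) => //.
- by move=> x Dx; apply: differentiableV; [exact: df|exact: f0].
- move=> v x Dx; rewrite deriveV; [|exact: f0|exact/diff_derivable/df].
  by rewrite exprVn.
- move=> v x Dx; apply: continuousM; last exact: cf.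
  apply: continuousN; rewrite (_ : (fun y => (f y)^-1 ^+ 2) = (fun y => (f y)^-1) \* (fun y => (f y)^-1))//.
  have cV : {for x, continuous (fun y => (f y)^-1)}.
    by apply: continuousV; [exact: f0|exact/differentiable_continuous/df].
  exact: continuousM.
Qed.

Lemma derive_comp_real V (f : V -> R) (q : R -> R) x v :
  differentiable f x -> differentiable q (f x) ->
  'D_v (q \o f) x = q^`()%classic (f x) * 'D_v f x.
Proof.
move=> df dq; rewrite deriveE; last exact: differentiable_comp.
rewrite diff_comp// /= deriveE// deriv1E; last exact/derivable1_diffP.
exact: mulrC.
Qed.

Lemma C1_on_comp_real V (D : set V) (f : V -> R) (q : R -> R) : open D ->
  (forall t, differentiable q t) -> continuous q^`()%classic ->
  C1_on D f -> C1_on D (q \o f).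
Proof.
move=> oD dq cq /(C1_onP _ oD)[df cf].
apply: (@C1_on_derive_eq _ _ _ (fun v => (q^`()%classic \o f) \* 'D_v f)) => //.
- by move=> x Dx; apply: differentiable_comp; [exact: df|exact: dq].
- by move=> v x Dx; rewrite derive_comp_real//; exact: df.
- move=> v x Dx; apply: continuousM; last exact: cf.
  by apply: continuous_comp; [exact/differentiable_continuous/df|exact: cq].
Qed.

(** A direction [v] is carried by an affine map to the fixed direction [l v]:
    both difference quotients are literally the same. *)
Lemma derive_comp_affine U V (L : U -> V) (l : U -> V) (f : V -> R) v x :
  (forall h y, L (h *: v + y) = h *: l v + L y) ->
  'D_v (f \o L) x = 'D_(l v) f (L x).
Proof.
by move=> Ll; rewrite /derive /=; under eq_fun do rewrite Ll.
Qed.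

Lemma C1_on_comp_affine U V (D : set V) (L : U -> V) (l : U -> V) (f : V -> R) :
  open D -> (forall v h y, L (h *: v + y) = h *: l v + L y) ->
  (forall x, differentiable L x) ->
  C1_on D f -> C1_on (L @^-1` D) (f \o L).
Proof.
move=> oD Ll dL /(C1_onP _ oD)[df cf].
have cL : continuous L by move=> x; exact/differentiable_continuous/dL.
have oLD : open (L @^-1` D) by apply: open_comp => // x _; exact: cL.
apply: (@C1_on_derive_eq _ _ _ (fun v => 'D_(l v) f \o L)) => //.
- by move=> x Dx; apply: differentiable_comp; [exact: dL|exact: df].
- by move=> v x Dx; exact: derive_comp_affine.
- by move=> v x Dx; apply: continuous_comp; [exact: cL|exact: cf].
Qed.

Lemma C1_on_fst U V (D : set U) (f : U -> R) : open D ->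
  C1_on D f -> C1_on (D `*` [set: V]) (fun z => f z.1).
Proof.
move=> oD Cf; rewrite (_ : D `*` _ = fst @^-1` D); last first.
  by apply/seteqP; split=> z //= [].
apply: (@C1_on_comp_affine _ _ _ _ fst) => // x.
by apply: linear_differentiable => y; exact: cvg_fst.
Qed.

Lemma C1_on_snd U V (D : set V) (f : V -> R) : open D ->
  C1_on D f -> C1_on ([set: U] `*` D) (fun z => f z.2).
Proof.
move=> oD Cf; rewrite (_ : _ `*` D = snd @^-1` D); last first.
  by apply/seteqP; split=> z //= [].
apply: (@C1_on_comp_affine _ _ _ _ snd) => // x.
by apply: linear_differentiable => y; exact: cvg_snd.
Qed.

Lemma C1_on_section U V (D : set (U * V)) (f : U * V -> R) y : open D ->
  C1_on D f -> C1_on [set x | D (x, y)] (fun x => f (x, y)).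
Proof.
move=> oD; apply: (@C1_on_comp_affine _ _ _ (fun x => (x, y)) (fun v => (v, 0))) => //.
  by move=> v h x; rewrite /GRing.scale/= /GRing.add /=; congr pair; rewrite /= scaler0 add0r.
Qed.

Lemma derive_section U V (f : U * V -> R) v x y :
  'D_v (fun x' => f (x', y)) x = 'D_(v, 0) f (x, y).
Proof.
apply: (@derive_comp_affine _ _ (fun x => (x, y)) (fun v => (v, 0))) => h z.
by rewrite /GRing.scale/= /GRing.add /=; congr pair; rewrite /= scaler0 add0r.
Qed.

Lemma C1_on_swap V (D : set V) (f : V * V -> R) : open D ->
  C1_on (D `*` D) f -> C1_on (D `*` D) (fun z => f (z.2, z.1)).
Proof.
move=> oD; rewrite -[X in _ -> C1_on X _](_ : (fun z : V * V => (z.2, z.1)) @^-1` (D `*` D) = _); last first.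
  by apply/seteqP; split=> z /= [].
have oDD : open (D `*` D) by exact: openX.
apply: (@C1_on_comp_affine _ _ _ (fun z : V * V => (z.2, z.1)) (fun z => (z.2, z.1))) => // z.
by apply: differentiable_pair; apply: linear_differentiable => y; [exact: cvg_snd|exact: cvg_fst].
Qed.

Lemma derive_out_closed (W : normedModType R) (K : set W) (f : W -> R) x v :
  closed K -> (forall x, ~ K x -> f x = 0) -> ~ K x -> 'D_v f x = 0.
Proof.
move=> cK f0 nK; rewrite (@near_eq_derive _ _ _ _ (cst 0)) ?derive_cst//.
have : nbhs x (~` K) by apply: open_nbhs_nbhs; split => //; exact: closed_openC.
by apply: filterS => y /f0.
Qed.

(** The null linear map satisfies the defining property of the differential. *)
Lemma differentiable_near0 V (f : V -> R) x :
  (\forall y \near x, f y = 0) -> differentiable f x.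
Proof.
move=> f0; pose z : {linear V -> R^o} := \0.
have cz : continuous z by move=> y; exact: cst_continuous.
have E : f \o shift x = cst (f x) + z +o_ 0 id.
  apply/eqaddoP => e e0; rewrite (nbhs_singleton f0).
  have : \forall h \near 0, f (shift x h) = 0.
    by rewrite (near_shift x) /=; near=> y; rewrite /= sub0r subrK; near: y.
  apply: filterS => h; rewrite !fctE => ->.
  by rewrite /= addr0 subr0 normr0 mulr_ge0// ltW.
have dE := diff_unique cz E.
by apply/diff_locallyP; rewrite dE.
Unshelve. all: by end_near. Qed.

End C1_calculus.

Section C1c_calculus.
Context {R : realType}.
Implicit Types U V W : normedModType R.

Lemma C1c_intro V (D K : set V) (f : V -> R) : C1_on D f ->
  compact K -> K `<=` D -> (forall x, ~ K x -> f x = 0) -> C1c D f.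
Proof.
move=> Cf cK KD f0.
have sub : closure [set x | f x != 0] `<=` K.
  have cl := compact_closed (@norm_hausdorff _ _) cK.
  rewrite (closure_id K).1//; apply: closure_subset => x /= /eqP fx.
  by apply: contrapT => /f0.
split=> //; first exact: subclosed_compact (@closed_closure _ _) cK sub.
exact: subset_trans sub KD.
Qed.

Lemma C1c_supp V (D : set V) (f : V -> R) : C1c D f ->
  exists K, [/\ compact K, K `<=` D, forall x, ~ K x -> f x = 0 &
    forall x v, ~ K x -> 'D_v f x = 0].
Proof.
move=> [Cf cK KD]; exists (closure [set x | f x != 0]); split=> //.
  move=> x nK; apply/eqP/negPn/negP => fx; apply: nK.
  exact: subset_closure.
move=> x v; apply: derive_out_closed => [|y nK]; first exact: closed_closure.
apply/eqP/negPn/negP => fy; apply: nK; exact: subset_closure.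
Qed.

Lemma within_continuous_bounded V (D K : set V) (g : V -> R) :
  {within D, continuous g} -> compact K -> K `<=` D ->
  exists2 M : R, 0 < M & forall x, K x -> `|g x| <= M.
Proof.
move=> cg cK KD.
have : compact (g @` K).
  by apply: continuous_compact => //; exact: continuous_subspaceW cg.
move=> /compact_bounded/ex_strict_bound_gt0[M M0 HM].
by exists M => // x Kx; apply: ltW; apply: HM; exists x.
Qed.

Lemma C1c_bounded V (D : set V) (f : V -> R) : open D -> C1c D f ->
  exists2 M : R, 0 < M & forall x, `|f x| <= M.
Proof.
move=> oD Cf; have [K [cK KD f0 _]] := C1c_supp Cf; case: Cf => Cf _ _.
have [M M0 HM] := within_continuous_bounded (C1_on_continuous oD Cf) cK KD.
exists M => // x; have [/HM//|/f0 ->] := pselect (K x).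
by rewrite normr0 ltW.
Qed.

Lemma C1c_derive_bounded V (D : set V) (f : V -> R) v : C1c D f ->
  exists2 M : R, 0 < M & forall x, `|'D_v f x| <= M.
Proof.
move=> Cf; have [K [cK KD _ f0]] := C1c_supp Cf; case: Cf => -[_ /(_ v) cf] _ _.
have [M M0 HM] := within_continuous_bounded cf cK KD.
exists M => // x; have [/HM//|/f0 ->] := pselect (K x).
by rewrite normr0 ltW.
Qed.

Lemma C1cM V (D : set V) (f g : V -> R) : open D ->
  C1c D f -> C1_on D g -> C1c D (f \* g).
Proof.
move=> oD Cf Cg; have [K [cK KD f0 _]] := C1c_supp Cf.
apply: (@C1c_intro _ _ K) => //; first by case: Cf => Cf _ _; exact: C1_onM oD Cf Cg.
by move=> x /f0 /= ->; rewrite mul0r.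
Qed.

(** A test function vanishes near every point outside its support, so nothing
    happens at the boundary of [D]. *)
Lemma C1c_extend V (D : set V) (f : V -> R) : open D -> C1c D f -> C1c setT f.
Proof.
move=> oD Cf; have [K [cK KD f0 df0]] := C1c_supp Cf.
have oKC : open (~` K) by apply: closed_openC; exact: compact_closed (@norm_hausdorff _ _) cK.
have near0 x : ~ K x -> \forall y \near x, ~ K y.
  by move=> nK; have : nbhs x (~` K) by exact: open_nbhs_nbhs.
apply: (@C1c_intro _ _ K) => //; case: Cf => /(C1_onP _ oD)[df cf] _ _.
apply/(C1_onP _ openT); split=> [x _|v x _].
  have [/KD/df//|nK] := pselect (K x).
  apply: differentiable_near0; apply: filterS (near0 x nK); exact: f0.
have [/KD/cf//|nK] := pselect (K x).
apply: (@continuous_for_near_eq _ _ _ _ (cst 0)).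
  by apply: filterS (near0 x nK) => y /df0.
exact: cst_continuous.
Qed.

Lemma C1c_tensor U V (D : set U) (E : set V) (f : U -> R) (g : V -> R) :
  open D -> open E -> C1c D f -> C1c E g ->
  C1c (D `*` E) (fun z => f z.1 * g z.2).
Proof.
move=> oD oE Cf Cg.
have [K [cK KD f0 _]] := C1c_supp Cf; have [L [cL LE g0 _]] := C1c_supp Cg.
have [Cf1 _ _] := Cf; have [Cg1 _ _] := Cg.
apply: (@C1c_intro _ _ (K `*` L)).
- apply: C1_onM; first exact: openX.
    by apply: C1_on_subset (@C1_on_fst _ _ V _ _ oD Cf1) => z [].
  by apply: C1_on_subset (@C1_on_snd _ U _ _ _ oE Cg1) => z [].
- exact: compact_setX.
- by move=> z [/= /KD ? /LE].
- move=> z; have [Kz nz|/f0 ->] := pselect (K z.1); last by rewrite mul0r.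
  by rewrite g0 ?mulr0// => Lz; apply: nz.
Qed.

Lemma compact_sub_square V (D : set V) (K : set (V * V)) : compact K ->
  K `<=` D `*` D -> exists L, [/\ compact L, L `<=` D & K `<=` L `*` L].
Proof.
move=> cK KD; exists (fst @` K `|` snd @` K); split.
- apply: compactU; apply: continuous_compact => //; apply: continuous_subspaceT => z.
    exact: cvg_fst.
  exact: cvg_snd.
- by move=> x [|] [z /KD[]] ? ? <-.
- by move=> z Kz; split; [left|right]; exists z.
Qed.

Lemma C1c_supp2 V (D : set V) (f : V * V -> R) : C1c (D `*` D) f ->
  exists K, [/\ compact K, K `<=` D,
    (forall z, ~ (K `*` K) z -> f z = 0) &
    forall z v, ~ (K `*` K) z -> 'D_v f z = 0].
Proof.
move=> Cf; have [K [cK KD f0 df0]] := C1c_supp Cf.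
have [L [cL LD KL]] := compact_sub_square cK KD.
exists L; split=> //.
- by move=> z nz; apply: f0 => /KL.
- by move=> z v nz; apply: df0 => /KL.
Qed.

End C1c_calculus.

(** * Bump functions *)

Section bump.
Context {R : realType}.

(** The simplest function of class C^1 that vanishes exactly on a half-line. *)
Definition pos_sqr (t : R) : R := Num.max 0 t ^+ 2.

Lemma pos_sqr_taylor (t h : R) :
  `|pos_sqr (h + t) - pos_sqr t - h * (2 * Num.max 0 t)| <= h ^+ 2.
Proof.
rewrite /pos_sqr ler_norml.
case: (leP 0 t) => t0; case: (leP 0 (h + t)) => ht0; apply/andP; split; nra.
Qed.

Lemma is_derive_pos_sqr (t : R) :
  is_derive t (1 : R) (pos_sqr : R -> R) (2 * Num.max 0 t).
Proof.
have cvg : h^-1 *: (pos_sqr (h *: (1 : R) + t) - pos_sqr t) @[h --> 0^'] -->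
    2 * Num.max 0 t.
  apply/cvgrPdist_lt => e e0.
  near=> h.
  have h0 : h != 0 by near: h; exact: nbhs_dnbhs_neq.
  have he : `|h| < e by near: h; apply: dnbhs0_lt.
  apply: le_lt_trans he.
  have -> : h *: (1 : R) = h by rewrite /GRing.scale/= mulr1.
  have h0' : 0 < `|h| by rewrite normr_gt0.
  rewrite distrC -(ler_pM2l h0').
  rewrite -normrM mulrBr /GRing.scale/= mulrA mulfV// mul1r.
  by rewrite -expr2 real_normK ?num_real//; exact: pos_sqr_taylor.
apply: DeriveDef; first by apply/cvg_ex; eexists; exact: cvg.
exact/cvg_lim.
Unshelve. all: by end_near. Qed.

Lemma continuous_max0 : continuous (fun t : R => Num.max 0 t).
Proof.
move=> t; apply: (@continuous_max _ _ (cst 0) id t); [exact: cst_continuous|exact: cvg_id].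
Qed.

Lemma C1_on_pos_sqr (V : normedModType R) (D : set V) (f : V -> R) : open D ->
  C1_on D f -> C1_on D (fun x => pos_sqr (f x)).
Proof.
move=> oD; apply: C1_on_comp_real => //.
  by move=> t; apply/derivable1_diffP; have [] := is_derive_pos_sqr t.
rewrite (_ : derive1 _ = fun t => 2 * Num.max 0 t); last first.
  by apply/funext => t; rewrite derive1E; have [] := is_derive_pos_sqr t.
by move=> t; apply: cvgM; [exact: cvg_cst|exact: continuous_max0].
Qed.

(** The one-dimensional profile of the bump centred at [a] of radius [r]; it is
    positive exactly on the open interval, and its derivative is explicit. *)
Definition bump1 (a r t : R) : R := pos_sqr (1 - ((t - a) / r) ^+ 2).

Lemma bump1_ge0 a r t : 0 <= bump1 a r t.
Proof. exact: sqr_ge0. Qed.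

Lemma bump1_le1 a r t : bump1 a r t <= 1.
Proof.
rewrite /bump1 /pos_sqr; have := sqr_ge0 ((t - a) / r); set s := _ ^+ 2 => s0.
by case: (leP 0 (1 - s)) => h; nra.
Qed.

Lemma bump1_gt0 a r t : 0 < r -> (0 < bump1 a r t) = (`|t - a| < r).
Proof.
move=> r0; rewrite /bump1 /pos_sqr.
rewrite -[in RHS](divfK (lt0r_neq0 r0) (t - a)); set s := (t - a) / r.
have -> : (`|s * r| < r) = (`|s| < 1).
  by rewrite normrM (gtr0_norm r0) -[X in _ < X]mul1r ltr_pM2r.
apply/idP/idP => [|s1].
  case: (leP 0 (1 - s ^+ 2)) => h; last by rewrite expr0n ltxx.
  by rewrite ltr_norml => h1; apply/andP; split; nra.
rewrite exprn_gt0// lt_max; apply/orP; right.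
by move: s1; rewrite ltr_norml => /andP[? ?]; nra.
Qed.

Definition dbump1 (a r t : R) : R :=
  2 * Num.max 0 (1 - ((t - a) / r) ^+ 2) * (- (2 * ((t - a) / r) / r)).

Lemma derive_bump1 a r t : 'D_1 (bump1 a r) t = dbump1 a r t.
Proof.
have d1 : is_derive t (1 : R) (fun t : R => (1 - ((t - a) / r) ^+ 2 : R)) (- (2 * ((t - a) / r) / r)).
  apply: is_derive_eq.
  rewrite /GRing.scale /=. ring.
have [/derivable1_diffP dg dgE] := d1.
have [/derivable1_diffP dq dqE] := is_derive_pos_sqr (1 - ((t - a) / r) ^+ 2).
rewrite (@derive_comp_real R R^o _ pos_sqr t 1 dg dq) dgE derive1E dqE.
by [].
Qed.

Lemma derivable_bump1 a r t : derivable (bump1 a r : R -> R) t (1 : R).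
Proof.
have [/derivable1_diffP dq _] := is_derive_pos_sqr (1 - ((t - a) / r) ^+ 2).
apply/derivable1_diffP/differentiable_comp; last exact: dq.
by apply/derivable1_diffP.
Qed.

Lemma dbump1_le a r t : 0 < r -> `|dbump1 a r t| <= 4 / r.
Proof.
move=> r0; rewrite /dbump1; set s := (t - a) / r.
have -> : 2 * Num.max 0 (1 - s ^+ 2) * (- (2 * s / r)) =
  (- 4 * (s * Num.max 0 (1 - s ^+ 2))) / r by ring.
rewrite normrM (gtr0_norm (_ : 0 < r^-1)) ?invr_gt0//.
apply: ler_wpM2r; first by rewrite invr_ge0 ltW.
rewrite normrM normrN (ger0_norm (_ : 0 <= 4))//.
suff : `|s * Num.max 0 (1 - s ^+ 2)| <= 1 by lra.
case: (leP 0 (1 - s ^+ 2)) => h; last by rewrite mulr0 normr0.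
rewrite normrM -[leRHS]mulr1; apply: ler_pM => //.
  by rewrite ler_norml; apply/andP; split; nra.
by rewrite ger0_norm//; nra.
Qed.

(** On the shell where the rescaled coordinate lies in [1/4, 3/4] both the
    profile and its slope stay away from zero. *)
Lemma bump1_shell a r t : 0 < r -> a + r / 4 <= t <= a + 3 * r / 4 ->
  1 / 8 <= bump1 a r t /\ 1 / 8 / r <= `|dbump1 a r t|.
Proof.
move=> r0 /andP[h1 h2].
have [s1 s2] : 1 / 4 <= (t - a) / r /\ (t - a) / r <= 3 / 4.
  by rewrite ler_pdivlMr// ler_pdivrMr//; lra.
rewrite /bump1 /dbump1 /pos_sqr; set s := (t - a) / r in s1 s2 *.
have s3 : 7 / 16 <= 1 - s ^+ 2 by nra.
rewrite max_r; last by lra.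
split; first by nra.
have -> : 2 * (1 - s ^+ 2) * (- (2 * s / r)) =
  (- 4 * (s * (1 - s ^+ 2))) / r by ring.
rewrite normrM (gtr0_norm (_ : 0 < r^-1)) ?invr_gt0//.
apply: ler_wpM2r; first by rewrite invr_ge0 ltW.
rewrite ler0_norm; nra.
Qed.

(** A product of one-dimensional profiles, because the balls of ['rV[R]_n] are
    cubes. *)
Definition bump n (a : 'rV[R]_n) (r : R) (x : 'rV[R]_n) : R :=
  \prod_(i < n) bump1 (a ord0 i) r (x ord0 i).

Lemma bump_ge0 n (a : 'rV[R]_n) r x : 0 <= bump a r x.
Proof. by apply: prodr_ge0 => i _; exact: bump1_ge0. Qed.

Lemma bump_le1 n (a : 'rV[R]_n) r x : bump a r x <= 1.
Proof. by apply: prodr_ile1 => i _; rewrite bump1_ge0 bump1_le1. Qed.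

Lemma bump_gt0 n (a : 'rV[R]_n) r : 0 < r -> [set x | 0 < bump a r x] = ball a r.
Proof.
move=> r0; apply/seteqP; split=> x /=.
  move=> bx; apply/rV_ballP => // i; rewrite distrC -bump1_gt0// lt0r bump1_ge0 andbT.
  by move: bx; rewrite /bump lt0r => /andP[/prodf_neq0/(_ i isT)].
move=> /(rV_ballP _ _ r0) ax; apply: prodr_gt0 => i _.
by rewrite bump1_gt0// distrC.
Qed.

Lemma bump_out n (a : 'rV[R]_n) r x : 0 < r -> ~ ball a r x -> bump a r x = 0.
Proof.
move=> r0; rewrite -bump_gt0//= => /negP; rewrite -leNgt => h.
by apply/eqP; rewrite eq_le h bump_ge0.
Qed.

Lemma C1_on_coord n (D : set 'rV[R]_n) i : open D ->
  C1_on D (fun x : 'rV[R]_n => x ord0 i).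
Proof.
move=> oD; apply: (@C1_on_derive_eq R 'rV[R]_n D (fun x => x ord0 i) (fun v : 'rV[R]_n => cst (v ord0 i))) => //.
- by move=> x _; exact: differentiable_coord.
- move=> v x _.
  have := @derive_comp_affine R 'rV[R]_n R (fun x => x ord0 i) (fun x => x ord0 i) id v x.
  by rewrite derive_id => ->// h y; rewrite !mxE.
- by move=> v x _; exact: cst_continuous.
Qed.

Lemma C1_on_bump1 n (a r : R) (i : 'I_n) :
  C1_on setT (fun x : 'rV[R]_n => bump1 a r (x ord0 i)).
Proof.
apply: C1_on_pos_sqr; first exact: openT.
have C : C1_on setT (fun x : 'rV[R]_n => (x ord0 i - a) / r).
  apply: (C1_onM openT _ (C1_on_cst _ openT)).
  exact: C1_onB openT (C1_on_coord i openT) (C1_on_cst _ openT).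
exact: C1_onB openT (C1_on_cst _ openT) (C1_onX _ openT C).
Qed.

Lemma C1_on_bump n (a : 'rV[R]_n) r : C1_on setT (bump a r).
Proof. by apply: C1_on_prod; [exact: openT|move=> i; exact: C1_on_bump1]. Qed.

Lemma compact_closed_ball_rV n (a : 'rV[R]_n) r : 0 < r ->
  compact (closed_ball a r).
Proof.
move=> r0; apply: bounded_closed_compact; last exact: closed_ball_closed.
rewrite closed_ballE//; exists (`|a| + r); split; first exact: num_real.
move=> M ltM x /= ax; apply/ltW/(le_lt_trans _ ltM).
by rewrite -[x](subrK a) addrC (le_trans (ler_normD _ _))// lerD2l distrC.
Qed.

Lemma C1c_bump n (D : set 'rV[R]_n) (a : 'rV[R]_n) r : 0 < r ->
  ball a (2 * r) `<=` D -> C1c D (bump a r).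
Proof.
move=> r0 aD; apply: (@C1c_intro _ _ _ (closed_ball a r)).
- exact/C1_onT/C1_on_bump.
- exact: compact_closed_ball_rV.
- apply: subset_trans aD; apply: closed_ball_subset => //; lra.
- move=> x nx; apply: bump_out => // ax; apply: nx; exact: subset_closed_ball.
Qed.

(** Along a coordinate line only one factor varies. *)
Lemma derive_bump n (a : 'rV[R]_n) r k x :
  'D_(ebase k) (bump a r) x =
  dbump1 (a ord0 k) r (x ord0 k) * \prod_(i < n | i != k) bump1 (a ord0 i) r (x ord0 i).
Proof.
set P := \prod_(i < n | _) _.
transitivity ('D_1 (fun t : R => bump1 (a ord0 k) r t * P) (x ord0 k)); last first.
  rewrite deriveMr; last exact: derivable_bump1.
  by rewrite derive_bump1 mulrC.
have E (y : 'rV[R]_n) : (forall i, i != k -> y ord0 i = x ord0 i) ->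
    bump a r y = bump1 (a ord0 k) r (y ord0 k) * P.
  move=> yx; rewrite /bump (bigD1 k)//=; congr (_ * _).
  by apply: eq_bigr => i /yx ->.
pose g t := bump1 (a ord0 k) r t * P; rewrite /derive -/(g) -/(g _).
rewrite (_ : (fun h => _) = (fun h : R => h^-1 *: ((g \o shift (x ord0 k)) (h *: (1 : R)) - g (x ord0 k))))//.
apply/funext => h; rewrite /g /= !E//.
  by rewrite !mxE !eqxx.
by move=> i ik; rewrite !mxE (negbTE ik) mulr0 add0r.
Qed.

Lemma derive_bump_le n (a : 'rV[R]_n) r k x : 0 < r ->
  `|'D_(ebase k) (bump a r) x| <= 4 / r.
Proof.
move=> r0; rewrite derive_bump normrM -[leRHS]mulr1.
apply: ler_pM => //; first exact: dbump1_le.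
rewrite ger0_norm; last by apply: prodr_ge0 => i _; exact: bump1_ge0.
by apply: prodr_ile1 => i _; rewrite bump1_ge0 bump1_le1.
Qed.

Lemma derive_bump_shell n (a : 'rV[R]_n) (r : R) k (x : 'rV[R]_n) : 0 < r ->
  (forall i, a ord0 i + r / 4 <= x ord0 i <= a ord0 i + 3 * r / 4) ->
  (1 / 8) ^+ n / r <= `|'D_(ebase k) (bump a r) x|.
Proof.
move=> r0 ax; rewrite derive_bump normrM.
have -> : (1 / 8) ^+ n / r = (1 / 8 / r) * \prod_(i < n | i != k) (1 / 8) :> R.
  rewrite mulrAC -[in LHS](card_ord n) -prodr_const (bigD1 k)//=.
apply: ler_pM.
- by rewrite !mulr_ge0// invr_ge0 ltW.
- by apply: prodr_ge0.
- by have [] := bump1_shell r0 (ax k).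
rewrite ger0_norm; last by apply: prodr_ge0 => i _; exact: bump1_ge0.
apply: ler_prod => i _; have [-> _] := bump1_shell r0 (ax i).
by rewrite andbT; lra.
Qed.

End bump.

(** * The fundamental lemma of the calculus of variations *)

Section fundamental_lemma.
Context d (T : measurableType d) {R : realType} (mu : {measure set T -> \bar R}).

(** Dynkin's pi-lambda theorem, applied to the charge that integrates [f]. *)
Lemma ae_eq0_of_integral_setI_closed (G : set (set T)) (f : T -> \bar R) :
  mu.-integrable setT f -> setI_closed G -> G setT ->
  @measurable _ T = <<s G >> ->
  (forall A, G A -> \int[mu]_(x in A) f x = 0)%E ->
  ae_eq mu setT f (cst 0%E).
Proof.
move=> intf GI GT mG f0.
have mGA A : G A -> measurable A by rewrite mG; exact: sub_gen_smallest.
pose nu : {charge set T -> \bar R} := induced_charge intf.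
have dH : dynkin [set A | measurable A /\ nu A = 0%E].
  split=> /=.
  - by split=> //; exact: f0.
  - move=> A [mA A0]; split; first exact: measurableC.
    have : nu setT = 0%E by exact: f0.
    have := chargeU nu mA (measurableC mA) (setICr A).
    by rewrite setUv /= A0 add0e => <-.
  - move=> F tF HF; split.
      by apply: bigcupT_measurable => k; have [] := HF k.
    have mF k : measurable (F k) by have [] := HF k.
    have := @charge_semi_sigma_additive _ _ _ nu F mF tF (bigcupT_measurable _ mF).
    move=> /cvg_lim <-//; apply: lim_near_cst => //; apply: nearW => n.
    by rewrite big1// => k _; have [] := HF k.
have GH : <<s G >> `<=` [set A | measurable A /\ nu A = 0%E].
  rewrite -(setI_closed_g_dynkin_g_sigma_algebra GI).
  by apply: smallest_sub => // A GA; split; [exact: mGA|exact: f0].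
apply: integral_ae_eq => // E _ mE; rewrite integral_cst// mul0e.
by have [] : measurable E /\ nu E = 0%E by apply: GH; rewrite -mG.
Qed.

(** The functions [w k] are test functions whose positivity sets cover [D] and
    the functions [v] are multipliers whose positivity sets form a
    pi-system generating all measurable sets. As [1 - (1 - w v) ^ n] increases
    to the indicator function of [w v > 0], testing against these functions
    computes the integral of [h] over a rich enough family of sets, without
    any mollification. *)
Lemma fundamental_lemma_generic (J : countType) (D : set T) (h : T -> R)
    (w : J -> T -> R) (Gam : set (T -> R)) :
  measurable D -> measurable_fun D h ->
  (forall k, measurable_fun setT (w k)) ->
  (forall k x, 0 <= w k x <= 1) ->
  D = \bigcup_k [set x | 0 < w k x] ->
  (forall k, mu.-integrable [set x | 0 < w k x] (EFin \o h)) ->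
  (forall v x, Gam v -> 0 <= v x <= 1) ->
  (forall v, Gam v -> measurable_fun setT v) ->
  Gam (cst 1) -> (forall u v, Gam u -> Gam v -> Gam (u \* v)) ->
  @measurable _ T = <<s [set [set x | 0 < v x] | v in Gam] >> ->
  (forall k v n, Gam v ->
    \int[mu]_(x in D) (h x * (1 - (1 - w k x * v x) ^+ n)) = 0) ->
  {ae mu, forall x, D x -> h x = 0}.
Proof.
move=> mD mh mw w01 DE ih v01 mv G1 GM mG test.
have mW k : measurable [set x | 0 < w k x].
  rewrite -[X in measurable X]setTI.
  have := mw k measurableT `]0, +oo[%classic (measurable_itv _).
  by congr (measurable (_ `&` _)); apply/seteqP; split=> x /=; rewrite in_itv/= andbT.
have mGV v : Gam v -> measurable [set x | 0 < v x].
  move=> Gv; rewrite -[X in measurable X]setTI.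
  have := mv _ Gv measurableT `]0, +oo[%classic (measurable_itv _).
  by congr (measurable (_ `&` _)); apply/seteqP; split=> x /=; rewrite in_itv/= andbT.
have WD k : [set x | 0 < w k x] `<=` D by rewrite DE => x wx; exists k.
have key k : {ae mu, forall x, 0 < w k x -> h x = 0}.
  have : ae_eq mu setT ((EFin \o h) \_ [set x | 0 < w k x]) (cst 0%E).
    apply: (@ae_eq0_of_integral_setI_closed [set [set x | 0 < v x] | v in Gam]).
    - by apply/(integrable_mkcond _ (mW k)); exact: ih.
    - move=> _ _ [u Gu <-] [v Gv <-]; exists (u \* v); first exact: GM.
      apply/seteqP; split=> x /=.
        have /andP[u0 _] := v01 u x Gu; have /andP[v0 _] := v01 v x Gv.
        by move=> uv; split; rewrite lt0r ?u0 ?v0 andbT; apply: contraTneq uv => ->;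
          rewrite ?mul0r ?mulr0 ltxx.
      by case=> u0 v0; exact: mulr_gt0.
    - by exists (cst 1) => //; apply/seteqP; split=> x //= _; exact: ltr01.
    - exact: mG.
    - move=> _ [v Gv <-].
      set W := [set x | 0 < w k x]; set A := [set x | 0 < v x].
      have mA : measurable A by exact: mGV.
      pose f_ n x : \bar R := (h x * (1 - (1 - w k x * v x) ^+ n))%:E.
      pose f x : \bar R := (h x * \1_A x)%:E.
      have mhW : measurable_fun W h by exact: measurable_funS mD (WD k) mh.
      have mf_ n : measurable_fun W (f_ n).
        apply/measurable_EFinP/measurable_funM => //.
        apply/measurable_funTS/measurable_funB => //.
        apply: measurable_funX; apply: measurable_funB => //.
        by apply: measurable_funM => //; exact: mv.
      have mf : measurable_fun W f.
        by apply/measurable_EFinP/measurable_funM => //; exact: measurable_funTS.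
      have wv01 x : 0 <= 1 - w k x * v x <= 1.
        have /andP[? ?] := w01 k x; have /andP[? ?] := v01 _ x Gv.
        by apply/andP; split; nra.
      have f_cvg x : W x -> f_ ^~ x @ \oo --> f x.
        move=> /= wx; apply: cvg_EFin; first exact: nearW.
        apply: cvgM; first exact: cvg_cst.
        have /andP[v0 _] := v01 _ x Gv.
        rewrite /f /A indicE; case: (boolP (x \in _)); rewrite ?notin_setE ?inE/= => vx.
          rewrite -[X in _ --> X]subr0; apply: cvgB; first exact: cvg_cst.
          apply: cvg_expr; have /andP[q0 _] := wv01 x.
          by rewrite ger0_norm// gtrBl mulr_gt0.
        have -> : v x = 0 by apply/eqP; rewrite eq_le v0 andbT leNgt; exact/negP.
        under eq_fun do rewrite mulr0 subr0 expr1n subrr.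
        exact: cvg_cst.
      have f_le n x : (`|f_ n x| <= `|(h x)%:E|)%E.
        rewrite lee_fin normrM ler_piMr// ger0_norm.
          by rewrite gerBl exprn_ge0//; have /andP[] := wv01 x.
        by rewrite subr_ge0; have /andP[? ?] := wv01 x; exact: exprn_ile1.
      have [intf _ cvg] := dominated_convergence (mW k) mf_ mf
        (aeW _ f_cvg) (integrable_abse (ih k)) (aeW _ (fun x n _ => f_le n x)).
      have f_0 n : (\int[mu]_(x in W) f_ n x = 0)%E.
        have intW : mu.-integrable W (f_ n).
          apply: le_integrable (ih k) => // x _; exact: f_le.
        have fin : (\int[mu]_(x in W) f_ n x)%E \is a fin_num.
          by apply: integrable_fin_num => //; exact: mW.
        rewrite -(fineK fin); congr EFin; rewrite -[RHS](test k v n Gv) /Rintegral.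
        congr fine; rewrite integral_mkcond [RHS]integral_mkcond.
        apply: eq_integral => x _; rewrite !patchE.
        case: (boolP (x \in W)) => xW.
          by rewrite ifT//; apply/mem_set/(WD k)/set_mem.
        have wx0 : w k x = 0.
          move: xW; rewrite notin_setE /W/= => /negP; rewrite -leNgt => wx.
          by have /andP[wx' _] := w01 k x; apply/eqP; rewrite eq_le wx wx'.
        by case: ifP => // _; rewrite wx0 mul0r subr0 expr1n subrr mulr0.
      have : (\int[mu]_(x in W) f x = 0)%E.
        have := cvg_lim (@ereal_hausdorff R) cvg.
        by move=> <-; under eq_fun do rewrite f_0; exact: lim_cst.
      rewrite (integral_mkcond W) (integral_mkcond A) => <-.
      apply: eq_integral => x _; rewrite !patchE /f.
      by rewrite indicE; case: (x \in A); case: (x \in W); rewrite //= ?mulr1 ?mulr0.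
  apply: filterS => x /(_ I) /=; rewrite patchE => + wx.
  by rewrite ifT ?inE// => -[].
pose F n : set T := if unpickle n is Some k then [set x | 0 < w k x /\ h x <> 0] else set0.
have nF : mu.-negligible (\bigcup_n F n).
  apply: negligible_bigcup => n; rewrite /F; case: (unpickle n) => [k|]; last exact: negligible_set0.
  by apply: negligibleS (key k) => x /= [wx hx] /(_ wx).
apply: negligibleS nF => x /= /not_implyP; rewrite {1}DE => -[[k _ wx] hx].
by exists (pickle k) => //; rewrite /F pickleK.
Qed.

End fundamental_lemma.

Section fundamental_lemma_rV.
Context {R : realType}.

Lemma C1_measurable_rV n (f : 'rV[R]_n -> R) :
  C1_on setT f -> measurable_fun setT f.
Proof.
move=> /(C1_on_continuous openT); apply: open_continuous_measurable_rV.
exact: openT.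
Qed.

Lemma C1_measurable_rV2 n (f : 'rV[R]_n * 'rV[R]_n -> R) :
  C1_on setT f -> measurable_fun setT f.
Proof.
move=> /(C1_on_continuous openT); apply: open_continuous_measurable_rV2.
exact: openT.
Qed.

Definition multiplier (V : normedModType R) : set (V -> R) :=
  [set v | C1_on setT v /\ forall x, 0 <= v x <= 1].

Lemma multiplierM (V : normedModType R) (u v : V -> R) :
  multiplier u -> multiplier v -> multiplier (u \* v).
Proof.
move=> [Cu u01] [Cv v01]; split; first exact: C1_onM openT Cu Cv.
move=> x; have /andP[? ?] := u01 x; have /andP[? ?] := v01 x.
by rewrite mulr_ge0//= mulr_ile1.
Qed.

Lemma multiplier1 (V : normedModType R) : multiplier (cst 1 : V -> R).
Proof. by split; [exact: C1_on_cst openT|move=> x; rewrite ler01 lexx]. Qed.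

(** A saturation of the squared positive part: it is positive on the same
    half-space but takes values in [0, 1]. *)
Lemma multiplier_halfspace (V : normedModType R) (g : V -> R) (a : R) :
  C1_on setT g -> exists2 v, multiplier v & [set x | 0 < v x] = [set x | a < g x].
Proof.
move=> Cg; pose q x := pos_sqr (g x - a).
have Cq : C1_on setT q.
  exact: C1_on_pos_sqr openT (C1_onB openT Cg (C1_on_cst _ openT)).
have q0 x : 0 <= q x by exact: sqr_ge0.
have q1 x : 0 < 1 + q x by rewrite ltr_pwDl.
exists (fun x => q x * (1 + q x)^-1); first split.
- apply: (C1_onM openT Cq); apply: C1_onV; first exact: openT.
    by move=> x _; rewrite lt0r_neq0.
  exact: C1_onD openT (C1_on_cst _ openT) Cq.
- move=> x; rewrite divr_ge0//=; last exact: ltW.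
  by rewrite ler_pdivrMr// mul1r lerDr.
- apply/seteqP; split=> x /=.
    rewrite pmulr_lgt0 ?invr_gt0// /q /pos_sqr; case: (leP 0 (g x - a)) => h.
      by move=> h2; rewrite -subr_gt0 lt0r h andbT; apply: contraTneq h2 => ->; rewrite expr0n ltxx.
    by rewrite expr0n ltxx.
  by rewrite -subr_gt0 => h; rewrite pmulr_lgt0 ?invr_gt0// exprn_gt0// lt_max h orbT.
Qed.

Lemma sigma_algebra_preimage_rV n (X : pointedType) (G : set (set X))
    (f : X -> 'rV[R]_n) :
  (forall i a, G [set x | a < f x ord0 i]) ->
  forall A, measurable A -> <<s G >> (f @^-1` A).
Proof.
move=> Gf A mA; rewrite -[_ @^-1` _]setTI.
suff : measurable_fun setT (f : g_sigma_algebraType G -> 'rV[R]_n).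
  by move=> /(_ measurableT A mA).
apply: measurable_fun_rVP => i.
apply: (measurability _ (RGenOInfty.measurableE R)) => _ [_ [a ->] <-].
rewrite setTI; apply: sub_gen_smallest.
have := Gf i a; congr G.
by apply/seteqP; split=> x /=; rewrite in_itv/= andbT.
Qed.

(** The coordinate half-spaces generate the sigma-algebra, and they are
    positivity sets of multipliers. *)
Lemma measurable_multiplierE n :
  @measurable _ 'rV[R]_n =
  <<s [set [set x | 0 < v x] | v in @multiplier 'rV[R]_n] >>.
Proof.
apply/seteqP; split=> A.
  apply: (sigma_algebra_preimage_rV (f := id)) => i a.
  have [v mv vE] := multiplier_halfspace a (C1_on_coord i (@openT 'rV[R]_n)).
  by exists v.
apply: smallest_sub; first exact: sigma_algebra_measurable.
move=> _ [v [Cv _] <-].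
rewrite -[X in measurable X]setTI (_ : mkset _ = v @^-1` `]0, +oo[%classic).
  exact: C1_measurable_rV.
by apply/seteqP; split=> x /=; rewrite in_itv/= andbT.
Qed.

Lemma measurable_multiplier2E n :
  @measurable _ ('rV[R]_n * 'rV[R]_n)%type =
  <<s [set [set x | 0 < v x] | v in @multiplier ('rV[R]_n * 'rV[R]_n)%type] >>.
Proof.
apply/seteqP; split=> A.
  apply: smallest_sub; first exact: smallest_sigma_algebra.
  move=> _ [] [B mB <-]; rewrite setTI; apply: sigma_algebra_preimage_rV mB => i a.
    have C : C1_on setT (fun z : 'rV[R]_n * 'rV[R]_n => z.1 ord0 i).
      rewrite -setXTT; exact: C1_on_fst openT (C1_on_coord i openT).
    by have [v mv vE] := multiplier_halfspace a C; exists v.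
  have C : C1_on setT (fun z : 'rV[R]_n * 'rV[R]_n => z.2 ord0 i).
    rewrite -setXTT; exact: C1_on_snd openT (C1_on_coord i openT).
  by have [v mv vE] := multiplier_halfspace a C; exists v.
apply: smallest_sub; first exact: sigma_algebra_measurable.
move=> _ [v [Cv _] <-].
rewrite -[X in measurable X]setTI (_ : mkset _ = v @^-1` `]0, +oo[%classic).
  exact: C1_measurable_rV2.
by apply/seteqP; split=> x /=; rewrite in_itv/= andbT.
Qed.

Lemma C1c_approx (V : normedModType R) (D : set V) (w v : V -> R) k :
  open D -> C1c D w -> C1_on setT v ->
  C1c D (fun x => 1 - (1 - w x * v x) ^+ k).
Proof.
move=> oD Cw Cv; have [K [cK KD w0 _]] := C1c_supp Cw.
apply: (C1c_intro _ cK KD).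
  have Cw1 : C1_on D w by case: Cw.
  have C1 : C1_on D (cst 1) by exact: C1_on_cst oD.
  apply: (C1_onB oD C1); apply: (C1_onX k oD); apply: (C1_onB oD C1).
  exact: C1_onM oD Cw1 (C1_onT _ Cv).
by move=> x /w0 ->; rewrite mul0r subr0 expr1n subrr.
Qed.

Lemma bump_gt0P n (a : 'rV[R]_n) r x : 0 < r -> 0 < bump a r x <-> ball a r x.
Proof. by move=> r0; rewrite -bump_gt0. Qed.

Definition bump2 n (z : 'rV[R]_n * 'rV[R]_n) (r : R) (x : 'rV[R]_n * 'rV[R]_n) :=
  bump z.1 r x.1 * bump z.2 r x.2.

Lemma bump2_01 n (z : 'rV[R]_n * 'rV[R]_n) r x : 0 <= bump2 z r x <= 1.
Proof. by rewrite mulr_ge0 ?bump_ge0//= mulr_ile1 ?bump_ge0 ?bump_le1. Qed.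

Lemma bump2_gt0 n (z : 'rV[R]_n * 'rV[R]_n) r : 0 < r ->
  [set x | 0 < bump2 z r x] = ball z r.
Proof.
move=> r0; rewrite (_ : ball z r = ball z.1 r `*` ball z.2 r)// -!bump_gt0//.
apply/seteqP; split=> x /= => [h|[h1 h2]]; last exact: mulr_gt0.
by split; rewrite lt0r bump_ge0 andbT; apply: contraTneq h;
  rewrite /bump2 => ->; rewrite ?mul0r ?mulr0 ltxx.
Qed.

Lemma bump2_gt0P n (z : 'rV[R]_n * 'rV[R]_n) r x : 0 < r ->
  0 < bump2 z r x <-> ball z r x.
Proof. by move=> r0; rewrite -bump2_gt0. Qed.

Lemma C1_on_bump2 n (z : 'rV[R]_n * 'rV[R]_n) r : C1_on setT (bump2 z r).
Proof.
rewrite -setXTT; apply: C1_onM; first exact: openX openT openT.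
  exact: C1_on_fst openT (C1_on_bump _ _).
exact: C1_on_snd openT (C1_on_bump _ _).
Qed.

Lemma C1c_bump2 n (D : set ('rV[R]_n * 'rV[R]_n)) z r : 0 < r ->
  ball z (2 * r) `<=` D -> C1c D (bump2 z r).
Proof.
move=> r0 zD; have r2 : r < 2 * r by lra.
apply: (@C1c_intro _ _ _ (closed_ball z.1 r `*` closed_ball z.2 r)).
- exact/C1_onT/C1_on_bump2.
- by apply: compact_setX; exact: compact_closed_ball_rV.
- move=> x [/(closed_ball_subset r0 r2) x1 /(closed_ball_subset r0 r2) x2].
  by apply: zD; split.
- move=> x nx; rewrite /bump2.
  have [x1|/bump_out ->//] := pselect (ball z.1 r x.1); last by rewrite mul0r.
  have [x2|/bump_out ->//] := pselect (ball z.2 r x.2); last by rewrite mulr0.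
  by exfalso; apply: nx; split; apply: subset_closed_ball.
Qed.

Lemma fundamental_lemma_rV n (D : set 'rV[R]_n) (h : 'rV[R]_n -> R) :
  open D -> L1loc D h ->
  (forall phi, C1c D phi -> \int[lebesgue_rV R n]_(x in D) (h x * phi x) = 0) ->
  {ae lebesgue_rV R n, forall x, D x -> h x = 0}.
Proof.
move=> oD [mh ih] test.
pose c (q : 'rV[rat]_n) : 'rV[R]_n := map_mx ratr q.
(* Balls that do not lie well inside [D] are discarded by a zero function, so
   that the index type stays countable. *)
pose w (qk : 'rV[rat]_n * nat) : 'rV[R]_n -> R :=
  if `[< ball (c qk.1) (2 / qk.2.+1%:R) `<=` D >]
  then bump (c qk.1) qk.2.+1%:R^-1 else cst 0.
have k0 (k : nat) : 0 < k.+1%:R^-1 :> R by rewrite invr_gt0.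
have mw qk : measurable_fun setT (w qk).
  rewrite /w; case: ifP => // _.
  by apply: C1_measurable_rV; exact: C1_on_bump.
apply: (@fundamental_lemma_generic _ _ _ _ _ D h w (@multiplier 'rV[R]_n)) => //.
- exact: open_measurable_rV.
- by move=> qk x; rewrite /w; case: ifP => _; rewrite ?bump_ge0 ?bump_le1//= lexx ler01.
- rewrite [LHS](open_bigcup_balls (@rat_rV_dense _ n) oD).
  apply/seteqP; split=> x [qk /=].
    by move=> qkD cx; exists qk => //=; rewrite /w asboolT//; apply/bump_gt0P.
  move=> _; rewrite /w; case: ifP => [/asboolP qkD|_]; last by rewrite ltxx.
  by move=> /(bump_gt0P _ _ (k0 _)) wx; exists qk.
- move=> qk; rewrite /w; case: ifP => [/asboolP qkD|_]; last first.
    rewrite (_ : mkset _ = set0) ?integrable_set0//.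
    by apply/seteqP; split=> x //=; rewrite ltxx.
  rewrite bump_gt0//; set B := closed_ball (c qk.1) qk.2.+1%:R^-1.
  have cB : compact B by exact: compact_closed_ball_rV.
  have BD : B `<=` D.
    by apply: subset_trans qkD; apply: closed_ball_subset => //; rewrite ltr_pMl//; lra.
  apply: (@integrableS _ _ _ _ B); [exact: compact_measurable_rV|exact: measurable_rV_ball|exact: subset_closed_ball|].
  apply/integrableP; split; last exact: ih.
  apply/measurable_EFinP; apply: measurable_funS mh => //.
  exact: open_measurable_rV.
- by move=> v x [_].
- move=> v [Cv _].
  exact: C1_measurable_rV.
- exact: multiplier1.
- exact: multiplierM.
- exact: measurable_multiplierE.
- move=> qk v k [Cv _]; apply: (test (fun x => 1 - (1 - w qk x * v x) ^+ k)).
  rewrite /w; case: ifP => [/asboolP qkD|_].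
    by apply: C1c_approx => //; apply: C1c_bump.
  apply: (@C1c_intro _ _ _ set0); [|exact: compact0|by []|].
    under eq_fun do rewrite mul0r subr0 expr1n subrr; exact: C1_on_cst.
  by move=> x _; rewrite mul0r subr0 expr1n subrr.
Qed.

Lemma fundamental_lemma_rV2 n (D : set 'rV[R]_n) (h : 'rV[R]_n * 'rV[R]_n -> R) :
  open D -> L1loc2 D h ->
  (forall psi, C1c (D `*` D) psi ->
    \int[(lebesgue_rV R n \x lebesgue_rV R n)%E]_(z in D `*` D) (h z * psi z) = 0) ->
  {ae (lebesgue_rV R n \x lebesgue_rV R n)%E, forall z, (D `*` D) z -> h z = 0}.
Proof.
move=> oD [mh ih] test; have oDD := openX oD oD.
pose w (qk : ('rV[rat]_n * 'rV[rat]_n) * nat) : 'rV[R]_n * 'rV[R]_n -> R :=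
  if `[< ball (ratr2 qk.1 : 'rV[R]_n * 'rV[R]_n) (2 / qk.2.+1%:R) `<=` D `*` D >]
  then bump2 (ratr2 qk.1) qk.2.+1%:R^-1 else cst 0.
have k0 (k : nat) : 0 < k.+1%:R^-1 :> R by rewrite invr_gt0.
have mw qk : measurable_fun setT (w qk).
  rewrite /w; case: ifP => // _.
  by apply: C1_measurable_rV2; exact: C1_on_bump2.
apply: (@fundamental_lemma_generic _ _ _ _ _ (D `*` D) h w
    (@multiplier ('rV[R]_n * 'rV[R]_n)%type)) => //.
- exact: open_measurable_rV2.
- by move=> qk x; rewrite /w; case: ifP => _; rewrite ?bump2_01//= lexx ler01.
- rewrite [LHS](open_bigcup_balls (@rat_rV2_dense _ n) oDD).
  apply/seteqP; split=> x [qk /=].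
    by move=> qkD cx; exists qk => //=; rewrite /w asboolT//; apply/bump2_gt0P.
  move=> _; rewrite /w; case: ifP => [/asboolP qkD|_]; last by rewrite ltxx.
  by move=> /(bump2_gt0P _ _ (k0 _)) wx; exists qk.
- move=> qk; rewrite /w; case: ifP => [/asboolP qkD|_]; last first.
    rewrite (_ : mkset _ = set0) ?integrable_set0//.
    by apply/seteqP; split=> x //=; rewrite ltxx.
  rewrite bump2_gt0//; set r := _^-1; set z := ratr2 _.
  have r2 : r < 2 * r by have := k0 qk.2; rewrite -/r => ?; lra.
  pose B := closed_ball z.1 r `*` closed_ball z.2 r.
  have cB : compact B by apply: compact_setX; apply: compact_closed_ball_rV; exact: k0.
  have BD : B `<=` D `*` D.
    apply: subset_trans qkD => x [x1 x2].
    by split; exact: closed_ball_subset (k0 _) r2 _ _.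
  apply: (@integrableS _ _ _ _ B); [exact: compact_measurable_rV2|apply: measurable_rV2_ball; exact: k0| |].
    by move=> x [x1 x2]; split; exact: subset_closed_ball.
  apply/integrableP; split; last exact: ih.
  apply/measurable_EFinP; apply: measurable_funS mh => //.
  exact: open_measurable_rV2.
- by move=> v x [_].
- move=> v [Cv _].
  exact: C1_measurable_rV2.
- exact: multiplier1.
- exact: multiplierM.
- exact: measurable_multiplier2E.
- move=> qk v k [Cv _]; apply: (test (fun x => 1 - (1 - w qk x * v x) ^+ k)).
  rewrite /w; case: ifP => [/asboolP qkD|_].
    by apply: C1c_approx => //; apply: C1c_bump2.
  apply: (@C1c_intro _ _ _ set0); [|exact: compact0|by []|].
    under eq_fun do rewrite mul0r subr0 expr1n subrr; exact: C1_on_cst.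
  by move=> x _; rewrite mul0r subr0 expr1n subrr.
Qed.

End fundamental_lemma_rV.

(** * Integration by parts *)

Section integration_by_parts.
Context {R : realType}.

Lemma integrable_mul_supp d (T : measurableType d)
    (mu : {measure set T -> \bar R}) (D K : set T) (u g : T -> R) (M : R) :
  measurable D -> measurable K -> K `<=` D ->
  measurable_fun D u -> measurable_fun D g ->
  (\int[mu]_(x in K) `|u x|%:E < +oo)%E ->
  (forall x, K x -> `|g x| <= M) -> (forall x, D x -> ~ K x -> g x = 0) ->
  mu.-integrable D (EFin \o (u \* g)).
Proof.
move=> mD mK KD mu_ mg iu gM g0.
have mugD : measurable_fun D (EFin \o (u \* g)).
  exact/measurable_EFinP/measurable_funM.
have ugK : (EFin \o (u \* g)) \_ D = (EFin \o (u \* g)) \_ K.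
  apply/funext => x; rewrite !patchE.
  case: ifPn => [/set_mem Dx|/negP nD]; case: ifPn => [/set_mem Kx|/negP nK] //=.
    by rewrite g0 ?mulr0// => /mem_set.
  by exfalso; apply: nD; exact/mem_set/KD.
apply/(integrable_mkcond _ mD); rewrite ugK; apply/(integrable_mkcond _ mK).
have iK : mu.-integrable K (fun x => M%:E * (`|u x|)%:E)%E.
  apply: integrableZl => //; apply/integrableP; split.
    apply/measurable_EFinP; apply: measurableT_comp => //.
    exact: measurable_funS mu_.
  by under eq_integral do rewrite /= normr_id.
apply: le_integrable iK => //; first exact: measurable_funS mugD.
move=> x Kx /=; rewrite lee_fin !normrM normr_id mulrC.
by rewrite ler_wpM2r// (le_trans (gM _ Kx))// ler_norm.
Qed.

Lemma integrable_bounded_supp d (T : measurableType d)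
    (mu : {measure set T -> \bar R}) (D K : set T) (g : T -> R) (M : R) :
  measurable D -> measurable K -> K `<=` D -> (mu K < +oo)%E ->
  measurable_fun D g -> (forall x, K x -> `|g x| <= M) ->
  (forall x, D x -> ~ K x -> g x = 0) -> mu.-integrable D (EFin \o g).
Proof.
move=> mD mK KD Koo mg gM g0.
rewrite (_ : g = cst 1 \* g); last by apply/funext => x /=; rewrite mul1r.
apply: (@integrable_mul_supp _ _ _ _ K _ _ M) => //.
under eq_integral do rewrite normr1.
by rewrite integral_cst// mul1e.
Qed.

Lemma integral_deriv_compact_supp (F : R -> R) (M : R) : 0 < M ->
  (forall t, derivable F t 1) -> continuous (F^`())%classic ->
  (forall t, M <= `|t| -> F t = 0 /\ (F^`())%classic t = 0) ->
  (\int[lebesgue_measure]_t ((F^`())%classic t)%:E = 0)%E.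
Proof.
move=> M0 dF cF F0.
have cF0 : continuous F.
  by move=> t; apply: differentiable_continuous; exact/derivable1_diffP.
have ltMM : - M < M by lra.
transitivity (\int[lebesgue_measure]_(t in `[(- M)%R, M]) ((F^`())%classic t)%:E)%E.
  rewrite [RHS]integral_mkcond; apply: eq_integral => t _; rewrite patchE.
  case: ifPn => //; rewrite notin_setE /= in_itv/= => /negP.
  rewrite -ler_norml -ltNge => /ltW/F0[_ ->//].
rewrite (continuous_FTC2 (F := F) ltMM).
- have hM : M <= `|M| by exact: ler_norm.
  have hN : M <= `|- M| by rewrite normrN.
  by rewrite (F0 _ hM).1 (F0 _ hN).1 subee.
- exact: continuous_subspaceT.
- split=> //.
  + by apply: cvg_at_right_filter; exact: cF0.
  + by apply: cvg_at_left_filter; exact: cF0.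
- by [].
Qed.

(** Only differentiability along the coordinate directions is kept, because it
    passes to the sections of a function without any chain rule. *)
Definition coord_C1c n (f : 'rV[R]_n -> R) : Prop :=
  [/\ forall i x, derivable f x (ebase i),
      forall i, continuous ('D_(ebase i) f) &
      exists2 M : R, 0 < M & forall x, ~ ball 0 M x ->
        f x = 0 /\ forall i, 'D_(ebase i) f x = 0].

Lemma C1c_coord_C1c n (D : set 'rV[R]_n) (f : 'rV[R]_n -> R) : open D ->
  C1c D f -> coord_C1c f.
Proof.
move=> oD /(C1c_extend oD) Cf; have [K [cK _ f0 df0]] := C1c_supp Cf.
case: Cf => /(C1_onP _ openT)[df cf] _ _.
have [M M0 KM] := compact_sub_ball cK; split.
- by move=> i x; apply: diff_derivable; exact: df.
- by move=> i x; exact: cf.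
- exists M => // x nx; have nK : ~ K x by move=> /KM.
  by split; [exact: f0|move=> i; exact: df0].
Qed.

Lemma continuous_compact_supp_integrable n (g : 'rV[R]_n -> R) M : 0 < M ->
  continuous g -> (forall x, ~ ball 0 M x -> g x = 0) ->
  (lebesgue_rV R n).-integrable setT (EFin \o g).
Proof.
move=> M0 cg g0.
have cB := @compact_closed_ball_rV R n 0 M M0.
have cg' : {within setT, continuous g} by exact: continuous_subspaceT.
have [C C0 gC] := within_continuous_bounded cg' cB (@subsetT _ _).
apply: (@integrable_bounded_supp _ _ _ _ (closed_ball (0 : 'rV[R]_n) M) _ C) => //.
- exact: compact_measurable_rV.
- exact: compact_lebesgue_rV_lty.
- exact: open_continuous_measurable_rV openT cg'.
- by move=> x _ nx; apply: g0 => /subset_closed_ball.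
Qed.

Let cons_ball n (t : R) (y : 'rV[R]_n) (M : R) : 0 < M ->
  ball (0 : 'rV[R]_n.+1) M (rV_cons (t, y)) -> `|t| < M /\ ball (0 : 'rV[R]_n) M y.
Proof.
move=> M0 /(rV_ballP _ _ M0) h; split.
  by have := h ord0; rewrite !mxE unlift_none sub0r normrN.
by apply/rV_ballP => // i; have := h (lift ord0 i); rewrite !mxE liftK.
Qed.

Let ball_cons_l n (y : 'rV[R]_n) (t t' e : R) : 0 < e -> `|t - t'| < e ->
  ball (rV_cons (t, y)) e (rV_cons (t', y)).
Proof.
move=> e0 tt; apply/rV_ballP => // i; rewrite !mxE.
by case: (unliftP ord0 i) => [j _|_] //=; rewrite subrr normr0.
Qed.

Let ball_cons_r n (y y' : 'rV[R]_n) (t e : R) : 0 < e -> ball y e y' ->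
  ball (rV_cons (t, y)) e (rV_cons (t, y')).
Proof.
move=> e0 /(rV_ballP _ _ e0) yy; apply/rV_ballP => // i; rewrite !mxE.
by case: (unliftP ord0 i) => [j _|_] //=; rewrite subrr normr0.
Qed.

Let continuous_cons_l n (y : 'rV[R]_n) : continuous (fun t : R => rV_cons (t, y)).
Proof.
move=> t; apply/cvg_ballP => e e0.
by apply: filterS (nbhsx_ballx t e e0) => t'; exact: ball_cons_l.
Qed.

Let continuous_cons_r n (t : R) : continuous (fun y : 'rV[R]_n => rV_cons (t, y)).
Proof.
move=> y; apply/(@cvg_ballP _ _ _ _ (nbhs_filter y)) => e e0.
by apply: filterS (nbhsx_ballx y e e0) => y'; exact: ball_cons_r.
Qed.

Let affine_cons_l n (y : 'rV[R]_n) (h t : R) :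
  rV_cons (h *: (1 : R) + t, y) = h *: ebase ord0 + rV_cons (t, y).
Proof.
apply/rowP => i; rewrite !mxE; case: (unliftP ord0 i) => [j ->|->] /=.
  by rewrite mulr0 add0r.
by [].
Qed.

Let affine_cons_r n (y : 'rV[R]_n) (h t : R) j :
  rV_cons (t, h *: ebase j + y) = h *: ebase (lift ord0 j) + rV_cons (t, y).
Proof.
apply/rowP => i; rewrite !mxE; case: (unliftP ord0 i) => [k ->|->] /=.
  by rewrite !mxE (inj_eq lift_inj).
by rewrite mulr0 add0r.
Qed.

(** By Fubini the first coordinate can be integrated first or last.  If the
    derivative is along the first coordinate, its integral over that coordinate
    vanishes by the fundamental theorem of calculus; otherwise the integral over
    the other coordinates vanishes by induction on the dimension. *)
Lemma integral_partial_eq0 n (i : 'I_n) (f : 'rV[R]_n -> R) : coord_C1c f ->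
  (\int[lebesgue_rV R n]_x ('D_(ebase i) f x)%:E = 0)%E.
Proof.
elim: n i f => [[]//|n IH] i f [df cdf [M M0 fM]].
pose g : 'rV[R]_n.+1 -> R := 'D_(ebase i) f.
have ig : (lebesgue_rV R n.+1).-integrable setT (EFin \o g).
  apply: (continuous_compact_supp_integrable M0) => [|x nx]; first exact: cdf.
  by have [_ h] := fM x nx; exact: h.
have mg : measurable_fun setT g.
  by apply: open_continuous_measurable_rV openT _; apply: continuous_subspaceT; exact: cdf.
have mG : measurable_fun setT (EFin \o (g \o @rV_cons R n)).
  by apply/measurable_EFinP; apply: measurableT_comp mg _; exact: measurable_rV_cons.
have iG : (lebesgue_measure \x lebesgue_rV R n)%E.-integrable setT (EFin \o (g \o @rV_cons R n)).
  apply/integrableP; split; first exact: mG.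
  move/integrableP : ig => [_]; apply: le_lt_trans.
  rewrite /= /rV_cons_measure ge0_integral_pushforward//.
    exact: measurable_rV_cons.
  by do 2 apply: measurableT_comp => //.
transitivity (\int[lebesgue_measure \x lebesgue_rV R n]_z ((g \o @rV_cons R n) z)%:E)%E.
  rewrite /= /rV_cons_measure integral_pushforward//.
  - exact: measurable_rV_cons.
  - exact/measurable_EFinP.
case: (unliftP ord0 i) => [j|] iE.
  rewrite -(integral12_prod_meas1 iG); apply: integral0_eq => t _ /=.
  have E k y : 'D_(ebase k) (f \o (fun y => rV_cons (t, y))) y =
      'D_(ebase (lift ord0 k)) f (rV_cons (t, y)).
    apply: (@derive_comp_affine R 'rV[R]_n 'rV[R]_n.+1 (fun y => rV_cons (t, y))
      (fun=> ebase (lift ord0 k))) => h z; exact: affine_cons_r.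
  rewrite /fubini_F /g iE; under eq_integral do rewrite /= -E.
  apply: IH; split.
  - move=> k y; have := df (lift ord0 k) (rV_cons (t, y)).
    rewrite /derivable /=; under eq_fun do rewrite -affine_cons_r.
    by [].
  - move=> k; rewrite (_ : 'D__ _ = 'D_(ebase (lift ord0 k)) f \o (fun y => rV_cons (t, y))).
      by move=> y; apply: continuous_comp; [exact: continuous_cons_r|exact: cdf].
    by apply/funext => y; exact: E.
  - exists M => // y ny.
    have nty : ~ ball 0 M (rV_cons (t, y)) by move=> /(cons_ball M0)[].
    by have [f0 df0] := fM _ nty; split=> // k; rewrite E.
rewrite -(integral21_prod_meas1 iG); apply: integral0_eq => y _ /=.
pose F t := f (rV_cons (t, y)).
have E t : (F^`())%classic t = 'D_(ebase ord0) f (rV_cons (t, y)).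
  rewrite derive1E; apply: (@derive_comp_affine R R^o 'rV[R]_n.+1
    (fun t => rV_cons (t, y)) (fun=> ebase ord0)) => h z; exact: affine_cons_l.
rewrite /fubini_G /g iE; under eq_integral do rewrite /= -E.
apply: (integral_deriv_compact_supp M0).
- move=> t; have := df ord0 (rV_cons (t, y)).
  rewrite /derivable /=; under eq_fun do rewrite -affine_cons_l.
  by [].
- rewrite (_ : (F^`())%classic = 'D_(ebase ord0) f \o (fun t => rV_cons (t, y))).
    by move=> t; apply: continuous_comp; [exact: continuous_cons_l|exact: cdf].
  by apply/funext => t; exact: E.
- move=> t tM.
  have nty : ~ ball 0 M (rV_cons (t, y)).
    by move=> /(cons_ball M0)[]; rewrite ltNge tM.
  by have [f0 df0] := fM _ nty; rewrite E.
Qed.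

(** The product [phi * f] is a test function, so the integral of its derivative
    vanishes. *)
Lemma C1c_integration_by_parts n (D : set 'rV[R]_n) (i : 'I_n)
    (f phi : 'rV[R]_n -> R) : open D -> C1_on D f -> C1c D phi ->
  \int[lebesgue_rV R n]_(x in D) (f x * 'D_(ebase i) phi x) =
  - \int[lebesgue_rV R n]_(x in D) ('D_(ebase i) f x * phi x).
Proof.
move=> oD Cf Cphi; have mD := open_measurable_rV oD.
have [K [cK KD phi0 dphi0]] := C1c_supp Cphi.
have mK := compact_measurable_rV cK; have Koo := compact_lebesgue_rV_lty cK.
have Cphi1 : C1_on D phi by case: Cphi.
have [df cf] := Cf; have [dphi cphi] := Cphi1.
have int (a b : 'rV[R]_n -> R) : {within D, continuous a} -> {within D, continuous b} ->
    (forall x, ~ K x -> b x = 0) ->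
    (lebesgue_rV R n).-integrable D (EFin \o (a \* b)).
  move=> ca cb b0.
  have [A A0 aA] := within_continuous_bounded ca cK KD.
  have [B B0 bB] := within_continuous_bounded cb cK KD.
  apply: (@integrable_bounded_supp _ _ _ _ K _ (A * B)) => //.
  - by apply: measurable_funM; exact: open_continuous_measurable_rV.
  - by move=> x Kx; rewrite normrM; apply: ler_pM => //; [exact: aA|exact: bB].
  - by move=> x _ /b0 /= ->; rewrite mulr0.
have i1 := int _ _ (C1_on_continuous oD Cf) (cphi (ebase i)) (fun x => dphi0 x _).
have i2 := int _ _ (cf (ebase i)) (C1_on_continuous oD Cphi1) phi0.
apply/eqP; rewrite -addr_eq0 -RintegralD//; apply/eqP.
have Cp : C1c D (phi \* f) by exact: C1cM oD Cphi Cf.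
rewrite /Rintegral -[RHS]/(fine 0%E) -(integral_partial_eq0 i (C1c_coord_C1c oD Cp)).
congr fine; rewrite integral_mkcond; apply: eq_integral => x _; rewrite patchE.
case: ifPn => [/set_mem Dx|/negP nDx].
  rewrite deriveM; [|exact/diff_derivable/dphi|exact/diff_derivable/df].
  by rewrite /GRing.scale /= addrC mulrC [X in _ + X]mulrC addrC mulrC [X in _ + X]mulrC.
have [L [cL LD _ h0]] := C1c_supp Cp.
by rewrite h0// => /LD /mem_set.
Qed.

Lemma within_continuous_L1loc n (D : set 'rV[R]_n) (g : 'rV[R]_n -> R) :
  open D -> {within D, continuous g} -> L1loc D g.
Proof.
move=> oD cg; split; first exact: open_continuous_measurable_rV.
move=> K cK KD; have [M M0 gM] := within_continuous_bounded cg cK KD.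
have mK := compact_measurable_rV cK.
have : (lebesgue_rV R n).-integrable K (EFin \o g).
  apply: (@integrable_bounded_supp _ _ _ _ K _ M) => //.
    exact: compact_lebesgue_rV_lty.
  exact: measurable_funS (open_measurable_rV oD) KD (open_continuous_measurable_rV oD cg).
by move=> /integrableP[].
Qed.

Lemma C1_on_weak_partial n (D : set 'rV[R]_n) (i : 'I_n) (f : 'rV[R]_n -> R) :
  open D -> C1_on D f -> weak_partial D i f ('D_(ebase i) f).
Proof.
move=> oD Cf; split.
- exact: within_continuous_L1loc (C1_on_continuous oD Cf).
- by apply: within_continuous_L1loc => //; case: Cf.
- by move=> phi; exact: C1c_integration_by_parts.
Qed.

End integration_by_parts.

(** * Fubini on rectangles *)

Section fubini_rectangle.
Context d1 d2 (T1 : measurableType d1) (T2 : measurableType d2) {R : realType}.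
Variables (m1 : {sigma_finite_measure set T1 -> \bar R})
  (m2 : {sigma_finite_measure set T2 -> \bar R}).
Variables (A : set T1) (B : set T2).
Hypotheses (mA : measurable A) (mB : measurable B).
Implicit Type f : T1 * T2 -> \bar R.

Let mAB : measurable (A `*` B). Proof. exact: measurableX. Qed.

Let rect1 f x : A x -> (fun y => (f \_ (A `*` B)) (x, y)) = (fun y => f (x, y)) \_ B.
Proof.
move=> Ax; apply/funext => y; rewrite !patchE.
case: ifPn => [/set_mem[_ /= By]|/negP nAB]; first by rewrite ifT// inE.
by case: ifPn => // /set_mem By; exfalso; apply: nAB; rewrite inE.
Qed.

Let rect2 f y : B y -> (fun x => (f \_ (A `*` B)) (x, y)) = (fun x => f (x, y)) \_ A.
Proof.
move=> By; apply/funext => x; rewrite !patchE.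
case: ifPn => [/set_mem[/= Ax _]|/negP nAB]; first by rewrite ifT// inE.
by case: ifPn => // /set_mem Ax; exfalso; apply: nAB; rewrite inE.
Qed.

Let rect10 f x y : ~ A x -> (f \_ (A `*` B)) (x, y) = 0%E.
Proof. by move=> nA; rewrite patchE ifF//; apply/negP => /set_mem[]. Qed.

Let rect20 f x y : ~ B y -> (f \_ (A `*` B)) (x, y) = 0%E.
Proof. by move=> nB; rewrite patchE ifF//; apply/negP => /set_mem[]. Qed.

Lemma ge0_integral_prod12 f : measurable_fun (A `*` B) f ->
  (forall z, (A `*` B) z -> (0 <= f z)%E) ->
  (\int[m1 \x m2]_(z in A `*` B) f z =
   \int[m1]_(x in A) \int[m2]_(y in B) f (x, y))%E.
Proof.
move=> mf f0; rewrite integral_mkcond fubini_tonelli1; last 2 first.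
- exact/(measurable_restrictT _ mAB).
- by move=> z; rewrite patchE; case: ifPn => // /set_mem; exact: f0.
rewrite [RHS]integral_mkcond; apply: eq_integral => x _; rewrite /fubini_F.
rewrite [RHS]patchE; case: ifPn => [/set_mem Ax|/negP nAx].
  by rewrite rect1// -integral_mkcond.
by apply: integral0_eq => y _; apply: rect10 => Ax; apply: nAx; rewrite inE.
Qed.

Lemma ge0_integral_prod21 f : measurable_fun (A `*` B) f ->
  (forall z, (A `*` B) z -> (0 <= f z)%E) ->
  (\int[m1 \x m2]_(z in A `*` B) f z =
   \int[m2]_(y in B) \int[m1]_(x in A) f (x, y))%E.
Proof.
move=> mf f0; rewrite integral_mkcond fubini_tonelli2; last 2 first.
- exact/(measurable_restrictT _ mAB).
- by move=> z; rewrite patchE; case: ifPn => // /set_mem; exact: f0.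
rewrite [RHS]integral_mkcond; apply: eq_integral => y _; rewrite /fubini_G.
rewrite [RHS]patchE; case: ifPn => [/set_mem By|/negP nBy].
  by rewrite rect2// -integral_mkcond.
by apply: integral0_eq => x _; apply: rect20 => By; apply: nBy; rewrite inE.
Qed.

Lemma measurable_fun_integral12 f : measurable_fun (A `*` B) f ->
  measurable_fun A (fun x => \int[m2]_(y in B) f (x, y))%E.
Proof.
move=> mf; have mfr : measurable_fun setT (f \_ (A `*` B)).
  exact/(measurable_restrictT _ mAB).
have m12 : measurable_fun setT (fubini_F m2 (f \_ (A `*` B))).
  rewrite (_ : fubini_F m2 _ = fun x =>
    (fubini_F m2 (f \_ (A `*` B))^\+ x - fubini_F m2 (f \_ (A `*` B))^\- x)%E).
    apply: emeasurable_funB; apply: measurable_fun_fubini_tonelli_F => //.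
      exact: measurable_funepos.
    exact: measurable_funeneg.
  apply/funext => x; rewrite /fubini_F /= [LHS]integralE.
  by congr (_ - _)%E; apply: eq_integral => y _; rewrite ?funeposE ?funenegE.
apply: eq_measurable_fun (measurable_funTS m12) => x /set_mem Ax.
by rewrite /fubini_F rect1// -integral_mkcond.
Qed.

Lemma measurable_fun_Rintegral12 (g : T1 * T2 -> R) : measurable_fun (A `*` B) g ->
  measurable_fun A (fun x => \int[m2]_(y in B) g (x, y)).
Proof.
move=> mg; apply: measurableT_comp => //.
by apply: (measurable_fun_integral12 (f := EFin \o g)); exact/measurable_EFinP.
Qed.

Section integrable.
Variable g : T1 * T2 -> R.
Hypothesis ig : (m1 \x m2)%E.-integrable (A `*` B) (EFin \o g).

Let igr : (m1 \x m2)%E.-integrable setT ((EFin \o g) \_ (A `*` B)).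
Proof. exact/(integrable_mkcond _ mAB). Qed.

Let mg : measurable_fun (A `*` B) g.
Proof. by apply/measurable_EFinP; exact: measurable_int ig. Qed.

Let abse_fine_le (t : \bar R) : (`|(fine t)%:E| <= `|t|)%E.
Proof. by case: t => [r||] //=; rewrite ?normr0 ?leey. Qed.

Lemma integrable_Rintegral12 :
  m1.-integrable A (EFin \o (fun x => \int[m2]_(y in B) g (x, y))).
Proof.
have iF : m1.-integrable A (fubini_F m2 ((EFin \o g) \_ (A `*` B))).
  by apply: integrableS (integrable_fubini_F igr).
apply: le_integrable iF => //.
  by apply/measurable_EFinP; exact: measurable_fun_Rintegral12.
by move=> x Ax; rewrite /fubini_F rect1// -integral_mkcond; exact: abse_fine_le.
Qed.

(** The inner integrals converge only for almost every [x]; taking their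
    real values changes the outer integrand on a null set. *)
Lemma Rintegral_prod12 : \int[(m1 \x m2)%E]_(z in A `*` B) g z =
  \int[m1]_(x in A) \int[m2]_(y in B) g (x, y).
Proof.
rewrite /Rintegral; congr fine.
rewrite integral_mkcond -(integral12_prod_meas1 igr).
rewrite (_ : \int[m1]_x _ = \int[m1]_(x in A) fubini_F m2 ((EFin \o g) \_ (A `*` B)) x)%E; last first.
  rewrite [RHS]integral_mkcond; apply: eq_integral => x _; rewrite [RHS]patchE.
  case: ifPn => // /negP nAx.
  by apply: integral0_eq => y _; apply: rect10 => Ax; apply: nAx; rewrite inE.
apply: ae_eq_integral => //.
- exact: measurable_funTS (measurable_fubini_F igr).
- by apply/measurable_EFinP; exact: (measurable_fun_Rintegral12 mg).
- apply: filterS (ae_integrable1 igr) => x ix Ax; rewrite /fubini_F.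
  by rewrite rect1// in ix *; rewrite -integral_mkcond fineK// integrable_fin_num//;
    exact/(integrable_mkcond _ mB).
Qed.

Lemma ae_integrable_section : {ae m1, forall x, A x -> m2.-integrable B (fun y => (g (x, y))%:E)}.
Proof.
apply: filterS (ae_integrable1 igr) => x ix Ax; rewrite rect1// in ix.
exact/(integrable_mkcond _ mB).
Qed.

Lemma Rintegral_prod21 : \int[(m1 \x m2)%E]_(z in A `*` B) g z =
  \int[m2]_(y in B) \int[m1]_(x in A) g (x, y).
Proof.
rewrite /Rintegral; congr fine.
rewrite integral_mkcond -(integral21_prod_meas1 igr).
rewrite (_ : \int[m2]_y _ = \int[m2]_(y in B) fubini_G m1 ((EFin \o g) \_ (A `*` B)) y)%E; last first.
  rewrite [RHS]integral_mkcond; apply: eq_integral => y _; rewrite [RHS]patchE.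
  case: ifPn => // /negP nBy.
  by apply: integral0_eq => x _; apply: rect20 => By; apply: nBy; rewrite inE.
have E : ae_eq m2 B (fubini_G m1 ((EFin \o g) \_ (A `*` B)))
    (fun y => (fine (\int[m1]_(x in A) (g (x, y))%:E)%E)%:E).
  apply: filterS (ae_integrable2 igr) => y iy By; rewrite /fubini_G.
  by rewrite rect2// in iy *; rewrite -integral_mkcond fineK// integrable_fin_num//;
    exact/(integrable_mkcond _ mA).
have mG : measurable_fun B (fubini_G m1 ((EFin \o g) \_ (A `*` B))).
  exact: measurable_funTS (measurable_fubini_G igr).
apply: ae_eq_integral => //.
apply: (eq_measurable_fun (fun y => (fine (fubini_G m1 ((EFin \o g) \_ (A `*` B)) y))%:E)).
  by move=> y /set_mem By; rewrite /fubini_G rect2// -integral_mkcond.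
by apply/measurable_EFinP; apply: measurableT_comp.
Qed.

End integrable.

Lemma integrable_tensor (a : T1 -> R) (b : T2 -> R) :
  m1.-integrable A (EFin \o a) -> m2.-integrable B (EFin \o b) ->
  (m1 \x m2)%E.-integrable (A `*` B) (EFin \o (fun z => a z.1 * b z.2)).
Proof.
move=> ia ib.
have ma : measurable_fun A a by apply/measurable_EFinP; exact: measurable_int ia.
have mb : measurable_fun B b by apply/measurable_EFinP; exact: measurable_int ib.
have mna : measurable_fun A (fun x => (`|a x|)%:E).
  by apply/measurable_EFinP; apply: measurableT_comp.
have mnb : measurable_fun B (fun y => (`|b y|)%:E).
  by apply/measurable_EFinP; apply: measurableT_comp.
have mab : measurable_fun (A `*` B) (fun z : T1 * T2 => a z.1 * b z.2).
  apply: measurable_funM.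
    apply: (measurable_comp (F := A)) => //; last exact: measurable_funTS.
    by move=> _ [z [Az _] <-].
  apply: (measurable_comp (F := B)) => //; last exact: measurable_funTS.
  by move=> _ [z [_ Bz] <-].
apply/integrableP; split; first exact/measurable_EFinP.
rewrite ge0_integral_prod12//; last by apply: measurableT_comp => //; exact/measurable_EFinP.
have [_ fa] := integrableP _ _ _ ia; have [_ fb] := integrableP _ _ _ ib.
rewrite (eq_integral (fun x => (`|a x|)%:E * \int[m2]_(y in B) `|(b y)%:E|)%E); last first.
  move=> x _; rewrite -ge0_integralZl////.
  by apply: eq_integral => y _ /=; rewrite normrM.
rewrite ge0_integralZr//; last exact: integral_ge0.
  by rewrite lte_mul_pinfty// ?integral_ge0// ge0_fin_numE// integral_ge0.
Qed.

End fubini_rectangle.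

(** * Uniqueness of weak and nonlocal derivatives *)

Section weak_derivatives.
Context {R : realType} {N : nat}.
Local Notation V := 'rV[R]_N.
Local Notation mu := (lebesgue_rV R N).
Local Notation mu2 := (mu \x mu)%E.
Implicit Types (D : set V) (i : 'I_N) (u : V -> R).

Lemma L1loc_integrable D u (K : set V) : open D -> L1loc D u ->
  compact K -> K `<=` D -> mu.-integrable K (EFin \o u).
Proof.
move=> oD [mu_ iu] cK KD; apply/integrableP; split; last exact: iu.
apply/measurable_EFinP; apply: measurable_funS KD mu_; exact: open_measurable_rV.
Qed.

Lemma L1loc2_integrable D (g : V * V -> R) (K : set (V * V)) : open D ->
  L1loc2 D g -> compact K -> K `<=` D `*` D -> mu2.-integrable K (EFin \o g).
Proof.
move=> oD [mg ig] cK KD; apply/integrableP; split; last exact: ig.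
apply/measurable_EFinP; apply: measurable_funS KD mg.
by apply: open_measurable_rV2; exact: openX.
Qed.

Lemma L1loc_mul_integrable D u (K : set V) (phi : V -> R) : open D ->
  L1loc D u -> {within D, continuous phi} -> compact K -> K `<=` D ->
  (forall x, ~ K x -> phi x = 0) -> mu.-integrable D (EFin \o (u \* phi)).
Proof.
move=> oD [mu_ iu] cphi cK KD phi0.
have [M M0 hM] := within_continuous_bounded cphi cK KD.
apply: (integrable_mul_supp (K := K) (M := M)) => //.
- exact: open_measurable_rV.
- exact: compact_measurable_rV.
- exact: open_continuous_measurable_rV.
- exact: iu.
- by move=> x _; exact: phi0.
Qed.

Lemma L1loc2_mul_integrable D (g : V * V -> R) (K : set (V * V))
    (psi : V * V -> R) : open D ->
  L1loc2 D g -> {within D `*` D, continuous psi} -> compact K ->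
  K `<=` D `*` D -> (forall z, ~ K z -> psi z = 0) ->
  mu2.-integrable (D `*` D) (EFin \o (g \* psi)).
Proof.
move=> oD [mg ig] cpsi cK KD psi0; have oDD := openX oD oD.
have [M M0 hM] := within_continuous_bounded cpsi cK KD.
apply: (integrable_mul_supp (K := K) (M := M)) => //.
- exact: open_measurable_rV2.
- exact: compact_measurable_rV2.
- exact: open_continuous_measurable_rV2.
- exact: ig.
- by move=> x _; exact: psi0.
Qed.

Lemma L1loc_C1c_integrable D u phi : open D -> L1loc D u -> C1c D phi ->
  mu.-integrable D (EFin \o (u \* phi)).
Proof.
move=> oD Lu Cphi; have [K [cK KD phi0 _]] := C1c_supp Cphi.
apply: (L1loc_mul_integrable oD Lu _ cK KD phi0).
by apply: C1_on_continuous => //; case: Cphi.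
Qed.

Lemma L1loc2_C1c_integrable D (g psi : V * V -> R) : open D -> L1loc2 D g ->
  C1c (D `*` D) psi -> mu2.-integrable (D `*` D) (EFin \o (g \* psi)).
Proof.
move=> oD Lg Cpsi; have [K [cK KD psi0 _]] := C1c_supp Cpsi.
apply: (L1loc2_mul_integrable oD Lg _ cK KD psi0).
by apply: C1_on_continuous; [exact: openX|case: Cpsi].
Qed.

Lemma L1loc_derive_integrable D u phi v : open D -> L1loc D u -> C1c D phi ->
  mu.-integrable D (EFin \o (u \* 'D_v phi)).
Proof.
move=> oD Lu Cphi; have [K [cK KD _ dphi0]] := C1c_supp Cphi.
apply: (L1loc_mul_integrable oD Lu _ cK KD).
  by case: Cphi => -[_ cphi] _ _.
by move=> x /dphi0.
Qed.

Lemma L1locB D u (g : V -> R) : open D -> L1loc D u -> L1loc D g -> L1loc D (u \- g).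
Proof.
move=> oD Lu Lg; split; first by apply: measurable_funB; [case: Lu|case: Lg].
move=> K cK KD; have mK := compact_measurable_rV cK.
have : mu.-integrable K ((EFin \o u) \- (EFin \o g))%E.
  by apply: integrableB => //; apply: L1loc_integrable oD _ cK KD.
by move=> /integrableP[_].
Qed.

Lemma L1loc2B D (f g : V * V -> R) : open D -> L1loc2 D f -> L1loc2 D g ->
  L1loc2 D (f \- g).
Proof.
move=> oD Lu Lg; split; first by apply: measurable_funB; [case: Lu|case: Lg].
move=> K cK KD; have mK := compact_measurable_rV2 cK.
have : mu2.-integrable K ((EFin \o f) \- (EFin \o g))%E.
  by apply: integrableB => //; apply: L1loc2_integrable oD _ cK KD.
by move=> /integrableP[_].
Qed.

Lemma weak_partial_unique D i u (g1 g2 : V -> R) : open D ->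
  weak_partial D i u g1 -> weak_partial D i u g2 ->
  {ae mu, forall x, D x -> g1 x = g2 x}.
Proof.
move=> oD [_ L1 e1] [_ L2 e2].
have : {ae mu, forall x, D x -> (g1 \- g2) x = 0}.
  apply: fundamental_lemma_rV => //; first exact: L1locB.
  move=> phi Cphi; under eq_Rintegral do rewrite /= mulrBl.
  rewrite RintegralB//; last 3 first.
  - exact: open_measurable_rV.
  - exact: L1loc_C1c_integrable.
  - exact: L1loc_C1c_integrable.
  by apply/eqP; rewrite subr_eq0 -eqr_opp -e1// -e2.
by apply: filterS => x h /h /eqP; rewrite subr_eq0 => /eqP.
Qed.

Lemma nl_weak_partial_unique D omega i u (g1 g2 : V * V -> R) : open D ->
  nl_weak_partial D omega i u g1 -> nl_weak_partial D omega i u g2 ->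
  {ae mu2, forall z, (D `*` D) z -> g1 z = g2 z}.
Proof.
move=> oD [_ L1 e1] [_ L2 e2].
have : {ae mu2, forall z, (D `*` D) z -> (g1 \- g2) z = 0}.
  apply: fundamental_lemma_rV2 => //; first exact: L1loc2B.
  move=> psi Cpsi; under eq_Rintegral do rewrite /= mulrBl.
  rewrite RintegralB//; last 3 first.
  - by apply: open_measurable_rV2; exact: openX.
  - exact: L1loc2_C1c_integrable.
  - exact: L1loc2_C1c_integrable.
  by apply/eqP; rewrite subr_eq0 -eqr_opp -e1// -e2.
by apply: filterS => x h /h /eqP; rewrite subr_eq0 => /eqP.
Qed.

Lemma weak_gradP D i u : (exists g, weak_partial D i u g) ->
  weak_partial D i u (fun x => weak_grad D u x ord0 i).
Proof.
move=> [g wg].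
rewrite (_ : (fun x => _) = xget (cst 0) [set g | weak_partial D i u g]).
  exact: xgetPex (ex_intro _ g wg).
by apply/funext => x; rewrite mxE.
Qed.

Lemma nl_gradP D omega i u : (exists g, nl_weak_partial D omega i u g) ->
  nl_weak_partial D omega i u (fun z => nl_grad D omega u z ord0 i).
Proof.
move=> [g wg].
rewrite (_ : (fun z => _) = xget (cst 0) [set g | nl_weak_partial D omega i u g]).
  exact: xgetPex (ex_intro _ g wg).
by apply/funext => x; rewrite mxE.
Qed.

End weak_derivatives.

(** * The nonlocal derivative of a weakly differentiable function *)

Section nonlocal_from_local.
Context {R : realType} {N : nat}.
Local Notation V := 'rV[R]_N.
Local Notation mu := (lebesgue_rV R N).
Local Notation mu2 := (mu \x mu)%E.

Lemma integrable_cst_compact (K : set V) (c : R) : compact K ->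
  mu.-integrable K (EFin \o cst c).
Proof.
move=> cK; have mK := compact_measurable_rV cK.
apply: (integrable_bounded_supp (K := K) (M := `|c|)) => //.
exact: compact_lebesgue_rV_lty.
Qed.

Lemma measurable_fun_fst (D E : set V) (g : V -> R) :
  measurable D -> measurable E -> measurable_fun D g ->
  measurable_fun (D `*` E) (fun z : V * V => g z.1).
Proof.
move=> mD mE mg; apply: (measurable_comp (F := D)) => //; last exact: measurable_funTS.
by move=> _ [z [Dz _] <-].
Qed.

Lemma measurable_fun_snd (D E : set V) (g : V -> R) :
  measurable D -> measurable E -> measurable_fun E g ->
  measurable_fun (D `*` E) (fun z : V * V => g z.2).
Proof.
move=> mD mE mg; apply: (measurable_comp (F := E)) => //; last exact: measurable_funTS.
by move=> _ [z [_ Ez] <-].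
Qed.

Lemma Rintegral_swap (D : set V) (f : V * V -> R) : measurable D ->
  mu2.-integrable (D `*` D) (EFin \o f) ->
  mu2.-integrable (D `*` D) (EFin \o (fun z => f (z.2, z.1))) ->
  \int[mu2]_(z in D `*` D) f (z.2, z.1) = \int[mu2]_(z in D `*` D) f z.
Proof. by move=> mD i1 i2; rewrite Rintegral_prod12// [RHS]Rintegral_prod21. Qed.

Lemma L1loc_cst (D : set V) (c : R) : L1loc D (cst c).
Proof.
split=> [|K cK _]; first exact: measurable_cst.
by have /integrableP[] := integrable_cst_compact c cK.
Qed.

Lemma eq_L1loc (D : set V) (f g : V -> R) : f =1 g -> L1loc D f -> L1loc D g.
Proof. by move=> /funext ->. Qed.

Section products.
Variables (D L : set V).
Hypotheses (oD : open D) (cL : compact L) (LD : L `<=` D).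
Let mD := open_measurable_rV oD.
Let mL := compact_measurable_rV cL.
Let LLD : L `*` L `<=` D `*` D. Proof. by move=> z [/LD ? /LD]. Qed.

(** A locally integrable function of one variable is integrable on [L * L],
    since [L] has finite measure; outside this set [chi] vanishes. *)
Lemma integrable_fst_mul (h : V -> R) (chi : V * V -> R) : L1loc D h ->
  {within D `*` D, continuous chi} -> (forall z, ~ (L `*` L) z -> chi z = 0) ->
  mu2.-integrable (D `*` D) (EFin \o (fun z => h z.1 * chi z)).
Proof.
move=> Lh cchi chi0; have [mh _] := Lh.
have [M M0 hM] := within_continuous_bounded cchi (compact_setX cL cL) LLD.
apply: (integrable_mul_supp (u := fun z : V * V => h z.1) (K := L `*` L) (M := M)) => //.
- exact: measurableX.
- exact: measurableX.
- exact: measurable_fun_fst.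
- exact: open_continuous_measurable_rV2 (openX oD oD) cchi.
- have := integrable_tensor mL mL (L1loc_integrable oD Lh cL LD)
    (integrable_cst_compact 1 cL).
  move=> /integrableP[_]; apply: le_lt_trans; rewrite le_eqVlt; apply/orP; left.
  by apply/eqP; apply: eq_integral => z _; rewrite /= mulr1.
- by move=> z _; exact: chi0.
Qed.

Lemma integrable_snd_mul (h : V -> R) (chi : V * V -> R) : L1loc D h ->
  {within D `*` D, continuous chi} -> (forall z, ~ (L `*` L) z -> chi z = 0) ->
  mu2.-integrable (D `*` D) (EFin \o (fun z => h z.2 * chi z)).
Proof.
move=> Lh cchi chi0; have [mh _] := Lh.
have [M M0 hM] := within_continuous_bounded cchi (compact_setX cL cL) LLD.
apply: (integrable_mul_supp (u := fun z : V * V => h z.2) (K := L `*` L) (M := M)) => //.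
- exact: measurableX.
- exact: measurableX.
- exact: measurable_fun_snd.
- exact: open_continuous_measurable_rV2 (openX oD oD) cchi.
- have := integrable_tensor mL mL (integrable_cst_compact 1 cL)
    (L1loc_integrable oD Lh cL LD).
  move=> /integrableP[_]; apply: le_lt_trans; rewrite le_eqVlt; apply/orP; left.
  by apply/eqP; apply: eq_integral => z _; rewrite /= mul1r.
- by move=> z _; exact: chi0.
Qed.

Lemma integrable_section_snd (chi : V * V -> R) x : D x ->
  {within D `*` D, continuous chi} -> (forall z, ~ (L `*` L) z -> chi z = 0) ->
  mu.-integrable D (EFin \o (fun y => chi (x, y))).
Proof.
move=> Dx cchi chi0.
have cy : {within D, continuous (fun y => chi (x, y))}.
  rewrite continuous_open_subspace// => y /set_mem Dy.
  move: cchi; rewrite continuous_open_subspace; last exact: openX.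
  move=> /(_ (x, y)); rewrite inE => /(_ (conj Dx Dy)) c.
  apply: (continuous_comp (g := chi)) c.
  by apply: differentiable_continuous; apply: differentiable_pair.
have [M M0 hM] := within_continuous_bounded cy cL LD.
apply: (integrable_bounded_supp (K := L) (M := M)) => //.
- exact: compact_lebesgue_rV_lty.
- exact: open_continuous_measurable_rV.
- by move=> y _ ny; apply: chi0 => -[].
Qed.

End products.

Section with_weight.
Variables (D : set V) (omega : V * V -> R).
Hypotheses (oD : open D) (adm : admissible_weight D omega).
Let mD := open_measurable_rV oD.
Let oDD := openX oD oD.
Let mDD := open_measurable_rV2 oDD.

Let Comega : C1_on (D `*` D) omega. Proof. by case: adm. Qed.

Lemma admissible_sym z : (D `*` D) z -> omega (z.2, z.1) = omega z.
Proof. by case: z => x y [/= Dx Dy]; case: adm => _ sym _; rewrite sym. Qed.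

Lemma measurable_weight : measurable_fun (D `*` D) omega.
Proof. exact: open_continuous_measurable_rV2 oDD (C1_on_continuous oDD Comega). Qed.

(** The nonlocal derivative of a function whose weak derivative is [g]. *)
Definition nl_diff (g : V -> R) (z : V * V) : R := omega z * (g z.2 - g z.1).

Lemma L1loc2_nl_diff (g : V -> R) : L1loc D g -> L1loc2 D (nl_diff g).
Proof.
move=> Lg; have [mg _] := Lg; split.
  apply: measurable_funM; first exact: measurable_weight.
  by apply: measurable_funB; [exact: measurable_fun_snd|exact: measurable_fun_fst].
move=> K cK KD; have mK := compact_measurable_rV2 cK.
have [L [cL LD KL]] := compact_sub_square cK KD.
have mL := compact_measurable_rV cL.
have ig := L1loc_integrable oD Lg cL LD; have i1 := integrable_cst_compact 1 cL.
have iL : mu2.-integrable (L `*` L) (EFin \o (fun z => 1 * g z.2 - g z.1 * 1)).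
  rewrite (_ : EFin \o _ = ((EFin \o (fun z : V * V => (1 * g z.2)%R)) \-
    (EFin \o (fun z : V * V => g z.1 * 1)%R))%E)//.
  apply: integrableB; first exact: measurableX.
    exact: (integrable_tensor mL mL i1 ig).
  exact: (integrable_tensor mL mL ig i1).
have [M M0 hM] := within_continuous_bounded (C1_on_continuous oDD Comega) cK KD.
have : mu2.-integrable K (EFin \o ((fun z => 1 * g z.2 - g z.1 * 1) \* omega)).
  apply: (integrable_mul_supp (K := K) (M := M)) => //.
  - apply/measurable_EFinP.
    exact: measurable_funS (measurableX mL mL) KL (measurable_int _ iL).
  - exact: measurable_funS mDD KD measurable_weight.
  - by have /integrableP[] := integrableS (measurableX mL mL) mK KL iL.
move=> /integrableP[_].
by under eq_integral do rewrite /= mul1r mulr1 mulrC.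
Qed.

(** Put [Psi (x, y) = omega (x, y) * (psi (y, x) - psi (x, y))].  For fixed [y]
    this is a test function of [x], so the derivative can be moved to [u]; in
    the remaining integral of [- g x * Psi (x, y)] the part with [psi (y, x)]
    turns into one with [psi (x, y)] and [g y] by exchanging the variables,
    which leaves the weight unchanged. *)
Lemma weak_partial_nl (i : 'I_N) (u g : V -> R) : weak_partial D i u g ->
  nl_weak_partial D omega i u (nl_diff g).
Proof.
move=> [Lu Lg ug]; split=> //; first exact: L1loc2_nl_diff.
move=> psi Cpsi.
pose Psi z := (psi (z.2, z.1) - psi z) * omega z.
have [L [cL LD psi0 _]] := C1c_supp2 Cpsi.
have mL := compact_measurable_rV cL.
have cLL : compact (L `*` L) by exact: compact_setX.
have LLD : L `*` L `<=` D `*` D by move=> z [/LD ? /LD].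
have Cpsi1 : C1_on (D `*` D) psi by case: Cpsi.
have Cpsis : C1_on (D `*` D) (fun z => psi (z.2, z.1)) by exact: C1_on_swap.
have psis0 z : ~ (L `*` L) z -> psi (z.2, z.1) = 0.
  by move=> nz; apply: psi0 => -[? ?]; apply: nz.
have CPsi1 : C1_on (D `*` D) Psi.
  exact: C1_onM oDD (C1_onB oDD Cpsis Cpsi1) Comega.
have Psi0 z : ~ (L `*` L) z -> Psi z = 0.
  by move=> nz; rewrite /Psi (psi0 z nz) (psis0 z nz) subrr mul0r.
have CPsi : C1c (D `*` D) Psi by exact: C1c_intro CPsi1 cLL LLD Psi0.
have clLL : closed (L `*` L) by exact: compact_closed (@norm_hausdorff _ _) cLL.
have dPsi0 z v : ~ (L `*` L) z -> 'D_v Psi z = 0 by exact: derive_out_closed.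
have [_ cdPsi] := CPsi1.
pose H := 'D_(ebase i, 0) Psi.
have adjE x : nl_adjoint D omega i psi x = \int[mu]_(y in D) H (x, y).
  apply: eq_Rintegral => y _; rewrite /H -derive_section /Psi.
  by under eq_fun do rewrite mulrC.
have int_fst := integrable_fst_mul oD cL LD.
have int_snd := integrable_snd_mul oD cL LD.
have cPsi := C1_on_continuous oDD CPsi1.
transitivity (\int[mu2]_(z in D `*` D) (u z.1 * H z)).
  rewrite (Rintegral_prod12 mD mD (int_fst u H Lu (cdPsi _) (fun z => dPsi0 z _))).
  apply: eq_Rintegral => x /set_mem Dx; rewrite adjE -RintegralZl//.
  by apply: (integrable_section_snd oD cL LD Dx (cdPsi _)) => z nz; exact: dPsi0.
rewrite (Rintegral_prod21 mD mD (int_fst u H Lu (cdPsi _) (fun z => dPsi0 z _))).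
have LNg : L1loc D (fun x => - g x).
  by apply: (eq_L1loc _ (L1locB oD (L1loc_cst D 0) Lg)) => x; rewrite /= sub0r.
transitivity (\int[mu2]_(z in D `*` D) (- g z.1 * Psi z)).
  rewrite (Rintegral_prod21 mD mD (int_fst _ Psi LNg cPsi Psi0)).
  apply: eq_Rintegral => y /set_mem Dy.
  have CPy : C1c D (fun x => Psi (x, y)).
    apply: (C1c_intro _ cL LD).
      have := C1_on_section y oDD CPsi1.
      by congr C1_on; apply/seteqP; split=> x /= => [[]|].
    by move=> x nx; apply: Psi0 => -[].
  transitivity (\int[mu]_(x in D) (u x * 'D_(ebase i) (fun x => Psi (x, y)) x)).
    by apply: eq_Rintegral => x _; rewrite /H -derive_section.
  rewrite ug// -mulN1r -RintegralZl//; last exact: L1loc_C1c_integrable.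
  by apply: eq_Rintegral => x _ /=; rewrite mulNr mul1r mulNr.
have ctn (f : V * V -> R) : C1_on (D `*` D) f -> {within D `*` D, continuous f}.
  exact: C1_on_continuous.
pose a z := g z.1 * (psi (z.2, z.1) * omega z).
pose b z := g z.1 * (psi z * omega z).
pose c z := g z.2 * (psi z * omega z).
have ia : mu2.-integrable (D `*` D) (EFin \o a).
  apply: (int_fst g _ Lg); first by apply: ctn; exact: C1_onM oDD Cpsis Comega.
  by move=> z nz; rewrite (psis0 z nz) mul0r.
have ib : mu2.-integrable (D `*` D) (EFin \o b).
  apply: (int_fst g _ Lg); first by apply: ctn; exact: C1_onM oDD Cpsi1 Comega.
  by move=> z nz; rewrite (psi0 z nz) mul0r.
have ic : mu2.-integrable (D `*` D) (EFin \o c).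
  apply: (int_snd g _ Lg); first by apply: ctn; exact: C1_onM oDD Cpsi1 Comega.
  by move=> z nz; rewrite (psi0 z nz) mul0r.
have aE z : (D `*` D) z -> a z = c (z.2, z.1).
  by move=> Dz; rewrite /a /c /= admissible_sym.
transitivity (\int[mu2]_(z in D `*` D) (b z - a z)).
  by apply: eq_Rintegral => z _; rewrite /a /b /Psi; ring.
rewrite RintegralB//.
have -> : \int[mu2]_(z in D `*` D) a z = \int[mu2]_(z in D `*` D) c z.
  have ics : mu2.-integrable (D `*` D) (EFin \o (fun z => c (z.2, z.1))).
    by apply: eq_integrable ia => // z /set_mem Dz; rewrite /= aE.
  rewrite -(Rintegral_swap mD ic ics).
  by apply: eq_Rintegral => z /set_mem Dz; exact: aE.
rewrite -opprB -RintegralB//; congr (- _).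
by apply: eq_Rintegral => z _; rewrite /b /c /nl_diff; ring.
Qed.

End with_weight.
End nonlocal_from_local.

(** * The weak derivative of a nonlocally differentiable function *)

Section local_from_nonlocal.
Context {R : realType} {N : nat}.
Local Notation V := 'rV[R]_N.
Local Notation mu := (lebesgue_rV R N).
Local Notation mu2 := (mu \x mu)%E.
Variables (D : set V) (omega : V * V -> R) (k : R).
Hypotheses (oD : open D) (adm : admissible_weight D omega).
Hypotheses (k0 : 0 < k) (k_le : forall z, (D `*` D) z -> k <= omega z).
Variable eta : V -> R.
Hypotheses (Ceta : C1c D eta) (eta1 : \int[mu]_(x in D) eta x = 1).
Let mD := open_measurable_rV oD.
Let oDD := openX oD oD.
Let mDD := open_measurable_rV2 oDD.

Let omega_gt0 z : (D `*` D) z -> 0 < omega z.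
Proof. by move=> /k_le; exact: lt_le_trans. Qed.

Let omega_neq0 z : (D `*` D) z -> omega z != 0.
Proof. by move=> /omega_gt0; exact: lt0r_neq0. Qed.

Let CVomega : C1_on (D `*` D) (fun z => (omega z)^-1).
Proof. by apply: (C1_onV oDD omega_neq0); case: adm. Qed.

Let Ceta1 : C1_on D eta. Proof. by case: Ceta. Qed.

Let Ceta2 : C1_on (D `*` D) (fun z => eta z.2).
Proof. by apply: C1_on_subset (@C1_on_snd _ V _ _ _ oD Ceta1) => z []. Qed.

Definition nl_kernel (z : V * V) : R := eta z.2 * (omega z)^-1.

Let Ckernel : C1_on (D `*` D) nl_kernel.
Proof. exact: C1_onM oDD Ceta2 CVomega. Qed.

Lemma nl_kernel_bounded : exists2 M, 0 < M &
  forall z, (D `*` D) z -> `|nl_kernel z| <= M.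
Proof.
have [M M0 hM] := C1c_bounded oD Ceta; exists (M / k); first exact: divr_gt0.
move=> z Dz; rewrite normrM; apply: ler_pM => //.
by rewrite gtr0_norm ?invr_gt0 ?omega_gt0// lef_pV2 ?posrE ?omega_gt0// k_le.
Qed.

(** The average of a nonlocal derivative in the second variable, divided by the
    weight: for [g = nl_diff omega h] it is the mean of [h], taken with respect
    to [eta], minus [h x]. *)
Definition nl_average (g : V * V -> R) (x : V) : R :=
  \int[mu]_(y in D) (g (x, y) * nl_kernel (x, y)).

Lemma measurable_nl_average g : L1loc2 D g -> measurable_fun D (nl_average g).
Proof.
move=> [mg _]; apply: (measurable_fun_Rintegral12 mu mD mD (g := g \* nl_kernel)).
apply: measurable_funM => //.
exact: open_continuous_measurable_rV2 oDD (C1_on_continuous oDD Ckernel).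
Qed.

Lemma L1loc_nl_average g : L1loc2 D g -> L1loc D (nl_average g).
Proof.
move=> Lg; split; first exact: measurable_nl_average.
move=> K cK KD; have mK := compact_measurable_rV cK.
have [L [cL LD eta0 _]] := C1c_supp Ceta; have mL := compact_measurable_rV cL.
have [M M0 hM] := nl_kernel_bounded.
have mker := open_continuous_measurable_rV2 oDD (C1_on_continuous oDD Ckernel).
have [mg ig] := Lg.
have KDD : K `*` D `<=` D `*` D by move=> z [/KD ? ?].
have KLKD : K `*` L `<=` K `*` D by move=> z [? /LD].
have i : mu2.-integrable (K `*` D) (EFin \o (g \* nl_kernel)).
  apply: (integrable_mul_supp (K := K `*` L) (M := M)) => //.
  - exact: measurableX.
  - exact: measurableX.
  - exact: measurable_funS mDD KDD mg.
  - exact: measurable_funS mDD KDD mker.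
  - by apply: ig; [exact: compact_setX|move=> z [/KD ? /LD]].
  - by move=> z [/KD ? /LD ?]; exact: hM.
  - by move=> z [? ?] nz; rewrite /nl_kernel eta0 ?mul0r// => ?; apply: nz.
by have /integrableP[] := integrable_Rintegral12 mK mD i.
Qed.

(** For [g = nl_diff omega h] with [h] the derivative of [u], the integral of
    [u * D_i eta] cancels the mean of [h] in [nl_average g], which leaves
    [h]. *)
Definition local_derivative i (u : V -> R) (g : V * V -> R) (x : V) : R :=
  - (\int[mu]_(x in D) (u x * 'D_(ebase i) eta x) + nl_average g x).

Let Rintegral0_eq (f : V -> R) :
  (forall y, D y -> f y = 0) -> \int[mu]_(y in D) f y = 0.
Proof. by move=> f0; rewrite /Rintegral integral0_eq// => y /f0 ->. Qed.

(** The test function [psi] below is chosen to make the weight cancel in the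
    nonlocal adjoint, which separates the variables. *)
Lemma nl_weak_partial_local i (u : V -> R) (g : V * V -> R) :
  nl_weak_partial D omega i u g -> weak_partial D i u (local_derivative i u g).
Proof.
move=> [Lu Lg ug]; set c := \int[mu]_(x in D) (u x * 'D_(ebase i) eta x).
have LG := L1loc_nl_average Lg.
split => //.
  apply: (eq_L1loc _ (L1locB oD (L1loc_cst D (- c)) LG)) => x.
  by rewrite /local_derivative /= opprD.
move=> phi Cphi.
have Cphi1 : C1_on D phi by case: Cphi.
have [dphi _] := Cphi1; have [deta _] := Ceta1.
pose psi z := phi z.1 * eta z.2 * (omega z)^-1.
have Cpsi : C1c (D `*` D) psi.
  exact: C1cM oDD (C1c_tensor oD oD Cphi Ceta) CVomega.
have iphi : mu.-integrable D (EFin \o phi).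
  have := L1loc_C1c_integrable oD (L1loc_cst D 1) Cphi.
  by apply: eq_integrable => // x _ /=; rewrite mul1r.
have ieta : mu.-integrable D (EFin \o eta).
  have := L1loc_C1c_integrable oD (L1loc_cst D 1) Ceta.
  by apply: eq_integrable => // x _ /=; rewrite mul1r.
set I := \int[mu]_(y in D) phi y.
have adjE x : D x -> nl_adjoint D omega i psi x =
    'D_(ebase i) eta x * I - 'D_(ebase i) phi x.
  move=> Dx; rewrite -[X in _ - X]mulr1 -eta1 -!RintegralZl// -RintegralB//; last 2 first.
  - by under [X in _.-integrable _ X]eq_fun do rewrite /= EFinM; exact: integrableZl.
  - by under [X in _.-integrable _ X]eq_fun do rewrite /= EFinM; exact: integrableZl.
  apply: eq_Rintegral => y /set_mem Dy.
  transitivity ('D_(ebase i) (fun x' => eta x' * phi y - phi x' * eta y) x).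
    apply: near_eq_derive; have : nbhs x D by exact: open_nbhs_nbhs.
    apply: filterS => x' Dx'; rewrite /psi /= [omega (y, x')](admissible_sym adm (z := (x', y)))//.
    have w0 := omega_neq0 (conj Dx' Dy : (D `*` D) (x', y)).
    by field.
  rewrite deriveB; last 2 first.
  - by apply: derivableM => //; apply: diff_derivable; exact: deta.
  - by apply: derivableM => //; apply: diff_derivable; exact: dphi.
  rewrite !deriveMr; [|by apply: diff_derivable; exact: dphi|by apply: diff_derivable; exact: deta].
  by rewrite mulrC [X in _ - X]mulrC.
have iuphi := L1loc_derive_integrable (ebase i) oD Lu Cphi.
have iueta := L1loc_derive_integrable (ebase i) oD Lu Ceta.
have E1 : \int[mu]_(x in D) (u x * nl_adjoint D omega i psi x) =
    c * I - \int[mu]_(x in D) (u x * 'D_(ebase i) phi x).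
  rewrite -RintegralZr// -RintegralB//; last first.
    by under [X in _.-integrable _ X]eq_fun do rewrite /= EFinM; exact: integrableZr.
  by apply: eq_Rintegral => x /set_mem Dx; rewrite adjE//=; ring.
have E2 : \int[mu2]_(z in D `*` D) (g z * psi z) =
    \int[mu]_(x in D) (nl_average g x * phi x).
  rewrite (Rintegral_prod12 mD mD (L1loc2_C1c_integrable oD Lg Cpsi)).
  have igp := L1loc2_C1c_integrable oD Lg Cpsi.
  rewrite /Rintegral; congr fine; apply: ae_eq_integral => //.
  - exact: measurable_int (integrable_Rintegral12 mD mD igp).
  - exact: measurable_int (L1loc_C1c_integrable oD LG Cphi).
  apply: filterS (ae_integrable_section mD mD igp) => x /= ix Dx; congr EFin.
  rewrite -/(Rintegral _ _ _).
  (* Integrability of the section of [g * psi] gives that of [g * nl_kernel]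
     only where [phi] does not vanish. *)
  have [phi0|phi0] := eqVneq (phi x) 0.
    rewrite phi0 mulr0; apply: Rintegral0_eq => y _.
    by rewrite /psi /= phi0 !mul0r mulr0.
  rewrite /nl_average -RintegralZr//.
    by apply: eq_Rintegral => y _; rewrite /psi /nl_kernel /=; ring.
  have := integrableZl mD (phi x)^-1 (ix Dx).
  apply: eq_integrable => // y _; rewrite /= -EFinM; congr EFin.
  by rewrite /psi /nl_kernel /=; set w := (omega _)^-1; field.
have iGphi := L1loc_C1c_integrable oD LG Cphi.
have := ug psi Cpsi; rewrite E1 E2 => E3.
have -> : \int[mu]_(x in D) (local_derivative i u g x * phi x) =
    - (c * I) - \int[mu]_(x in D) (nl_average g x * phi x).
  rewrite -mulNr -RintegralZl// -RintegralB//; last first.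
    by under [X in _.-integrable _ X]eq_fun do rewrite /= EFinM; exact: integrableZl.
  by apply: eq_Rintegral => x _; rewrite /local_derivative -/c; ring.
by move: E3; lra.
Qed.

End local_from_nonlocal.

(** * L^p norms on a set *)

Section Lp_norm_theory.
Context d (T : measurableType d) {R : realType} (mu : {measure set T -> \bar R}).
Implicit Types (p : \bar R) (D : set T) (f g : T -> R).
Local Open Scope ereal_scope.

Lemma Lp_norm_ge0 p D f : 0 <= Lp_norm mu p D f.
Proof. exact: Lnorm_ge0. Qed.

Lemma Lp_norm_finE (q : R) D f : (1 <= q)%R ->
  Lp_norm mu q%:E D f = (\int[mu]_(x in D) (`|f x| `^ q)%:E) `^ q^-1.
Proof.
move=> q1; have q0 : q != 0%R by lra.
rewrite /Lp_norm unlock; congr poweR; rewrite [RHS]integral_mkcond.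
apply: eq_integral => x _; rewrite !patchE; case: ifP => _ //=.
by rewrite normr0 powR0.
Qed.

Lemma Lp_norm_yE D f : 0 < mu setT ->
  Lp_norm mu +oo D f = ess_sup mu (abse \o ((EFin \o f) \_ D)).
Proof. by move=> mu0; rewrite /Lp_norm unlock mu0. Qed.

Lemma measurable_fun_powR D f (q : R) : measurable_fun D f ->
  measurable_fun D (fun x => (`|f x| `^ q)%:E).
Proof.
move=> mf; apply/measurable_EFinP.
apply: (measurableT_comp (measurable_powR q)).
exact: measurableT_comp.
Qed.

Lemma Lp_norm_le p D f g : 1 <= p -> measurable D ->
  measurable_fun D f -> measurable_fun D g ->
  {ae mu, forall x, D x -> (`|f x| <= `|g x|)%R} ->
  Lp_norm mu p D f <= Lp_norm mu p D g.
Proof.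
move=> p1 mD mf mg fg; case: p p1 => [q||]//; rewrite ?lee_fin => q1.
  have q0 : (0 < q)%R by lra.
  rewrite (Lp_norm_finE D f q1) (Lp_norm_finE D g q1); apply: gt0_ler_poweR.
  - by rewrite invr_ge0 ltW.
  - by rewrite in_itv /= leey andbT integral_ge0// => x _; rewrite lee_fin powR_ge0.
  - by rewrite in_itv /= leey andbT integral_ge0// => x _; rewrite lee_fin powR_ge0.
  apply: ae_ge0_le_integral => //.
  - exact: measurable_fun_powR.
  - exact: measurable_fun_powR.
  apply: filterS fg => x fg Dx; rewrite lee_fin.
  by apply: ge0_ler_powR (fg Dx); rewrite ?nnegrE// ltW.
rewrite /Lp_norm unlock; case: ifP => // _; apply: le_ess_sup.
apply: filterS fg => x fg /=; rewrite !patchE; case: ifP => // /set_mem Dx.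
by rewrite lee_fin fg.
Qed.

Lemma Lp_normD p D f g : 1 <= p -> measurable D ->
  measurable_fun D f -> measurable_fun D g ->
  Lp_norm mu p D (fun x => f x + g x)%R <= Lp_norm mu p D f + Lp_norm mu p D g.
Proof.
move=> p1 mD mf mg; rewrite /Lp_norm !restrict_EFin.
rewrite (_ : (fun x => f x + g x)%R \_ D = (f \_ D \+ g \_ D)%R); last first.
  by apply/funext => x /=; rewrite !patchE; case: ifP => //; rewrite addr0.
by apply: eminkowski => //; exact/(measurable_restrictT _ mD).
Qed.

Lemma Lp_normZ p D (c : R) f : 1 <= p -> measurable D -> measurable_fun D f ->
  Lp_norm mu p D (fun x => c * f x)%R <= `|c|%:E * Lp_norm mu p D f.
Proof.
move=> p1 mD mf; case: p p1 => [q||]//; rewrite ?lee_fin => q1.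
  have q0 : (0 < q)%R by lra.
  rewrite !Lp_norm_finE//.
  rewrite (eq_integral (fun x => (`|c| `^ q)%:E * (`|f x| `^ q)%:E)) => [|x _]; last first.
    by rewrite normrM powRM.
  rewrite ge0_integralZl//; last exact: measurable_fun_powR.
  rewrite poweRM ?lee_fin ?powR_ge0 ?integral_ge0//.
  by rewrite poweR_EFin -powRrM mulfV ?gt_eqF// powRr1.
rewrite /Lp_norm unlock; case: ifP => mu0; last by rewrite mule0.
rewrite -ess_supZl//; apply: le_ess_sup; apply: aeW => x /=.
by rewrite !patchE; case: ifP => _; rewrite ?abse0 ?mule0//= normrM EFinM.
Qed.

Lemma Lp_norm0 p D : 1 <= p -> Lp_norm mu p D (cst 0%R) = 0.
Proof.
move=> p1; rewrite /Lp_norm.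
rewrite (_ : (EFin \o cst 0%R) \_ D = cst 0); last first.
  by apply/funext => x; rewrite patchE; case: ifP.
by rewrite Lnorm0// gt_eqF// (lt_le_trans _ p1).
Qed.

Lemma Lp_norm_sum p D n (f : 'I_n -> T -> R) : 1 <= p -> measurable D ->
  (forall i, measurable_fun D (f i)) ->
  Lp_norm mu p D (fun x => \sum_(i < n) f i x)%R <= \sum_(i < n) Lp_norm mu p D (f i).
Proof.
move=> p1 mD; elim: n f => [|n IH] f mf.
  rewrite big_ord0 (_ : (fun x => _) = cst 0%R) ?Lp_norm0//.
  by apply/funext => x; rewrite big_ord0.
rewrite big_ord_recr /=.
rewrite (_ : (fun x => _) = (fun x => \sum_(i < n) f (widen_ord (leqnSn n) i) x + f ord_max x)%R); last first.
  by apply/funext => x; rewrite big_ord_recr.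
apply: (le_trans (Lp_normD p1 mD _ (mf _))).
  exact: measurable_sum.
by rewrite leeD2r// IH.
Qed.

Lemma Lp_norm_cst_lty p D (c : R) : 1 <= p -> measurable D ->
  (p < +oo -> mu D < +oo) -> Lp_norm mu p D (cst c) < +oo.
Proof.
move=> p1 mD finD; case: p p1 finD => [q||]//; rewrite ?lee_fin => q1 finD.
  rewrite Lp_norm_finE// poweR_lty//.
  rewrite [ltLHS](integral_cst mu mD (`|c| `^ q)%:E).
  by rewrite lte_mul_pinfty// ?lee_fin ?powR_ge0// finD// ltry.
rewrite /Lp_norm unlock; case: ifP => // _.
apply: (@le_lt_trans _ _ `|c|%:E); last exact: ltry.
apply/ess_supP; apply: aeW => x /=; rewrite patchE; case: ifP => _ //=.
by rewrite normr0 lee_fin.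
Qed.

(** Hoelder's inequality against the indicator function of [L], with the
    exponents 1 and [+oo] treated apart. *)
Lemma integral_le_Lp_norm p D L : 1 <= p -> measurable D -> measurable L ->
  L `<=` D -> mu L < +oo ->
  exists2 C : R, (0 < C)%R & forall f, measurable_fun D f ->
    \int[mu]_(x in L) `|f x|%:E <= C%:E * Lp_norm mu p D f.
Proof.
move=> p1 mD mL LD Loo; pose m := fine (mu L).
have m0 : (0 <= m)%R by rewrite fine_ge0.
have mE : mu L = m%:E by rewrite fineK// ge0_fin_numE.
have mfL f : measurable_fun D f -> measurable_fun L (fun x => (`|f x|)%:E).
  by move=> mf; apply/measurable_EFinP; apply: measurableT_comp => //; exact: measurable_funS mf.
case: p p1 => [q||]//; rewrite ?lee_fin => q1; last first.
  exists (m + 1)%R; first lra.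
  move=> f mf; have [mu0|] := boolP (0 < mu setT); last first.
    rewrite -leNgt => mu0.
    have -> : \int[mu]_(x in L) `|f x|%:E = 0.
      apply: null_set_integral => //; first exact: mfL.
      by apply/eqP; rewrite eq_le measure_ge0 andbT (le_trans _ mu0)// le_measure ?inE.
    by rewrite mule_ge0 ?Lp_norm_ge0// lee_fin; lra.
  have s0 := Lp_norm_ge0 +oo D f; set s := Lp_norm _ _ _ _ in s0 *.
  have [->|soo] := eqVneq s +oo; first by rewrite gt0_muley ?leey// lte_fin; lra.
  have sE : s = (fine s)%:E by rewrite fineK// ge0_fin_numE// ltey.
  have s1 : (0 <= fine s)%R by exact: fine_ge0.
  apply: (@le_trans _ _ (\int[mu]_(x in L) (cst (fine s)%:E x))).
    apply: ae_ge0_le_integral => //; first exact: mfL.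
    rewrite -sE /s Lp_norm_yE//.
    apply: filterS (ess_sup_ge mu (abse \o ((EFin \o f) \_ D))) => x + Lx.
    by rewrite /= patchE ifT// inE; exact: LD.
  rewrite integral_cst// mE sE /= -EFinM lee_fin; nra.
have [->|q_neq1] := eqVneq q 1%R.
  exists 1%R => // f mf; rewrite Lp_norm_finE// mul1e invr1 poweRe1; last first.
    by apply: integral_ge0 => x _; rewrite lee_fin powR_ge0.
  under [leRHS]eq_integral do rewrite powRr1//.
  apply: ge0_subset_integral => //.
  by apply/measurable_EFinP; apply: measurableT_comp.
have q_gt1 : (1 < q)%R by rewrite lt_neqAle eq_sym q_neq1.
pose r := (q / (q - 1))%R.
have r0 : (0 < r)%R by rewrite divr_gt0 ?subr_gt0// (lt_trans ltr01).
have qr : (q^-1 + r^-1 = 1)%R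
  by rewrite /r invf_div -[X in (X + _)%R]mul1r -mulrDl addrC subrK divff//;
    rewrite gt_eqF// (lt_trans ltr01).
pose c := 'N[mu]_r%:E[EFin \o \1_L].
have c0 : 0 <= c by exact: Lnorm_ge0.
have coo : c < +oo.
  rewrite /c unlock poweR_lty//.
  rewrite (eq_integral (fun x => (\1_L x)%:E)) ?integral_indic ?setIT// => x _.
  rewrite /= indicE; case: (x \in L); rewrite ?normr1 ?powR1//.
  by rewrite normr0 powR0// gt_eqF.
have cE : c = (fine c)%:E by rewrite fineK// ge0_fin_numE.
exists (fine c + 1)%R; first by have := fine_ge0 c0; lra.
move=> f mf.
have mfD : measurable_fun setT (f \_ D) by exact/(measurable_restrictT _ mD).
apply: (@le_trans _ _ ('N[mu]_1[EFin \o ((f \_ D) \* \1_L)%R])).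
  rewrite Lnorm1 integral_mkcond le_eqVlt; apply/orP; left; apply/eqP.
  apply: eq_integral => x _; rewrite /= !patchE indicE.
  case: ifP => xL; last by rewrite mulr0 normr0.
  by rewrite mulr1 ifT//; exact/mem_set/LD/set_mem.
have q_gt0 : (0 < q)%R by rewrite (lt_trans ltr01).
have mI : measurable_fun setT (\1_L : T -> R) by exact: measurable_indic.
have H := hoelder mu mfD mI q_gt0 r0 qr.
apply: (le_trans H).
rewrite -restrict_EFin -/(Lp_norm mu q%:E D f) -/c muleC.
by apply: lee_pmul => //; [exact: Lp_norm_ge0|rewrite cE lee_fin; lra].
Qed.

End Lp_norm_theory.

Section Lp_norm_bounds.
Context d (T : measurableType d) {R : realType} (mu : {measure set T -> \bar R}).
Implicit Types (p : \bar R) (D : set T) (f g : T -> R).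
Local Open Scope ereal_scope.

Lemma Lp_norm_y_le D f (M : R) : (0 <= M)%R ->
  {ae mu, forall x, D x -> (`|f x| <= M)%R} -> Lp_norm mu +oo D f <= M%:E.
Proof.
move=> M0 fM; rewrite /Lp_norm unlock; case: ifP => _; last by rewrite lee_fin.
apply/ess_supP; apply: filterS fM => x fM /=; rewrite patchE; case: ifP => [/set_mem Dx|_] /=.
  by rewrite lee_fin fM.
by rewrite normr0 lee_fin.
Qed.

Lemma Lp_norm_y_ae D f (M : R) : 0 < mu setT -> Lp_norm mu +oo D f <= M%:E ->
  {ae mu, forall x, D x -> (`|f x| <= M)%R}.
Proof.
move=> mu0; rewrite Lp_norm_yE// => /ess_supP; apply: filterS => x + Dx.
by rewrite /= patchE ifT ?inE// lee_fin.
Qed.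

Lemma Lp_norm_fin_leP (q : R) D f (t : R) : (1 <= q)%R -> (0 <= t)%R ->
  Lp_norm mu q%:E D f <= t%:E <->
  \int[mu]_(x in D) (`|f x| `^ q)%:E <= (t `^ q)%:E.
Proof.
move=> q1 t0; have q0 : (0 < q)%R by rewrite (lt_le_trans ltr01).
have I0 : 0 <= \int[mu]_(x in D) (`|f x| `^ q)%:E.
  by apply: integral_ge0 => x _; rewrite lee_fin powR_ge0.
have ty (r : \bar R) : 0 <= r -> r \in `[0, +oo].
  by move=> r0; rewrite in_itv /= r0 leey.
rewrite Lp_norm_finE//; split => h.
  have := gt0_ler_poweR (ltW q0) _ _ h; rewrite -poweRrM mulVf ?gt_eqF//.
  by rewrite poweRe1// poweR_EFin; apply; rewrite ty ?poweR_ge0 ?lee_fin.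
have qV0 : (0 <= q^-1)%R by rewrite invr_ge0 ltW.
have := gt0_ler_poweR qV0 _ _ h.
rewrite poweR_EFin -powRrM mulfV ?gt_eqF// powRr1//.
by apply; rewrite ty ?lee_fin ?powR_ge0.
Qed.

Lemma Lp_norm_abs p D f : 1 <= p -> measurable D -> measurable_fun D f ->
  Lp_norm mu p D (fun x => `|f x|%R) <= Lp_norm mu p D f.
Proof.
move=> p1 mD mf; apply: Lp_norm_le => //; first exact: measurableT_comp.
by apply: aeW => x _; rewrite normr_id.
Qed.

Lemma eq_Lp_norm p D f g : (forall x, D x -> f x = g x) ->
  Lp_norm mu p D f = Lp_norm mu p D g.
Proof.
move=> fg; rewrite /Lp_norm (_ : (EFin \o f) \_ D = (EFin \o g) \_ D)//.
apply/funext => x; rewrite !patchE; case: ifP => // /set_mem Dx /=.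
by rewrite fg.
Qed.

Section euclidean_norm.
Variable N : nat.
Implicit Type G : T -> 'rV[R]_N.
Local Open Scope ring_scope.

Lemma enorm_ge0 (v : 'rV[R]_N) : 0 <= enorm v.
Proof. exact: sqrtr_ge0. Qed.

Lemma coord_le_enorm (v : 'rV[R]_N) i : `|v ord0 i| <= enorm v.
Proof.
rewrite -sqrtr_sqr ler_sqrt; last by apply: sumr_ge0 => j _; exact: sqr_ge0.
by rewrite (bigD1 i)//= lerDl; apply: sumr_ge0 => j _; exact: sqr_ge0.
Qed.

Lemma sum_sqr_le n (a : 'I_n -> R) : \sum_i a i ^+ 2 <= (\sum_i `|a i|) ^+ 2.
Proof.
elim: n a => [|n IH] a; first by rewrite !big_ord0 expr0n.
rewrite !big_ord_recl /= sqrrD real_normK ?num_real//.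
have := IH (fun j => a (lift ord0 j)).
set A := \sum_(i < n) _; set B := \sum_(i < n) _ => AB.
have : 0 <= `|a ord0| * B by rewrite mulr_ge0// sumr_ge0.
set c := `|a ord0| * B => c0; lra.
Qed.

Lemma enorm_le_sum (v : 'rV[R]_N) : enorm v <= \sum_i `|v ord0 i|.
Proof.
rewrite -[leRHS]ger0_norm ?sumr_ge0// -sqrtr_sqr ler_sqrt ?sqr_ge0//.
exact: sum_sqr_le.
Qed.

Lemma measurable_enorm D G : (forall i, measurable_fun D (fun x => G x ord0 i)) ->
  measurable_fun D (@enorm R N \o G).
Proof.
move=> mG; rewrite /enorm /comp.
apply: (measurableT_comp (f := fun x : R => Num.sqrt x)).
  exact: continuous_measurable_fun (@sqrt_continuous R).
by apply: measurable_sum => i; apply: measurable_funX; exact: mG.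
Qed.

Lemma Lp_norm_coord_le p D G i : (1 <= p)%E -> measurable D ->
  (forall i, measurable_fun D (fun x => G x ord0 i)) ->
  (Lp_norm mu p D (fun x => G x ord0 i) <= Lp_norm mu p D (@enorm R N \o G))%E.
Proof.
move=> p1 mD mG; apply: Lp_norm_le => //; first exact: measurable_enorm.
apply: aeW => x _ /=; rewrite (ger0_norm (enorm_ge0 _)); exact: coord_le_enorm.
Qed.

Lemma Lp_norm_enorm_le p D G : (1 <= p)%E -> measurable D ->
  (forall i, measurable_fun D (fun x => G x ord0 i)) ->
  (Lp_norm mu p D (@enorm R N \o G) <=
   \sum_i Lp_norm mu p D (fun x => G x ord0 i))%E.
Proof.
move=> p1 mD mG.
have mN i : measurable_fun D (fun x => `|G x ord0 i|) by exact: measurableT_comp.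
apply: (@le_trans _ _ (Lp_norm mu p D (fun x => \sum_i `|G x ord0 i|))).
  apply: Lp_norm_le => //; [exact: measurable_enorm|exact: measurable_sum|].
  apply: aeW => x _ /=; rewrite (ger0_norm (enorm_ge0 _)).
  by rewrite ger0_norm ?sumr_ge0//; exact: enorm_le_sum.
apply: (le_trans (Lp_norm_sum _ p1 mD mN)).
by apply: lee_sum => i _; exact: Lp_norm_abs.
Qed.

End euclidean_norm.
End Lp_norm_bounds.

(** * L^p bounds on the nonlocal derivative *)

Section weighted_estimates.
Context {R : realType} {N : nat}.
Local Notation V := 'rV[R]_N.
Local Notation mu := (lebesgue_rV R N).
Local Notation mu2 := (mu \x mu)%E.
Variables (D : set V) (omega : V * V -> R) (p : \bar R).
Hypotheses (p1 : (1 <= p)%E) (oD : open D).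
Hypothesis adm : admissible_weight D omega.
Let mD := open_measurable_rV oD.
Let mDD : measurable (D `*` D) := measurableX mD mD.
Local Open Scope ereal_scope.

Lemma lebesgue_rV_setT_gt0 : 0 < mu setT.
Proof. by apply: open_lebesgue_rV_gt0; [exact: openT|exists 0%R]. Qed.

(** A null set in one of the variables spans a null cylinder. *)
Lemma ae_fst (P : V -> Prop) : {ae mu, forall x, P x} -> {ae mu2, forall z, P z.1}.
Proof.
move=> [A [mA A0 PA]]; exists (A `*` setT); split.
- exact: measurableX.
- by apply: (etrans (product_measure1E mu mu mA measurableT)); rewrite [X in X * _]A0 mul0e.
- by move=> z /= nz; split => //; exact: PA.
Qed.

Lemma ae_snd (P : V -> Prop) : {ae mu, forall x, P x} -> {ae mu2, forall z, P z.2}.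
Proof.
move=> [A [mA A0 PA]]; exists (setT `*` A); split.
- exact: measurableX.
- by apply: (etrans (product_measure1E mu mu measurableT mA)); rewrite [X in _ * X]A0 mule0.
- by move=> z /= nz; split => //; exact: PA.
Qed.

Lemma ae_of_sections (A : set (V * V)) : measurable A ->
  (forall x, mu (xsection A x) = 0) -> {ae mu2, forall z, ~ A z}.
Proof.
move=> mA A0; exists A; split => //.
  rewrite /product_measure1; apply: integral0_eq => x _; exact: A0.
by move=> z /= /contrapT.
Qed.

Lemma ae_sections_of_ae (P : V * V -> Prop) : {ae mu2, forall z, P z} ->
  {ae mu, forall x, {ae mu, forall y, P (x, y)}}.
Proof.
move=> [A [mA A0 PA]].
have mx : measurable_fun setT (fun x => mu (xsection A x)).
  exact: measurable_fun_xsection.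
have : ae_eq mu setT (fun x => mu (xsection A x)) (cst 0).
  apply/ae_eq_integral_abs => //.
  by under eq_integral do rewrite gee0_abs//.
apply: filterS => x /(_ I) /= x0; exists (xsection A x); split => //.
  exact: measurable_xsection.
by move=> y /= nP; rewrite /xsection/= inE; exact: PA.
Qed.

Let momega : measurable_fun (D `*` D) omega.
Proof. exact: measurable_weight. Qed.

Let omega_ge0 z : (D `*` D) z -> (0 <= omega z)%R.
Proof. by case: z => x y [/= Dx Dy]; case: adm => h _ _; exact: h. Qed.

(** The bound holds for every [x] and almost every [y]; by Tonelli the set of
    pairs that violate it is null. *)
Lemma weight_bounded_ae (K : R) : p = +oo ->
  (forall x, D x -> weight_fun p D omega x <= K%:E) ->
  {ae mu2, forall z, (D `*` D) z -> (omega z <= K)%R}.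
Proof.
move=> py wK.
pose A := (D `*` D) `&` omega @^-1` `]K, +oo[%classic.
have mA : measurable A by exact: momega.
have : {ae mu2, forall z, ~ A z}.
  apply: ae_of_sections => // x; have [Dx|nDx] := pselect (D x); last first.
    rewrite (_ : xsection A x = set0) ?measure0//.
    by apply/seteqP; split => y //; rewrite /xsection/= inE => -[[]].
  have := wK x Dx; rewrite /weight_fun py => /ess_supP [B [mB B0 AB]].
  apply/eqP; rewrite eq_le measure_ge0 andbT -B0 le_measure ?inE//.
    exact: measurable_xsection.
  move=> y; rewrite /xsection/= inE => -[[/= _ Dy]]; rewrite /= in_itv/= andbT => Ky.
  by apply: AB => /=; rewrite patchE ifT ?inE// lee_fin leNgt Ky.
apply: filterS => z nA Dz; rewrite leNgt; apply/negP => Kz; apply: nA.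
by split => //=; rewrite in_itv/= andbT.
Qed.

Lemma measurable_fun_section1 (f : V * V -> R) x : measurable_fun (D `*` D) f ->
  D x -> measurable_fun D (fun y => f (x, y)).
Proof.
move=> mf Dx; apply: (measurable_comp (F := D `*` D)) => //.
  by move=> _ [y Dy <-].
exact: measurable_funTS (pair1_measurable x).
Qed.

Let weight_section (K : R) (q : R) x (c : R) : (1 <= q)%R -> p = q%:E ->
  (forall x, D x -> weight_fun p D omega x <= K%:E) -> D x ->
  \int[mu]_(y in D) (`|omega (x, y) * c| `^ q)%:E <= K%:E * (`|c| `^ q)%:E.
Proof.
move=> q1 pq wK Dx; rewrite muleC.
apply: (@le_trans _ _ ((`|c| `^ q)%:E * weight_fun p D omega x)); last first.
  by apply: lee_wpmul2l; [rewrite lee_fin powR_ge0|exact: wK].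
rewrite pq /weight_fun -ge0_integralZl//; last 2 first.
- apply/measurable_EFinP; apply: (measurableT_comp (measurable_powR q)).
  exact: measurable_fun_section1 momega Dx.
- by move=> y _; rewrite lee_fin powR_ge0.
rewrite le_eqVlt; apply/orP; left; apply/eqP; apply: eq_integral => y /set_mem Dy.
have w0 := omega_ge0 (conj Dx Dy : (D `*` D) (x, y)).
by rewrite normrM powRM// (ger0_norm w0) mulrC EFinM.
Qed.

(** Here [h] is one of the two projections, and the hypothesis on integrals is
    what Tonelli gives when the weight is integrated first.  At [p = +oo], where
    [fine p] is 0, the constant is still at least [K]. *)
Let weighted_gen (K : R) (h : V * V -> V) (g : V -> R) : (0 < K)%R ->
  measurable_fun (D `*` D) (g \o h) -> measurable_fun D g ->
  (forall P : V -> Prop, {ae mu, forall x, P x} -> {ae mu2, forall z, P (h z)}) ->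
  (forall q : R, p = q%:E ->
    \int[mu2]_(z in D `*` D) (`|omega z * g (h z)| `^ q)%:E <=
    K%:E * \int[mu]_(x in D) (`|g x| `^ q)%:E) ->
  (forall z, (D `*` D) z -> D (h z)) ->
  (forall x, D x -> weight_fun p D omega x <= K%:E) ->
  Lp_norm mu2 p (D `*` D) (fun z => omega z * g (h z))%R <=
    (Num.max K (K `^ (fine p)^-1))%:E * Lp_norm mu p D g.
Proof.
move=> K0 mgh mg aeh hq hD wK; set C := Num.max _ _.
have KC : (K <= C)%R by rewrite le_max lexx.
have C0 : (0 < C)%R by rewrite (lt_le_trans K0).
have s0 := Lp_norm_ge0 mu p D g; set s := Lp_norm _ _ _ _ in s0 *.
have [->|soo] := eqVneq s +oo; first by rewrite gt0_muley ?leey// lte_fin.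
have sE : s = (fine s)%:E by rewrite fineK// ge0_fin_numE// ltey.
have fs0 : (0 <= fine s)%R by exact: fine_ge0.
have := p1; case pE : p => [q||]//; rewrite ?lee_fin => q1; last first.
  rewrite sE -EFinM; apply: Lp_norm_y_le; first by rewrite mulr_ge0// ltW.
  have gs : Lp_norm mu +oo D g <= (fine s)%:E by rewrite -sE /s pE.
  have wK' := weight_bounded_ae pE wK.
  have h2 := aeh _ (Lp_norm_y_ae lebesgue_rV_setT_gt0 gs).
  apply: filterS2 wK' h2 => z hz1 hz2 Dz.
  rewrite normrM; apply: ler_pM => //; last exact/hz2/hD.
  by rewrite ger0_norm ?omega_ge0//; apply: le_trans KC; exact: hz1.
have q0 : (0 < q)%R by rewrite (lt_le_trans ltr01).
apply: (@le_trans _ _ ((K `^ q^-1)%:E * s)); last first.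
  by rewrite lee_wpmul2r// lee_fin /C pE le_max lexx orbT.
rewrite sE -EFinM; apply/Lp_norm_fin_leP => //.
  by rewrite mulr_ge0// powR_ge0.
apply: (le_trans (hq q pE)).
rewrite powRM ?powR_ge0// -powRrM mulVf ?gt_eqF// powRr1 ?(ltW K0)// EFinM.
apply: lee_wpmul2l; first by rewrite lee_fin ltW.
by apply/(Lp_norm_fin_leP _ _ _ q1 fs0); rewrite -sE /s pE.
Qed.

(** The term in [g x] and the term in [g y] are estimated separately, the
    weight being integrated in [y] and in [x] respectively; its symmetry makes
    both integrals values of the weight function. *)
Lemma Lp_nl_diff_le (K : R) : (0 < K)%R ->
  (forall x, D x -> weight_fun p D omega x <= K%:E) ->
  exists2 C : R, (0 < C)%R & forall g, measurable_fun D g ->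
    Lp_norm mu2 p (D `*` D) (nl_diff omega g) <= C%:E * Lp_norm mu p D g.
Proof.
move=> K0 wK; pose C := Num.max K (K `^ (fine p)^-1)%R.
have C0 : (0 < C)%R by rewrite (lt_le_trans K0)// le_max lexx.
exists (C + C)%R; first exact: addr_gt0.
move=> g mg.
have m1 : measurable_fun (D `*` D) (fun z : V * V => g z.1) by exact: measurable_fun_fst.
have m2 : measurable_fun (D `*` D) (fun z : V * V => g z.2) by exact: measurable_fun_snd.
have b1 : Lp_norm mu2 p (D `*` D) (fun z => omega z * g z.1)%R <= C%:E * Lp_norm mu p D g.
  apply: (@weighted_gen K fst) => //; [exact: ae_fst| |by move=> z []].
  move=> q pq; have q1 : (1 <= q)%R by have := p1; rewrite pq.
  have mw : measurable_fun (D `*` D) (fun z => (`|omega z * g z.1| `^ q)%:E).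
    by apply: measurable_fun_powR; exact: measurable_funM.
  rewrite ge0_integral_prod12// -ge0_integralZl//; last 2 first.
  - exact: measurable_fun_powR.
  - by rewrite lee_fin ltW.
  apply: ge0_le_integral => //.
  - by move=> x _; apply: integral_ge0 => y _; rewrite lee_fin powR_ge0.
  - exact: (measurable_fun_integral12 mu mD mD mw).
  - by apply: measurable_funeM; exact: measurable_fun_powR.
  - by move=> x Dx; exact: (@weight_section K q x (g x) q1 pq wK Dx).
have b2 : Lp_norm mu2 p (D `*` D) (fun z => omega z * g z.2)%R <= C%:E * Lp_norm mu p D g.
  apply: (@weighted_gen K snd) => //; [exact: ae_snd| |by move=> z []].
  move=> q pq; have q1 : (1 <= q)%R by have := p1; rewrite pq.
  rewrite (eq_integral (fun z => (`|omega (z.2, z.1) * g z.2| `^ q)%:E)); last first.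
    by move=> z /set_mem Dz; rewrite (admissible_sym adm Dz).
  have mw : measurable_fun (D `*` D) (fun z => (`|omega z * g z.1| `^ q)%:E).
    by apply: measurable_fun_powR; exact: measurable_funM.
  have mws : measurable_fun (D `*` D) (fun z => (`|omega (z.2, z.1) * g z.2| `^ q)%:E).
    apply: (eq_measurable_fun (fun z => (`|omega z * g z.2| `^ q)%:E)).
      by move=> z /set_mem Dz; rewrite (admissible_sym adm Dz).
    by apply: measurable_fun_powR; exact: measurable_funM.
  rewrite ge0_integral_prod21// -ge0_integralZl//; last 2 first.
  - exact: measurable_fun_powR.
  - by rewrite lee_fin ltW.
  apply: ge0_le_integral => //.
  - by move=> x _; apply: integral_ge0 => y _; rewrite lee_fin powR_ge0.
  - exact: (measurable_fun_integral12 mu mD mD mw).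
  - by apply: measurable_funeM; exact: measurable_fun_powR.
  - by move=> x Dx; exact: (@weight_section K q x (g x) q1 pq wK Dx).
rewrite (@eq_Lp_norm _ _ _ _ _ _ _ (fun z => omega z * g z.2 + (-1) * (omega z * g z.1))%R); last first.
  by move=> z _; rewrite /nl_diff; ring.
rewrite EFinD ge0_muleDl ?lee_fin ?(ltW C0)//.
apply: (le_trans (Lp_normD _ p1 mDD _ _)); [exact: measurable_funM|by apply: measurable_funM => //; exact: measurable_funM|].
apply: leeD => //; apply: le_trans b1.
apply: (le_trans (Lp_normZ _ _ p1 mDD _)); first exact: measurable_funM.
by rewrite normrN normr1 mul1e.
Qed.

End weighted_estimates.

(** * From the nonlocal to the classical Sobolev space *)

Section Lp_norm_pairing.
Context d (T : measurableType d) {R : realType} (mu : {measure set T -> \bar R}).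
Local Open Scope ereal_scope.

Lemma Rintegral_mul_le_Lp_norm (p : \bar R) (D L : set T) (M : R) : 1 <= p ->
  measurable D -> measurable L -> L `<=` D -> mu L < +oo -> (0 < M)%R ->
  exists2 C : R, (0 < C)%R & forall u phi : T -> R,
    measurable_fun D u -> measurable_fun D phi ->
    (forall x, L x -> (`|phi x| <= M)%R) ->
    (forall x, D x -> ~ L x -> phi x = 0%R) ->
    (`|\int[mu]_(x in D) (u x * phi x)|%R)%:E <= C%:E * Lp_norm mu p D u.
Proof.
move=> p1 mD mL LD Loo M0.
have [C C0 hC] := integral_le_Lp_norm p1 mD mL LD Loo.
exists (M * C)%R; first exact: mulr_gt0.
move=> u phi mu_ mphi phiM phi0.
have mup : measurable_fun D (fun x => (u x * phi x)%:E).
  by apply/measurable_EFinP; exact: measurable_funM.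
have mau : measurable_fun L (fun x => (`|u x|)%:E).
  by apply/measurable_EFinP; apply: measurableT_comp => //; exact: measurable_funS mu_.
have abse_fine_le (t : \bar R) : (`|fine t|)%:E <= `|t|.
  by case: t => [r||] //=; rewrite ?normr0 ?leey.
apply: (le_trans (abse_fine_le _)); apply: (le_trans (le_abse_integral mu mD mup)).
apply: (@le_trans _ _ (\int[mu]_(x in L) (M%:E * (`|u x|)%:E))); last first.
  rewrite ge0_integralZl//; last by rewrite lee_fin ltW.
  rewrite EFinM -muleA; apply: lee_wpmul2l; first by rewrite lee_fin ltW.
  exact: hC.
rewrite integral_mkcond [leRHS]integral_mkcond; apply: ge0_le_integral => //.
- by move=> x _; rewrite patchE; case: ifP.
- by apply/(measurable_restrictT _ mD); exact: measurableT_comp.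
- by apply/(measurable_restrictT _ mL); exact: measurable_funeM.
move=> x _; rewrite !patchE; case: ifPn => [/set_mem Dx|_]; last first.
  by case: ifP => // _; rewrite -EFinM lee_fin mulr_ge0// ltW.
case: ifPn => [/set_mem Lx|/negP nLx].
  by rewrite -EFinM lee_fin normrM mulrC ler_wpM2r// phiM.
by rewrite lee_fin phi0 ?mulr0 ?normr0// => /mem_set.
Qed.

End Lp_norm_pairing.

Section embedding_into_sobolev.
Context {R : realType} {N : nat}.
Local Notation V := 'rV[R]_N.
Local Notation mu := (lebesgue_rV R N).
Local Notation mu2 := (mu \x mu)%E.
Variables (D : set V) (omega : V * V -> R) (p : \bar R) (k : R).
Hypotheses (p1 : (1 <= p)%E) (D0 : D !=set0) (oD : open D).
Hypothesis adm : admissible_weight D omega.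
Hypotheses (k0 : 0 < k) (k_le : forall z, (D `*` D) z -> k <= omega z).
Let mD := open_measurable_rV oD.
Let mDD : measurable (D `*` D) := measurableX mD mD.
Local Open Scope ereal_scope.

Lemma setT2_gt0 : 0 < mu2 setT.
Proof.
have -> : mu2 setT = mu setT * mu setT by rewrite -setXTT; exact: product_measure1E.
by rewrite mule_gt0// lebesgue_rV_setT_gt0.
Qed.

Lemma exists_unit_bump : exists2 eta : V -> R, C1c D eta &
  (\int[mu]_(x in D) eta x = 1)%R.
Proof.
have [a Da] := D0.
have /nbhs_ballP[e /= e0 aeD] : nbhs a D by exact: open_nbhs_nbhs.
have r0 : (0 < e / 2)%R by rewrite divr_gt0.
have Cb : C1c D (bump a (e / 2)).
  by apply: C1c_bump => //; rewrite mulrC divfK.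
pose I := (\int[mu]_(x in D) bump a (e / 2) x)%R.
have ib : mu.-integrable D (EFin \o bump a (e / 2)).
  have := L1loc_C1c_integrable oD (L1loc_cst D 1) Cb.
  by apply: eq_integrable => // x _ /=; rewrite mul1r.
have I0 : (0 < I)%R.
  rewrite lt0r; apply/andP; split; last by apply: Rintegral_ge0 => x _; exact: bump_ge0.
  apply/eqP => I00.
  have bD : ball a (e / 2) `<=` D.
    by apply: subset_trans aeD; apply: le_ball; lra.
  have : \int[mu]_(x in D) `|(bump a (e / 2) x)%:E| = 0.
    under eq_integral do rewrite /= ger0_norm ?bump_ge0//.
    by rewrite -(fineK (integrable_fin_num mD ib)) -[fine _]/I I00.
  move=> /(ae_eq_integral_abs mu mD (measurable_int _ ib)) [A [mA A0 hA]].
  have : mu (ball a (e / 2)) <= mu A.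
    apply: le_measure; rewrite ?inE//; first exact: measurable_rV_ball.
    move=> x bx; apply: hA => /= /(_ (bD _ bx)) [] h.
    by have := (bump_gt0P a x r0).2 bx; rewrite h ltxx.
  by rewrite [leRHS]A0 lebesgue_rV_ball// lee_fin leNgt exprn_gt0// pmulrn_lgt0.
exists (fun x => I^-1 * bump a (e / 2) x)%R; last by rewrite RintegralZl// mulVf// gt_eqF.
rewrite (_ : (fun x => _) = bump a (e / 2) \* cst I^-1)%R; last first.
  by apply/funext => x /=; rewrite mulrC.
exact: C1cM oD Cb (C1_on_cst _ oD).
Qed.

Section unit_bump.
Variable eta : V -> R.
Hypotheses (Ceta : C1c D eta) (eta1 : (\int[mu]_(x in D) eta x = 1)%R).

(** For every [x] the average is a pairing of [g (x, _)] with a kernel that is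
    bounded and supported in a compact set, uniformly in [x]; Hoelder's
    inequality in [y] is then integrated in [x]. *)
Lemma Lp_nl_average_le : exists2 C : R, (0 < C)%R & forall g,
  measurable_fun (D `*` D) g -> measurable_fun D (nl_average D omega eta g) ->
  Lp_norm mu p D (nl_average D omega eta g) <= C%:E * Lp_norm mu2 p (D `*` D) g.
Proof.
have [L [cL LD eta0 _]] := C1c_supp Ceta.
have mL := compact_measurable_rV cL.
have [M M0 hM] := nl_kernel_bounded oD k0 k_le Ceta.
have [B B0 hB] := Rintegral_mul_le_Lp_norm p1 mD mL LD (compact_lebesgue_rV_lty cL) M0.
exists B => // g mg mav.
have oDD := openX oD oD.
have mker : measurable_fun (D `*` D) (nl_kernel omega eta).
  have [_ _ Cw] := adm; have [Ce _ _] := Ceta.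
  apply: measurable_funM.
    by apply: measurable_fun_snd => //; exact: open_continuous_measurable_rV oD (C1_on_continuous oD Ce).
  apply: (open_continuous_measurable_rV2 oDD (C1_on_continuous oDD _)).
  by apply: C1_onV => // z Dz; rewrite gt_eqF// (lt_le_trans k0)// k_le.
have key x : D x -> (`|nl_average D omega eta g x|)%:E <=
    B%:E * Lp_norm mu p D (fun y => g (x, y)).
  move=> Dx; apply: hB.
  - exact: (measurable_fun_section1 oD mg Dx).
  - exact: (measurable_fun_section1 oD mker Dx).
  - by move=> y /LD Dy; exact: hM.
  - by move=> y Dy nLy; rewrite /nl_kernel eta0 ?mul0r.
have s0 := Lp_norm_ge0 mu2 p (D `*` D) g.
have := p1; case pE : p => [q||]//; rewrite ?lee_fin => q1; last first.
  set s := Lp_norm mu2 _ _ _; have {}s0 : 0 <= s by move: s0; rewrite pE.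
  have [->|soo] := eqVneq s +oo; first by rewrite gt0_muley ?leey// lte_fin.
  have sE : s = (fine s)%:E by rewrite fineK// ge0_fin_numE// ltey.
  have fs0 : (0 <= fine s)%R by exact: fine_ge0.
  have gs : Lp_norm mu2 +oo (D `*` D) g <= (fine s)%:E by rewrite -sE.
  rewrite sE -EFinM; apply: Lp_norm_y_le; first by rewrite mulr_ge0// ltW.
  apply: filterS (ae_sections_of_ae (Lp_norm_y_ae setT2_gt0 gs)) => x gx Dx.
  rewrite -lee_fin; apply: (le_trans (key x Dx)); rewrite pE (EFinM B).
  apply: lee_wpmul2l; first by rewrite lee_fin ltW.
  by apply: Lp_norm_y_le => //; apply: filterS gx => y + Dy; apply.
have q0 : (0 < q)%R by rewrite (lt_le_trans ltr01).
set s := Lp_norm mu2 _ _ _; have {}s0 : 0 <= s by move: s0; rewrite pE.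
have [->|soo] := eqVneq s +oo; first by rewrite gt0_muley ?leey// lte_fin.
have sE : s = (fine s)%:E by rewrite fineK// ge0_fin_numE// ltey.
have fs0 : (0 <= fine s)%R by exact: fine_ge0.
rewrite sE -EFinM; apply/Lp_norm_fin_leP => //; first by rewrite mulr_ge0// ltW.
have mgq := measurable_fun_powR q mg.
apply: (@le_trans _ _ ((B `^ q)%:E * \int[mu2]_(z in D `*` D) (`|g z| `^ q)%:E)); last first.
  rewrite (powRM q (ltW B0) fs0) EFinM; apply: lee_wpmul2l; first by rewrite lee_fin powR_ge0.
  by apply/(Lp_norm_fin_leP _ _ _ q1 fs0); rewrite -sE.
rewrite ge0_integral_prod12// -ge0_integralZl//; last 3 first.
- exact: (measurable_fun_integral12 mu mD mD mgq).
- by move=> x _; apply: integral_ge0 => y _; rewrite lee_fin powR_ge0.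
- by rewrite lee_fin powR_ge0.
apply: ge0_le_integral => //.
- exact: measurable_fun_powR.
- apply: measurable_funeM; exact: (measurable_fun_integral12 mu mD mD mgq).
move=> x Dx; have := key x Dx; rewrite pE Lp_norm_finE//.
set I := \int[mu]_(y in D) _ => h.
have I0 : 0 <= I by apply: integral_ge0 => y _; rewrite lee_fin powR_ge0.
have ty (r : \bar R) : 0 <= r -> r \in `[0, +oo] by move=> r0; rewrite in_itv /= r0 leey.
have := gt0_ler_poweR (ltW q0) _ _ h; rewrite poweRM ?poweR_ge0 ?lee_fin ?(ltW B0)//.
rewrite -poweRrM mulVf ?gt_eqF// poweRe1// !poweR_EFin; apply.
  by rewrite ty.
by rewrite ty// mule_ge0 ?poweR_ge0// lee_fin ltW.
Qed.

Lemma derive_pairing_le (i : 'I_N) : exists2 C : R, (0 < C)%R &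
  forall u : V -> R, measurable_fun D u ->
    (`|\int[mu]_(x in D) (u x * 'D_(ebase i) eta x)|%R)%:E <= C%:E * Lp_norm mu p D u.
Proof.
have [L [cL LD _ deta0]] := C1c_supp Ceta.
have mL := compact_measurable_rV cL.
have [M M0 hM] := C1c_derive_bounded (ebase i) Ceta.
have [C C0 hC] := Rintegral_mul_le_Lp_norm p1 mD mL LD (compact_lebesgue_rV_lty cL) M0.
exists C => // u mu_; apply: hC => //; last by move=> x _; exact: deta0.
by case: Ceta => -[_ cd] _ _; exact: open_continuous_measurable_rV.
Qed.

Hypothesis finD : p < +oo -> mu D < +oo.

(** The integral of [u * D_i eta] is a constant function of [x], and the measure
    of [D] enters through its L^p norm. *)
Lemma Lp_local_derivative_le (i : 'I_N) : exists2 C : R, (0 < C)%R &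
  forall u g, L1loc D u -> L1loc2 D g ->
    Lp_norm mu p D (local_derivative D omega eta i u g) <=
    C%:E * (Lp_norm mu p D u + Lp_norm mu2 p (D `*` D) g).
Proof.
have [C1 C10 hC1] := Lp_nl_average_le.
have [C2 C20 hC2] := derive_pairing_le i.
have S0 := Lp_norm_ge0 mu p D (cst 1%R).
have Soo := Lp_norm_cst_lty 1 p1 mD finD.
set S := Lp_norm _ _ _ _ in S0 Soo.
have SE : S = (fine S)%:E by rewrite fineK// ge0_fin_numE.
have fS0 : (0 <= fine S)%R by exact: fine_ge0.
have C2S0 : (0 <= C2 * fine S)%R by rewrite mulr_ge0// ltW.
exists (C2 * fine S + C1)%R; first by rewrite ltr_wpDl.
move=> u g Lu Lg; have [mu_ _] := Lu; have [mg _] := Lg.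
have mav := measurable_nl_average oD adm k0 k_le Ceta Lg.
set c := (\int[mu]_(x in D) (u x * 'D_(ebase i) eta x))%R.
rewrite (@eq_Lp_norm _ _ _ _ _ _ _ (fun x => - c * cst 1 x +
    (-1) * nl_average D omega eta g x)%R); last first.
  by move=> x _; rewrite /local_derivative -/c /=; ring.
apply: (le_trans (Lp_normD _ p1 mD _ _)); [by apply: measurable_funM|by apply: measurable_funM|].
have A0 := Lp_norm_ge0 mu p D u; have B0 := Lp_norm_ge0 mu2 p (D `*` D) g.
set A := Lp_norm mu p D u in A0 *; set B := Lp_norm mu2 _ _ _ in B0 *.
apply: (@le_trans _ _ ((C2 * fine S)%:E * A + C1%:E * B)).
  apply: leeD.
    apply: (le_trans (Lp_normZ _ _ p1 mD _)); first exact: measurable_cst.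
    rewrite -/S SE normrN EFinM -muleA [(fine S)%:E * A]muleC muleA.
    by apply: lee_wpmul2r; [rewrite lee_fin|exact: hC2].
  apply: (le_trans (Lp_normZ _ _ p1 mD mav)).
  by rewrite normrN normr1 mul1e; exact: hC1.
rewrite EFinD ge0_muleDl ?lee_fin ?(ltW C10)//.
apply: leeD; apply: lee_wpmul2l; rewrite ?lee_fin ?(ltW C10)//.
  by rewrite leeDl.
by rewrite leeDr.
Qed.

End unit_bump.

Lemma nl_sobolev_embeds_sobolev : (p < +oo -> mu D < +oo) ->
  embeds (nl_sobolev p D omega) (nl_sobolev_norm p D omega)
    (sobolev p D) (sobolev_norm p D).
Proof.
move=> finD; have [eta Ceta eta1] := exists_unit_bump.
have /choice[C hC] : forall i : 'I_N, exists C : R, (0 < C)%R /\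
    forall u g, L1loc D u -> L1loc2 D g ->
    Lp_norm mu p D (local_derivative D omega eta i u g) <=
    C%:E * (Lp_norm mu p D u + Lp_norm mu2 p (D `*` D) g).
  by move=> i; have [C C0 hC] := Lp_local_derivative_le Ceta finD i; exists C.
pose K := (\sum_i C i)%R.
have K0 : (0 <= K)%R by apply: sumr_ge0 => i _; have [/ltW] := hC i.
have main u : nl_sobolev p D omega u ->
    (forall i, exists g, weak_partial D i u g) /\
    (forall i, measurable_fun D (fun x => weak_grad D u x ord0 i)) /\
    Lp_norm mu p D (@enorm R N \o weak_grad D u) <= K%:E * nl_sobolev_norm p D omega u.
  move=> [[mu_ uoo] ex [mG Goo]].
  have nlw i := nl_gradP (ex i).
  have lw i := nl_weak_partial_local oD adm k0 k_le Ceta eta1 (nlw i).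
  have exw i : exists g, weak_partial D i u g by exists (local_derivative D omega eta i u
    (fun z => nl_grad D omega u z ord0 i)).
  have ww i := weak_gradP (exw i).
  have mw i : measurable_fun D (fun x => weak_grad D u x ord0 i) by have [_ []] := ww i.
  have mn i : measurable_fun (D `*` D) (fun z => nl_grad D omega u z ord0 i).
    by have [_ []] := nlw i.
  split => //; split => //.
  apply: (le_trans (Lp_norm_enorm_le mu p1 mD mw)).
  rewrite /K -sumEFin ge0_sume_distrl; last by move=> i _; have [/ltW] := hC i.
  apply: lee_sum => i _; have [Ci0 hCi] := hC i.
  apply: (@le_trans _ _ (Lp_norm mu p D (local_derivative D omega eta i u
      (fun z => nl_grad D omega u z ord0 i)))).
    apply: Lp_norm_le => //; first by have [_ []] := lw i.
    by apply: filterS (weak_partial_unique oD (ww i) (lw i)) => x h Dx; rewrite h.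
  apply: (le_trans (hCi u _ _ _)); [by have [] := nlw i|by have [_ ] := nlw i|].
  apply: lee_wpmul2l; first by rewrite lee_fin ltW.
  apply: leeD => //; exact: (Lp_norm_coord_le mu2 i p1 mDD mn).
split.
  move=> u Xu; have [ex [mw le]] := main u Xu; have [uLp _ GLp] := Xu.
  split => //; split; first exact: measurable_enorm.
  apply: (le_lt_trans le); rewrite lte_mul_pinfty ?lee_fin//.
  by rewrite /nl_sobolev_norm lte_add_pinfty//; [case: uLp|case: GLp].
exists (1 + K)%R; first by rewrite ltr_pwDl.
move=> u Xu; have [_ [_ le]] := main u Xu.
rewrite /sobolev_norm EFinD ge0_muleDl ?lee_fin// mul1e.
apply: leeD => //; rewrite /nl_sobolev_norm leeDl//; exact: Lp_norm_ge0.
Qed.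

End embedding_into_sobolev.

(** * From the classical to the nonlocal Sobolev space *)

Section embedding_into_nl_sobolev.
Context {R : realType} {N : nat}.
Local Notation V := 'rV[R]_N.
Local Notation mu := (lebesgue_rV R N).
Local Notation mu2 := (mu \x mu)%E.
Variables (D : set V) (omega : V * V -> R) (p : \bar R).
Hypotheses (p1 : (1 <= p)%E) (oD : open D).
Hypothesis adm : admissible_weight D omega.
Let mD := open_measurable_rV oD.
Let mDD : measurable (D `*` D) := measurableX mD mD.
Local Open Scope ereal_scope.

Lemma sobolev_embeds_nl_sobolev (K : R) : (0 < K)%R ->
  (forall x, D x -> weight_fun p D omega x <= K%:E) ->
  embeds (sobolev p D) (sobolev_norm p D)
    (nl_sobolev p D omega) (nl_sobolev_norm p D omega).
Proof.
move=> K0 wK; have [C C0 hC] := Lp_nl_diff_le p1 oD adm K0 wK.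
pose M := (\sum_(i < N) C)%R.
have M0 : (0 <= M)%R by apply: sumr_ge0 => i _; exact: ltW.
have main u : sobolev p D u ->
    (forall i, exists g, nl_weak_partial D omega i u g) /\
    (forall i, measurable_fun (D `*` D) (fun z => nl_grad D omega u z ord0 i)) /\
    Lp_norm mu2 p (D `*` D) (@enorm R N \o nl_grad D omega u) <=
      M%:E * Lp_norm mu p D (@enorm R N \o weak_grad D u).
  move=> [[mu_ uoo] ex [mG Goo]].
  have ww i := weak_gradP (ex i).
  have nw i := weak_partial_nl oD adm (ww i).
  have exn i : exists g, nl_weak_partial D omega i u g.
    by exists (nl_diff omega (fun x => weak_grad D u x ord0 i)).
  have nn i := nl_gradP (exn i).
  have mw i : measurable_fun D (fun x => weak_grad D u x ord0 i) by have [_ []] := ww i.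
  have mn i : measurable_fun (D `*` D) (fun z => nl_grad D omega u z ord0 i).
    by have [_ []] := nn i.
  split => //; split => //.
  apply: (le_trans (Lp_norm_enorm_le mu2 p1 mDD mn)).
  rewrite /M -sumEFin ge0_sume_distrl; last by move=> i _; exact: ltW.
  apply: lee_sum => i _.
  apply: (@le_trans _ _ (Lp_norm mu2 p (D `*` D) (nl_diff omega (fun x => weak_grad D u x ord0 i)))).
    apply: Lp_norm_le => //; first by have [_ []] := nw i.
    by apply: filterS (nl_weak_partial_unique oD (nn i) (nw i)) => z h Dz; rewrite h.
  apply: (le_trans (hC _ (mw i))).
  apply: lee_wpmul2l; first by rewrite lee_fin ltW.
  exact: (Lp_norm_coord_le mu i p1 mD mw).
split.
  move=> u Xu; have [ex [mn le]] := main u Xu; have [uLp _ GLp] := Xu.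
  split => //; split; first exact: measurable_enorm.
  apply: (le_lt_trans le); rewrite lte_mul_pinfty ?lee_fin//.
  by case: GLp.
exists (1 + M)%R; first by rewrite ltr_pwDl.
move=> u Xu; have [_ [_ le]] := main u Xu.
rewrite /sobolev_norm /nl_sobolev_norm.
have A0 := Lp_norm_ge0 mu p D u.
have B0 := Lp_norm_ge0 mu p D (@enorm R N \o weak_grad D u).
rewrite EFinD ge0_muleDl ?lee_fin// mul1e.
apply: leeD; first by rewrite leeDl.
apply: (le_trans le); apply: lee_wpmul2l; first by rewrite lee_fin.
by rewrite leeDr.
Qed.

End embedding_into_nl_sobolev.

(** * Necessity of the bound on the weight *)

Section Lp_norm_support.
Context d (T : measurableType d) {R : realType} (mu : {measure set T -> \bar R}).
Local Open Scope ereal_scope.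

Lemma Lp_norm_le_supp (p : \bar R) (D B : set T) (f : T -> R) (M : R) : 1 <= p ->
  measurable D -> measurable B -> B `<=` D -> (0 <= M)%R -> measurable_fun D f ->
  (forall x, B x -> (`|f x| <= M)%R) -> (forall x, D x -> ~ B x -> f x = 0%R) ->
  Lp_norm mu p D f <= M%:E * Lp_norm mu p B (cst 1%R).
Proof.
move=> p1 mD mB BD M0 mf fM f0.
have -> : Lp_norm mu p B (cst 1%R) = Lp_norm mu p D (\1_B : T -> R).
  rewrite /Lp_norm (_ : (EFin \o _) \_ B = (EFin \o (\1_B : T -> R)) \_ D)//.
  apply/funext => x; rewrite !patchE /= indicE.
  case: ifPn => [/set_mem Bx|nB]; first by rewrite ifT// inE; exact: BD.
  by case: ifP => //; rewrite (negbTE nB).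
have m1 : measurable_fun D (\1_B : T -> R) by exact: measurable_indic.
have mM : measurable_fun D (fun x => M * (\1_B : T -> R) x)%R by exact: measurable_funM.
apply: (@le_trans _ _ (Lp_norm mu p D (fun x => M * (\1_B : T -> R) x)%R)).
  apply: Lp_norm_le => //; apply: aeW => x Dx.
  rewrite indicE; have [Bx|nBx] := pselect (B x).
    by rewrite mem_set// mulr1 (ger0_norm M0) fM.
  by rewrite f0// normr0.
by apply: (le_trans (Lp_normZ mu M p1 mD m1)); rewrite ger0_norm.
Qed.

End Lp_norm_support.

Section bump_energy.
Context {R : realType} {N : nat}.
Local Notation V := 'rV[R]_N.
Local Notation mu := (lebesgue_rV R N).
Local Notation mu2 := (mu \x mu)%E.
Variables (D : set V) (omega : V * V -> R) (p : \bar R).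
Hypotheses (p1 : (1 <= p)%E) (oD : open D).
Hypothesis adm : admissible_weight D omega.
Let mD := open_measurable_rV oD.
Let mDD : measurable (D `*` D) := measurableX mD mD.
Local Open Scope ereal_scope.

Lemma derive_bump_out (a : V) (r : R) (i : 'I_N) (x : V) : (0 < r)%R ->
  ~ ball a (2 * r) x -> ('D_(ebase i) (bump a r) x = 0)%R.
Proof.
move=> r0 nx; apply: (@derive_out_closed _ _ (closed_ball a r)).
- exact: closed_ball_closed.
- move=> y ny; apply: bump_out => // yb; apply: ny; exact: subset_closed_ball yb.
- move=> xb; apply: nx; move: xb; rewrite closed_ballE// /closed_ball_ /= => xb.
  by rewrite -ball_normE /=; apply: (le_lt_trans xb); rewrite ltr_pMl// ltr1n.
Qed.

(** The norm of the gradient dominates: as [r <= 1], the bound 1 on the bump is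
    at most [1 / r]. *)
Lemma bump_sobolev_norm_le (a : V) (r : R) : (0 < r)%R -> (r <= 1)%R ->
  ball a (2 * r) `<=` D ->
  sobolev p D (bump a r) /\
  sobolev_norm p D (bump a r) <=
    ((1 + 4 * N%:R) / r)%:E * Lp_norm mu p (ball a (2 * r)) (cst 1%R).
Proof.
move=> r0 r1 BD; set B := ball a (2 * r); set S := Lp_norm mu p B _.
have r20 : (0 < 2 * r)%R by rewrite mulr_gt0.
have mB : measurable B by exact: measurable_rV_ball.
have S0 : 0 <= S by exact: Lp_norm_ge0.
have Soo : S < +oo.
  by apply: Lp_norm_cst_lty => // _; rewrite [ltLHS]lebesgue_rV_ball// ltry.
have CD : C1_on D (bump a r) by apply: C1_on_subset (C1_on_bump a r).
have wp i := C1_on_weak_partial i oD CD.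
have ex i : exists g, weak_partial D i (bump a r) g.
  by exists ('D_(ebase i) (bump a r)).
have ww i := weak_gradP (ex i).
have mw i : measurable_fun D (fun x => weak_grad D (bump a r) x ord0 i).
  by have [_ []] := ww i.
have mu_ : measurable_fun D (bump a r) by exact: open_continuous_measurable_rV oD (C1_on_continuous oD CD).
have uS : Lp_norm mu p D (bump a r) <= S.
  rewrite -[leRHS]mul1e; apply: Lp_norm_le_supp => //.
    by move=> x _; rewrite ger0_norm ?bump_le1// bump_ge0.
  move=> x _ nx; apply: bump_out => // xb; apply: nx; apply: le_ball xb.
  by rewrite ler_peMl ?ler1n// ltW.
have gS : Lp_norm mu p D (@enorm R N \o weak_grad D (bump a r)) <=
    (N%:R * (4 / r))%:E * S.
  apply: (le_trans (Lp_norm_enorm_le mu p1 mD mw)).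
  apply: (@le_trans _ _ (\sum_(i < N) (4 / r)%:E * S)); last first.
    rewrite -ge0_sume_distrl; last by move=> i _; rewrite lee_fin divr_ge0// ltW.
    by rewrite (sumEFin _ _ (fun _ => 4 / r)%R) sumr_const card_ord -[X in X%:E * _]mulr_natl lexx.
  apply: lee_sum => i _.
  apply: (@le_trans _ _ (Lp_norm mu p D ('D_(ebase i) (bump a r)))).
    apply: Lp_norm_le => //; first by have [_ []] := wp i.
    by apply: filterS (weak_partial_unique oD (ww i) (wp i)) => x h Dx; rewrite h.
  apply: Lp_norm_le_supp => //.
  - by rewrite divr_ge0// ltW.
  - by have [_ []] := wp i.
  - by move=> x _; exact: derive_bump_le.
  - by move=> x _; exact: derive_bump_out.
split.
  split => //; split => //; first exact: le_lt_trans Soo.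
    exact: measurable_enorm.
  by apply: (le_lt_trans gS); rewrite lte_mul_pinfty// lee_fin mulr_ge0// divr_ge0// ltW.
apply: (le_trans (leeD uS gS)).
rewrite -[X in X + _]mul1e -ge0_muleDl ?lee_fin ?mulr_ge0 ?divr_ge0 ?(ltW r0)//; last by rewrite invr_ge0 ltW.
have h : (1 + N%:R * (4 / r) <= (1 + 4 * N%:R) / r)%R.
  rewrite [leRHS]mulrDl mul1r (_ : N%:R * (4 / r) = 4 * N%:R / r)%R ?lerD2r; last first.
    by rewrite mulrA [(N%:R * 4)%R]mulrC.
  by rewrite -[leLHS]invr1 lef_pV2// posrE.
by apply: lee_wpmul2r => //; rewrite -[1]/(1%:E) -EFinD lee_fin.
Qed.

Lemma bump_nl_diff_le :
  embeds (sobolev p D) (sobolev_norm p D)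
    (nl_sobolev p D omega) (nl_sobolev_norm p D omega) ->
  exists2 C : R, (0 < C)%R & forall (a : V) (r : R) (i : 'I_N), (0 < r)%R ->
    (r <= 1)%R -> ball a (2 * r) `<=` D ->
    Lp_norm mu2 p (D `*` D) (nl_diff omega ('D_(ebase i) (bump a r))) <=
      (C / r)%:E * Lp_norm mu p (ball a (2 * r)) (cst 1%R).
Proof.
move=> [sub [C C0 hC]]; exists (C * (1 + 4 * N%:R))%R.
  by rewrite mulr_gt0// ltr_pwDl// mulr_ge0.
move=> a r i r0 r1 BD.
have [Xu uS] := bump_sobolev_norm_le r0 r1 BD.
have nn := nl_gradP (let: And3 _ ex _ := sub _ Xu in ex i).
have CD : C1_on D (bump a r) by apply: C1_on_subset (C1_on_bump a r).
have nw := weak_partial_nl oD adm (C1_on_weak_partial i oD CD).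
have mn j : measurable_fun (D `*` D) (fun z => nl_grad D omega (bump a r) z ord0 j).
  by have [_ []] := nl_gradP (let: And3 _ ex _ := sub _ Xu in ex j).
apply: (@le_trans _ _ (C%:E * sobolev_norm p D (bump a r))); last first.
  rewrite -mulrA EFinM -muleA; apply: lee_wpmul2l => //.
  by rewrite lee_fin ltW.
apply: (le_trans _ (hC _ Xu)).
apply: (@le_trans _ _ (Lp_norm mu2 p (D `*` D) (fun z => nl_grad D omega (bump a r) z ord0 i))).
  apply: Lp_norm_le => //; first by have [_ []] := nw.
  by apply: filterS (nl_weak_partial_unique oD nn nw) => x h Dx; rewrite h.
apply: (le_trans (Lp_norm_coord_le mu2 i p1 mDD mn)).
by rewrite /nl_sobolev_norm leeDr// Lp_norm_ge0.
Qed.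

End bump_energy.

Section powR_and_fatou.
Context {R : realType}.

Lemma cvg_powR (q t : R) : 0 < t -> x `^ q @[x --> t] --> t `^ q.
Proof.
move=> t0; have powE (x : R) : 0 < x -> x `^ q = expR (q * ln x).
  by move=> x0; rewrite /powR gt_eqF.
rewrite powE//; have c : expR (q * ln x) @[x --> t] --> expR (q * ln t).
  apply: (cvg_comp (fun x => q * ln x) expR); last exact: continuous_expR.
  by apply: cvgMr; exact: continuous_ln.
apply: cvg_trans c; apply: near_eq_cvg; near=> x; rewrite powE//.
by near: x; exact: (lt_nbhsr t0).
Unshelve. all: by end_near. Qed.

Lemma fatou_le d (T : measurableType d) (mu : {measure set T -> \bar R})
    (D : set T) (f : nat -> T -> R) (g : T -> R) (K : R) : measurable D ->
  (forall n, measurable_fun D (f n)) -> (forall n x, D x -> 0 <= f n x) ->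
  (forall x, D x -> f ^~ x @ \oo --> g x) ->
  (forall n, (\int[mu]_(x in D) (f n x)%:E <= K%:E)%E) ->
  (\int[mu]_(x in D) (g x)%:E <= K%:E)%E.
Proof.
move=> mD mf f0 fg fK.
rewrite (eq_integral (fun x => limn_einf (fun n => (f n x)%:E))); last first.
  move=> x /set_mem Dx; have := fg x Dx => h.
  have /cvg_limn_einf_sup[-> _] // : (fun n => (f n x)%:E) @ \oo --> (g x)%:E.
  by apply: cvg_EFin h; apply: nearW.
apply: le_trans (fatou mu mD _ _) _ => //.
  by move=> n; apply/measurable_EFinP.
rewrite limn_einf_lim; apply: lime_le; first exact: is_cvg_einfs.
near=> n; apply: le_trans (fK n); apply: ereal_inf_lbound.
by exists n => /=.
Unshelve. all: by end_near. Qed.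

End powR_and_fatou.

Section shell.
Context {R : realType} {N : nat}.
Local Notation V := 'rV[R]_N.
Local Notation mu := (lebesgue_rV R N).

(** A cube on which the derivatives of [bump a r] are comparable to [1 / r]; it
    shrinks to [a] with [r], at a volume proportional to that of a ball of
    radius [r]. *)
Definition shell (a : V) (r : R) : set V :=
  [set x | forall j, a ord0 j + r / 4 <= x ord0 j <= a ord0 j + 3 * r / 4].

Let shellE a r : shell a r = [set x : V | forall j,
  (`[a ord0 j + r / 4, a ord0 j + 3 * r / 4]%classic : set R) (x ord0 j)].
Proof. by apply/seteqP; split => x /= h j; have := h j; rewrite in_itv. Qed.

Lemma measurable_shell a r : measurable (shell a r).
Proof.
rewrite shellE.
by apply: (measurable_rV_box (A := fun j => `[a ord0 j + r / 4, a ord0 j + 3 * r / 4]%classic)).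
Qed.

Lemma lebesgue_rV_shell a r : 0 < r -> mu (shell a r) = ((r / 2) ^+ N)%:E.
Proof.
move=> r0; rewrite shellE (lebesgue_rV_box (A := fun j =>
  `[a ord0 j + r / 4, a ord0 j + 3 * r / 4]%classic))//.
rewrite (eq_bigr (fun=> (r / 2)%:E)) => [|i _].
  by rewrite prodEFin prodr_const card_ord.
rewrite lebesgue_measure_itv /= lte_fin ifT; last by lra.
by rewrite -EFinB; congr EFin; lra.
Qed.

Lemma shell_sub_ball a r : 0 < r -> shell a r `<=` ball a r.
Proof. by move=> r0 x h; apply/rV_ballP => // j; have := h j; rewrite ltr_norml; lra. Qed.

End shell.

Lemma div_shell_slope (R : realType) n (C r : R) :
  C / r = 8 ^+ n * C * ((1 / 8) ^+ n / r).
Proof.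
rewrite mulrA -mulrA [8 ^+ n * C]mulrC -!mulrA; congr (_ * _).
by rewrite mulrA -exprMn mul1r mulfV// expr1n mul1r.
Qed.

Section bump_nl_diff.
Context {R : realType} {N : nat}.
Local Notation V := 'rV[R]_N.
Local Notation mu := (lebesgue_rV R N).
Local Notation mu2 := (mu \x mu)%E.
Variables (D : set V) (omega : V * V -> R).
Hypothesis oD : open D.
Hypothesis adm : admissible_weight D omega.
Let mD := open_measurable_rV oD.
Let mDD : measurable (D `*` D) := measurableX mD mD.

Lemma nl_diff_bump_shell (a : V) (r : R) i (x y : V) : 0 < r -> D x -> D y ->
  shell a r x -> ~ ball a (2 * r) y ->
  omega (x, y) * ((1 / 8) ^+ N / r) <= `|nl_diff omega ('D_(ebase i) (bump a r)) (x, y)|.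
Proof.
move=> r0 Dx Dy Qx By; have [w0 _ _] := adm.
rewrite /nl_diff /= (derive_bump_out i r0 By) sub0r normrM normrN.
rewrite (ger0_norm (w0 _ _ Dx Dy)) ler_wpM2l ?w0//.
exact: derive_bump_shell.
Qed.

Local Open Scope ereal_scope.

(** Otherwise the integral over [y] exceeds [K] at every [x] of the shell, and
    so [`|nl_diff|] to the power [q] has integral at least of order
    [K * r ^ (N - q)], whereas the embedding bounds it by a multiple of
    [r ^ (N - q)]. *)
Lemma exists_shell_integral_le (q C : R) (i : 'I_N) : (1 <= q)%R -> (0 < C)%R ->
  (forall (a : V) (r : R), (0 < r)%R -> (r <= 1)%R -> ball a (2 * r) `<=` D ->
    Lp_norm mu2 q%:E (D `*` D) (nl_diff omega ('D_(ebase i) (bump a r))) <=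
      (C / r)%:E * Lp_norm mu q%:E (ball a (2 * r)) (cst 1%R)) ->
  exists2 K : R, (0 < K)%R & forall (a : V) (r : R), (0 < r)%R -> (r <= 1)%R ->
    ball a (2 * r) `<=` D -> exists2 x : V, shell a r x &
      \int[mu]_(y in D `\` ball a (2 * r)) (omega (x, y) `^ q)%:E <= K%:E.
Proof.
move=> q1 C0 hC; have q0 : (0 < q)%R by exact: lt_le_trans q1.
(* The two factors [8 ^+ N] come from the slope [(1 / 8) ^+ N / r] on the shell
   and from the ratio of the volumes [(4 * r) ^+ N] and [(r / 2) ^+ N]. *)
pose K := ((8 ^+ N * C) `^ q * 8 ^+ N + 1)%R.
have K0 : (0 < K)%R by rewrite ltr_wpDl// mulr_ge0// powR_ge0.
exists K => // a r r0 r1 BD; apply: contrapT => nex.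
set B := ball a (2 * r) in BD nex *; pose Q := shell a r; pose E := D `\` B.
have mB : measurable B by apply: measurable_rV_ball; rewrite mulr_gt0.
have mQ : measurable Q := measurable_shell a r.
have mE : measurable E by exact: measurableD.
have QD : Q `<=` D.
  apply: subset_trans (shell_sub_ball r0) (subset_trans _ BD).
  by apply: le_ball; rewrite ler_peMl ?ler1n// ltW.
have QED : Q `*` E `<=` D `*` D by move=> [x y] [/= Qx [Dy _]]; split => //; exact: QD.
have F_gt x : Q x -> K%:E <= \int[mu]_(y in E) (omega (x, y) `^ q)%:E.
  by move=> Qx; rewrite leNgt; apply/negP => /ltW h; apply: nex; exists x.
pose c := ((1 / 8) ^+ N / r : R)%R.
have c0 : (0 < c)%R by rewrite divr_gt0// exprn_gt0.
set g := nl_diff omega ('D_(ebase i) (bump a r)).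
have [w0 _ Cw] := adm.
have mw := measurable_weight oD adm.
have mg : measurable_fun (D `*` D) g.
  have CD : C1_on D (bump a r) by apply: C1_on_subset (C1_on_bump a r).
  by have [_ []] := weak_partial_nl oD adm (C1_on_weak_partial i oD CD).
have mwq : measurable_fun (Q `*` E) (fun z => (omega z `^ q)%:E).
  apply/measurable_EFinP; apply: (measurableT_comp (measurable_powR q)).
  exact: measurable_funS mw.
have upper : \int[mu2]_(z in D `*` D) (`|g z| `^ q)%:E <=
    ((C / r) `^ q * (4 * r) ^+ N)%:E.
  have -> : ((C / r) `^ q * (4 * r) ^+ N)%R =
      ((C / r * ((4 * r) ^+ N) `^ q^-1) `^ q)%R.
    have Cr0 : (0 <= C / r)%R by rewrite divr_ge0 ?(ltW C0) ?(ltW r0).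
    rewrite [RHS]powRM ?powR_ge0//.
    by rewrite -powRrM mulVf ?gt_eqF// powRr1// exprn_ge0// mulr_ge0// ltW.
  have r40 : (0 <= (4 * r) ^+ N)%R by rewrite exprn_ge0// mulr_ge0// ltW.
  apply/Lp_norm_fin_leP => //.
    by rewrite mulr_ge0 ?powR_ge0// divr_ge0 ?(ltW C0) ?(ltW r0).
  apply: (le_trans (hC a r r0 r1 BD)); rewrite [leRHS]EFinM.
  apply: lee_wpmul2l; first by rewrite lee_fin divr_ge0 ?(ltW C0) ?(ltW r0).
  apply/Lp_norm_fin_leP; rewrite ?powR_ge0//.
  rewrite -powRrM mulVf ?gt_eqF// powRr1//.
  under eq_integral do rewrite /= normr1 powR1.
  rewrite integral_cst// mul1e [leLHS]lebesgue_rV_ball; last by rewrite mulr_gt0.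
  by have -> : (2 * r *+ 2 = 4 * r)%R by ring.
have lower : ((c `^ q * K) * (r / 2) ^+ N)%:E <= \int[mu2]_(z in D `*` D) (`|g z| `^ q)%:E.
  have mgq := measurable_fun_powR q mg.
  apply: (@le_trans _ _ (\int[mu2]_(z in Q `*` E) (`|g z| `^ q)%:E)); last first.
    by apply: ge0_subset_integral => //; exact: measurableX.
  apply: (@le_trans _ _ (\int[mu2]_(z in Q `*` E) ((c `^ q)%:E * (omega z `^ q)%:E))); last first.
    apply: ge0_le_integral => //.
    - exact: measurableX.
    - by move=> z _; rewrite -EFinM lee_fin mulr_ge0 ?powR_ge0.
    - exact: measurable_funeM.
    - exact: measurable_funS mgq.
    move=> [x y] [/= Qx [Dy By]]; have Dx := QD x Qx; rewrite -EFinM lee_fin.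
    rewrite -powRM ?w0 ?(ltW c0)//; apply: ge0_ler_powR; rewrite ?nnegrE ?(ltW q0)//.
      by rewrite mulr_ge0 ?w0// ltW.
    by rewrite mulrC; exact: nl_diff_bump_shell.
  rewrite ge0_integralZl//; last 3 first.
  - exact: measurableX.
  - by move=> z _; rewrite lee_fin powR_ge0.
  - by rewrite lee_fin powR_ge0.
  rewrite -mulrA EFinM; apply: lee_wpmul2l; first by rewrite lee_fin powR_ge0.
  rewrite ge0_integral_prod12//; last by move=> z _; rewrite lee_fin powR_ge0.
  rewrite EFinM -(lebesgue_rV_shell a r0) -(integral_cst mu mQ K%:E).
  apply: ge0_le_integral => //.
  - by move=> x _; rewrite lee_fin ltW.
  - exact: (measurable_fun_integral12 mu mQ mE mwq).
have := le_trans lower upper; rewrite lee_fin.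
rewrite (div_shell_slope N C r) -/c.
have -> : (4 * r = 8 * (r / 2))%R by lra.
have C80 : (0 <= 8 ^+ N * C)%R by rewrite mulr_ge0 ?exprn_ge0 ?(ltW C0).
rewrite (exprMn N 8%R (r / 2)%R) (powRM q C80 (ltW c0)).
have cq0 : (0 < c `^ q)%R by exact: powR_gt0.
have r2 : (0 < (r / 2) ^+ N)%R by rewrite exprn_gt0// divr_gt0.
rewrite [X in (_ <= X)%R -> _](_ : _ = c `^ q * ((8 ^+ N * C) `^ q * 8 ^+ N) * (r / 2) ^+ N)%R; last by ring.
rewrite ler_pM2r// ler_pM2l// /K => h.
by move: h; rewrite gerDl ler10.
Qed.

End bump_nl_diff.

Section weight_bound.
Context {R : realType} {N : nat}.
Local Notation V := 'rV[R]_N.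
Local Notation mu := (lebesgue_rV R N).
Variables (D : set V) (omega : V * V -> R).
Hypothesis oD : open D.
Hypothesis adm : admissible_weight D omega.
Variable i : 'I_N.
Let mD := open_measurable_rV oD.
Local Open Scope ereal_scope.

Lemma lebesgue_rV_set1 (a : V) : mu [set a] = 0.
Proof.
have -> : [set a] = [set x : V | forall j, [set a ord0 j] (x ord0 j)].
  apply/seteqP; split => x /=; first by move=> ->.
  by move=> h; apply/rowP => j; exact: h.
rewrite (lebesgue_rV_box (A := fun j => [set a ord0 j]))//.
by rewrite (bigD1 i)//= lebesgue_measure_set1 mul0e.
Qed.

Lemma weight_continuous (x y : V) : D x -> D y -> {for (x, y), continuous omega}.
Proof.
by move=> Dx Dy; have [_ _ [dw _]] := adm; exact/differentiable_continuous/dw.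
Qed.

(** The points of smaller and smaller shells converge to [a]. Along them the
    integrands converge wherever [omega (a, y)] is positive and [y] differs from
    [a], and no other [y] contributes to the integral. *)
Lemma integral_weight_le (q K : R) (a : V) : (1 <= q)%R -> D a ->
  (forall r : R, (0 < r)%R -> (r <= 1)%R ->
    ball a (2 * r) `<=` D -> exists2 x : V, shell a r x &
      \int[mu]_(y in D `\` ball a (2 * r)) (omega (x, y) `^ q)%:E <= K%:E) ->
  \int[mu]_(y in D) (omega (a, y) `^ q)%:E <= K%:E.
Proof.
move=> q1 Da hK; have q0 : (0 < q)%R by exact: lt_le_trans q1.
have [w0 _ _] := adm.
have /nbhs_ballP[e /= e0 aeD] : nbhs a D by exact: open_nbhs_nbhs.
pose m := (Num.min 1 (e / 2))%R.
have m0 : (0 < m)%R by rewrite lt_min ltr01 divr_gt0.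
(* All radii are at most [e / 2], so that the doubled balls stay in [D]. *)
pose r n := (m * harmonic n)%R.
have r0 n : (0 < r n)%R by rewrite mulr_gt0// harmonic_gt0.
have rm n : (r n <= m)%R.
  by rewrite /r ler_piMr ?(ltW m0)// /harmonic /= invf_le1// ler1n.
have r1 n : (r n <= 1)%R by rewrite (le_trans (rm n))// ge_min lexx.
have rD n : ball a (2 * r n) `<=` D.
  apply: subset_trans aeD; apply: le_ball.
  by rewrite mulrC -ler_pdivlMr// (le_trans (rm n))// ge_min lexx orbT.
have rcvg : r @ \oo --> (0 : R)%R.
  rewrite -(mulr0 m); apply: cvgMr; exact: cvg_harmonic.
have /choice[x hx] : forall n, exists x : V, shell a (r n) x /\
    \int[mu]_(y in D `\` ball a (2 * r n)) (omega (x, y) `^ q)%:E <= K%:E.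
  by move=> n; have [x ? ?] := hK _ (r0 n) (r1 n) (rD n); exists x.
have xr n : ball a (r n) (x n) by apply: shell_sub_ball => //; have [] := hx n.
have Dx n : D (x n).
  by apply: (rD n); apply: le_ball (xr n); rewrite ler_peMl ?ler1n// ltW.
have xa : x @ \oo --> a.
  apply/cvg_ballP => d d0; near=> n; apply: le_ball (xr n).
  by near: n; apply: filterS (cvgr_lt (0 : R)%R rcvg d d0) => n /ltW.
have msec b : D b -> measurable_fun D (fun y => omega (b, y)).
  by move=> Db; exact: (measurable_fun_section1 oD (measurable_weight oD adm) Db).
pose E := (D `\` [set a]) `&` (fun y => omega (a, y)) @^-1` `]0%R, +oo[%classic.
have m1 : measurable [set a] by apply: compact_measurable_rV; exact: compact_set1.
have mE : measurable E.
  rewrite /E setDE -setIA [X in _ `&` X]setIC setIA; apply: measurableI.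
    exact: msec.
  exact: measurableC.
have mpow b : D b -> measurable_fun D (fun y => (omega (b, y) `^ q)%:E).
  move=> Db; apply/measurable_EFinP; apply: (measurableT_comp (measurable_powR q)).
  exact: msec.
have -> : \int[mu]_(y in D) (omega (a, y) `^ q)%:E =
    \int[mu]_(y in D `\` [set a]) (omega (a, y) `^ q)%:E.
  have aD : [set a] `<=` D by move=> _ ->.
  rewrite -[in LHS](setDUK aD) ge0_integral_setU//.
  - rewrite null_set_integral ?add0e//; last exact: lebesgue_rV_set1.
    exact: measurable_funS (mpow a Da).
  - exact: measurableD.
  - by rewrite setDUK//; exact: mpow.
  - by move=> y _; rewrite lee_fin powR_ge0.
  - by apply/disj_setPS => y [] /= ya [_].
rewrite (_ : \int[mu]_(y in _) _ = \int[mu]_(y in E) (omega (a, y) `^ q)%:E); last first.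
  rewrite integral_mkcond [RHS]integral_mkcond; apply: eq_integral => y _.
  rewrite !patchE; case: ifPn => [/set_mem Dy|nDy]; last first.
    by rewrite ifN//; apply: contra nDy => /set_mem[Dy _]; exact/mem_set.
  case: ifPn => // nE; have [Dy' ya] := Dy.
  suff -> : omega (a, y) = 0%R by rewrite powR0// gt_eqF.
  apply/eqP; rewrite eq_le w0// andbT leNgt; apply/negP => w.
  by move/negP: nE; apply; apply/mem_set; split => //=; rewrite in_itv /= andbT.
pose f n y := (\1_(~` ball a (2 * r n)) y * omega (x n, y) `^ q)%R.
have mB n : measurable (ball a (2 * r n)) by apply: measurable_rV_ball; rewrite mulr_gt0.
have mf n : measurable_fun D (f n).
  apply: measurable_funM; first by apply: measurable_indic; exact: measurableC.
  by apply/measurable_EFinP; exact: mpow.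
have ED : E `<=` D by move=> y [[]].
apply: (@fatou_le _ _ _ mu E f).
- exact: mE.
- by move=> n; exact: measurable_funS (mf n).
- by move=> n y _; rewrite /f mulr_ge0 ?powR_ge0// indicE.
- move=> y [[Dy ya] /=]; rewrite in_itv /= andbT => way.
  have c : (omega (x n, y) `^ q)%R @[n --> \oo] --> (omega (a, y) `^ q)%R.
    apply: (cvg_comp (fun n => omega (x n, y)) (fun t => t `^ q)%R); last exact: cvg_powR.
    apply: (cvg_comp (fun n => (x n, y)) omega); last exact: weight_continuous.
    exact: (cvg_pair xa (cvg_cst y)).
  apply: cvg_trans c; apply: near_eq_cvg.
  have d0 : (0 < `|a - y|)%R by rewrite normr_gt0 subr_eq0; apply/eqP => ay; exact: ya.
  have nd : ~ ball a `|a - y|%R y by rewrite -ball_normE /= ltxx.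
  near=> n; rewrite /f indicE mem_set ?mul1r//= => yB; apply: nd.
  apply: le_ball yB.
  near: n; apply: filterS (cvgr_lt (0 : R)%R rcvg _ (divr_gt0 d0 (ltr0Sn R 1))) => n.
  rewrite ltr_pdivlMr// mulrC; exact: ltW.
move=> n; apply: (@le_trans _ _ (\int[mu]_(y in D) (f n y)%:E)).
  apply: ge0_subset_integral => //; first exact/measurable_EFinP.
  by move=> y _; rewrite lee_fin /f mulr_ge0 ?powR_ge0// indicE.
have [_ hxn] := hx n; apply: le_trans hxn.
rewrite integral_mkcond [leRHS]integral_mkcond le_eqVlt; apply/orP; left; apply/eqP.
apply: eq_integral => y _; rewrite !patchE /f indicE.
have [By|nBy] := pselect (ball a (2 * r n) y).
  rewrite [y \in ~` _]memNset ?mul0r//.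
  by rewrite [in RHS]ifN//; [case: ifP|apply/negP => /set_mem[_ /(_ By)]].
rewrite [y \in ~` _]mem_set// mul1r; case: ifPn => [/set_mem Dy|nDy].
  by rewrite ifT//; exact/mem_set.
by rewrite ifN//; apply: contra nDy => /set_mem[Dy _]; exact/mem_set.
Unshelve. all: by end_near. Qed.

End weight_bound.

Section weight_ess_bound.
Context {R : realType} {N : nat}.
Local Notation V := 'rV[R]_N.
Local Notation mu := (lebesgue_rV R N).
Local Notation mu2 := (mu \x mu)%E.
Variables (D : set V) (omega : V * V -> R).
Hypothesis oD : open D.
Hypothesis adm : admissible_weight D omega.
Variable i : 'I_N.

(** If the bound fails at [(a, y)], it fails on a neighbourhood by continuity.
    A shell around [a] times a ball around [y] then carries values of the
    nonlocal derivative of a bump that exceed its essential bound, though it has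
    positive measure. *)
Lemma weight_le (C : R) (a y : V) :
  (forall (a : V) (r : R), 0 < r -> r <= 1 -> ball a (2 * r) `<=` D ->
    (Lp_norm mu2 +oo (D `*` D) (nl_diff omega ('D_(ebase i) (bump a r))) <=
      (C / r)%:E * Lp_norm mu +oo (ball a (2 * r)) (cst 1%R))%E) ->
  0 < C -> D a -> D y -> a <> y -> omega (a, y) <= 8 ^+ N * C.
Proof.
move=> hC C0 Da Dy ay; rewrite leNgt; apply/negP => way.
have [e e0 he] : exists2 e, 0 < e & ball (a, y) e `<=`
    (D `*` D) `&` [set z | 8 ^+ N * C < omega z].
  have /nbhs_ballP[e /= e0 he] : nbhs (a, y) ((D `*` D) `&` [set z | 8 ^+ N * C < omega z]).
    apply: filterI; first by apply: open_nbhs_nbhs; split => //; exact: openX.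
    exact: (cvgr_gt (omega (a, y)) (weight_continuous adm Da Dy) _ way).
  by exists e.
pose d := `|a - y|.
have d0 : 0 < d by rewrite normr_gt0 subr_eq0; exact/eqP.
(* The points of the shell are within [e] of [a], and the ball of radius [m] at
   [y] does not meet the ball of radius [2 r] at [a]. *)
pose m := Num.min e d / 4.
have m0 : 0 < m by rewrite divr_gt0// lt_min e0.
have me : m <= e / 4 by rewrite ler_pM2r ?invr_gt0// ge_min lexx.
have md : m <= d / 4 by rewrite ler_pM2r ?invr_gt0// ge_min lexx orbT.
pose r := Num.min 1 m.
have r0 : 0 < r by rewrite lt_min ltr01.
have r1 : r <= 1 by rewrite ge_min lexx.
have rm : r <= m by rewrite ge_min lexx orbT.
have rD : ball a (2 * r) `<=` D.
  move=> x xa; have [] // := he (x, y) _; last by case.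
  by split => /=; [apply: le_ball xa; lra|exact: ballxx].
have sub z : (shell a r `*` ball y m) z ->
    (D `*` D) z /\ C / r < `|nl_diff omega ('D_(ebase i) (bump a r)) z|.
  move: z => [x y'] [/= Qx yy'].
  have xa := shell_sub_ball r0 Qx.
  have [[/= Dx Dy'] w] : ((D `*` D) `&` [set z | 8 ^+ N * C < omega z]) (x, y').
    apply: he; split => /=; first by apply: le_ball xa; lra.
    by apply: le_ball yy'; lra.
  split; first by split.
  have nya : ~ ball a (2 * r) y'.
    move=> y'a; have : ball a (2 * r + m) y by exact: ball_triangle y'a (ball_sym yy').
    by rewrite -ball_normE /= -/d; lra.
  apply: (lt_le_trans _ (nl_diff_bump_shell adm i r0 Dx Dy' Qx nya)).
  rewrite (div_shell_slope N C r).
  by rewrite ltr_pM2r// divr_gt0// exprn_gt0.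
have nle : (Lp_norm mu2 +oo (D `*` D) (nl_diff omega ('D_(ebase i) (bump a r))) <= (C / r)%:E)%E.
  apply: (le_trans (hC a r r0 r1 rD)); rewrite -[leRHS]mule1.
  apply: lee_wpmul2l; first by rewrite lee_fin divr_ge0// ltW.
  by apply: Lp_norm_y_le => //; apply: aeW => x _; rewrite normr1.
have [A [mA A0 hA]] := Lp_norm_y_ae setT2_gt0 nle.
have : (mu2 (shell a r `*` ball y m) <= mu2 A)%E.
  apply: le_measure; rewrite ?inE//.
    by apply: measurableX; [exact: measurable_shell|exact: measurable_rV_ball].
  by move=> z /sub[Dz lt]; apply: hA => /= /(_ Dz); rewrite leNgt lt.
rewrite [leRHS]A0 leNgt => /negP; apply.
rewrite [ltRHS](product_measure1E mu mu (measurable_shell a r) (measurable_rV_ball y m0)).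
rewrite [X in (_ < X * _)%E]lebesgue_rV_shell// [X in (_ < _ * X)%E]lebesgue_rV_ball//.
by rewrite -EFinM lte_fin mulr_gt0// exprn_gt0// ?divr_gt0// pmulrn_lgt0.
Qed.

End weight_ess_bound.

Section embedding_weight_bound.
Context {R : realType} {N : nat}.
Local Notation V := 'rV[R]_N.
Local Notation mu := (lebesgue_rV R N).
Variables (D : set V) (omega : V * V -> R) (p : \bar R).
Hypotheses (p1 : (1 <= p)%E) (D0 : D !=set0) (oD : open D).
Hypothesis adm : admissible_weight D omega.
Local Open Scope ereal_scope.

Lemma embedding_weight_bound_pos (i : 'I_N) :
  embeds (sobolev p D) (sobolev_norm p D)
    (nl_sobolev p D omega) (nl_sobolev_norm p D omega) ->
  exists2 K : R, (0 < K)%R & forall x, D x -> weight_fun p D omega x <= K%:E.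
Proof.
move=> /(bump_nl_diff_le p1 oD adm)[C C0 hC].
have {}hC a r := hC a r i.
case: p p1 hC => [q||]//; rewrite ?lee_fin => q1 hC.
  have [K K0 hK] := exists_shell_integral_le oD adm q1 C0 hC.
  exists K => // a Da; apply: (integral_weight_le oD adm i q1 Da) => r r0 r1.
  exact: hK.
have [w0 _ _] := adm.
have C80 : (0 < 8 ^+ N * C)%R by rewrite mulr_gt0// exprn_gt0.
exists (8 ^+ N * C)%R => // a Da; apply/ess_supP.
exists [set a]; split.
- by apply: compact_measurable_rV; exact: compact_set1.
- exact: lebesgue_rV_set1.
move=> y /= nle; apply: contrapT => ya; apply: nle; rewrite patchE.
case: ifPn => [/set_mem Dy|_]; last by rewrite lee_fin ltW.
by rewrite lee_fin; apply: (weight_le oD adm hC) => // ay; apply: ya.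
Qed.

(** The only point of the space carries all the measure. *)
Lemma weight_bound_dim0 : N = 0%N -> (p < +oo -> mu D < +oo) ->
  exists2 K : R, (0 < K)%R & forall x, D x -> weight_fun p D omega x <= K%:E.
Proof.
move=> N0 finD; have [a Da] := D0.
have e (x : V) : x = a by apply/rowP => j; exfalso; move: j; rewrite N0 => -[].
have mD := open_measurable_rV oD.
have [w0 _ _] := adm.
suff [K hK] : exists K : R, weight_fun p D omega a <= K%:E.
  exists (`|K| + 1)%R; first by rewrite ltr_wpDl.
  move=> x _; rewrite (e x); apply: (le_trans hK).
  by rewrite lee_fin (le_trans (ler_norm _))// lerDl.
case: p p1 finD => [q||]//= q1 finD; last first.
  exists (omega (a, a)); apply/ess_supP; apply: aeW => y /=; rewrite (e y) patchE.
  by case: ifP; rewrite ?lee_fin ?w0.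
exists (fine (\int[mu]_(y in D) (omega (a, y) `^ q)%:E)).
rewrite (eq_integral (cst (omega (a, a) `^ q)%:E)); last by move=> y _; rewrite (e y).
rewrite integral_cst// fineK// fin_numM// ge0_fin_numE//.
exact/finD/ltry.
Qed.

End embedding_weight_bound.

Theorem theorem1p3 (R : realType) (N : nat) (p : \bar R)
    (Omega : set 'rV[R]_N) (omega : 'rV[R]_N * 'rV[R]_N -> R)
    (p_ge1 : (1 <= p)%E)
    (Omega_nonempty : Omega !=set0) (Omega_open : open Omega)
    (Omega_finite : (p < +oo)%E -> (lebesgue_rV R N Omega < +oo)%E)
    (omega_adm : admissible_weight Omega omega) :
  ((exists2 k : R, 0 < k &
      forall x y, Omega x -> Omega y -> k <= omega (x, y)) ->
    embeds (nl_sobolev p Omega omega) (nl_sobolev_norm p Omega omega)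
      (sobolev p Omega) (sobolev_norm p Omega)) /\
  (embeds (sobolev p Omega) (sobolev_norm p Omega)
      (nl_sobolev p Omega omega) (nl_sobolev_norm p Omega omega) <->
    exists2 K : R, 0 < K &
      forall x, Omega x -> (weight_fun p Omega omega x <= K%:E)%E).
Proof.
split=> [[k k0 k_le]|].
  apply: (@nl_sobolev_embeds_sobolev _ _ _ _ _ k) => //.
  by move=> [x y] [/= Dx Dy]; exact: k_le.
split=> [emb|[K K0 wK]]; last exact: sobolev_embeds_nl_sobolev wK.
have [N0|] := eqVneq N 0; first exact: weight_bound_dim0.
rewrite -lt0n => N_gt0.
exact: (embedding_weight_bound_pos p_ge1 Omega_open omega_adm (Ordinal N_gt0) emb).
Qed.
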